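(* Let $(X,d,\mu)$ be a complete, doubling metric measure space supporting a $(1,1)$-Poincaré inequality. Let $0<\theta<1$ and $1\le q\le Q_d/(Q_d-\theta)$, where $Q_d>1$ is the relative lower mass bound exponent of $\mu$. Then there exist constants $C\ge 1$ and $\tau\ge 1$, depending only on the doubling constant and the constants of the $(1,1)$-Poincaré inequality, such that for all balls $B=B(x_0,r)\subset X$ and all $u\in L^1_{\mathrm{loc}}(X)$, $$\left(\frac{1}{\mu(B)}\int_{B}|u-u_{B}|^q\,d\mu\right)^{1/q}\le C(1-\theta)\,r^\theta\,\frac{1}{\mu(\tau B)}\int_{\tau B}\int_{\tau B}\frac{|u(x)-u(y)|}{d(x,y)^\theta\,\mu(B(x,d(x,y)))}\,d\mu(y)\,d\mu(x).$$
   Context: A metric measure space $(X,d,\mu)$ is a metric space with a Borel regular outer measure $\mu$. Balls $B(x,r)=\{y\in X:d(x,y)<r\}$ are open and come with a prescribed center and radius; for $B=B(x,r)$, $\lambda B:=B(x,\lambda r)$ and $\mathrm{rad}(B):=r$. The measure $\mu$ is doubling with constant $C_\mu\ge1$ if $0<\mu(B(x,2r))\le C_\mu\,\mu(B(x,r))<\infty$ for all $x\in X$, $r>0$. We write $u_B=\frac1{\mu(B)}\int_B u\,d\mu$. $L^1_{\mathrm{loc}}(X)$ consists of the functions integrable on every open set with compact closure (complete doubling spaces are proper, so equivalently on every ball). Relative lower mass bound exponent: if $\mu$ is doubling there exist $C_0\ge1$ and $Q_d>1$, depending only on $C_\mu$, such that $\frac{\mu(B(y,r))}{\mu(B(x,R))}\ge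 C_0^{-1}\left(\frac rR\right)^{Q_d}$ for all $x\in X$, $0<r\le R<\infty$, $y\in B(x,R)$; $Q_d$ denotes this (fixed) exponent. A Borel function $g:X\to[0,\infty]$ is an upper gradient of $u:X\to[-\infty,\infty]$ if $|u(\gamma(b))-u(\gamma(a))|\le\int_\gamma g\,ds$ for all non-constant compact rectifiable curves $\gamma:[a,b]\to X$ (with $\int_\gamma g\,ds=\infty$ required if $u(\gamma(a))$ or $u(\gamma(b))$ is not finite). $(X,d,\mu)$ supports a $(1,1)$-Poincaré inequality if there are constants $C_P,\tau_P\ge1$ such that $\frac1{\mu(B)}\int_B|u-u_B|\,d\mu\le C_P\,\mathrm{rad}(B)\,\frac1{\mu(\tau_PB)}\int_{\tau_PB}g\,d\mu$ for every ball $B$, every $u\in L^1_{\mathrm{loc}}(X)$ and every upper gradient $g$ of $u$. The integrand of the double integral is read as $0$ on the diagonal $x=y$. *)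

(* Defs.v *)
From HB Require Import structures.
From mathcomp Require Import all_boot all_order all_algebra.
From mathcomp Require Import all_classical all_reals all_analysis.
From mathcomp Require Import measurable_realfun.

Set Implicit Arguments.
Unset Strict Implicit.
Unset Printing Implicit Defensive.

Import Order.TTheory GRing.Theory Num.Theory.
Import numFieldNormedType.Exports.

Local Open Scope classical_set_scope.
Local Open Scope ring_scope.

(* The library builds the Caratheodory sigma-algebra of an outer measure, and
   its complete uniform spaces, on pointed types only; hence the base point.
   It plays no role below: an empty space has no balls. *)
#[short(type="pointedMetricType")]
HB.structure Definition PointedMetric (R : numDomainType) :=
  {M of Metric R M & isPointed M}.

#[short(type="completeMetricType")]
HB.structure Definition CompleteMetric (R : numDomainType) :=
  {M of Metric R M & Complete M}.

Section curves.
Context {R : realType} {X : metricType R}.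
Implicit Types (gamma : R -> X) (a b s : R).

Definition curve_length gamma a b : \bar R :=
  ereal_sup [set (\sum_(0 <= n < size s)
                    mdist (gamma (nth b (a :: s) n))
                          (gamma (nth b (a :: s) n.+1)))%:E
            | s in itv_partition a b].

Definition nonconstant_rectifiable_curve gamma a b :=
  [/\ a <= b,
      {within `[a, b], continuous gamma},
      (exists s t, [/\ s \in `[a, b], t \in `[a, b] & gamma s <> gamma t]) &
      (curve_length gamma a b < +oo)%E].

(* For a rectifiable curve and 0 <= s <= its length, the set below is a nonempty
   compact interval on which gamma is constant. *)
Definition arc_length_param gamma a b s : X :=
  gamma (sup [set t | t \in `[a, b] /\ curve_length gamma a t = s%:E]).

Definition line_integral (g : X -> \bar R) gamma a b : \bar R :=
  (\int[lebesgue_measure]_(s in `[0%R, fine (curve_length gamma a b)])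
     g (arc_length_param gamma a b s))%E.

End curves.

Section metric_measure_space.
Context {R : realType} {X : pointedMetricType R}.
Variable mu : {outer_measure set X -> \bar R}.

Definition borel_set : set (set X) := <<s [set U : set X | open U] >>.

Definition borel_function (g : X -> \bar R) :=
  forall Y : set (\bar R), measurable Y -> borel_set (g @^-1` Y).

Definition borel_regular :=
  borel_set `<=` mu.-caratheodory /\
  forall A : set X, exists B : set X, [/\ borel_set B, A `<=` B & mu A = mu B].

(* mu restricted to its Caratheodory-measurable sets *)
Definition cara_measure :
    {measure set (caratheodory_type mu) -> \bar R} :=
  (mu : set (caratheodory_type mu) -> \bar R).

Definition mint (A : set X) (f : X -> \bar R) : \bar R :=
  (\int[cara_measure]_(x in (A : set (caratheodory_type mu))) f x)%E.

Definition mean (A : set X) (f : X -> \bar R) : \bar R :=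
  ((fine (mu A))^-1%:E * mint A f)%E.

Definition L1loc (u : X -> \bar R) :=
  forall U : set X, open U -> compact (closure U) ->
    cara_measure.-integrable (U : set (caratheodory_type mu)) u.

Definition doubling (Cmu : R) :=
  1 <= Cmu /\
  forall (x : X) (r : R), 0 < r ->
    [/\ 0 < mu (ball x (2 * r)%R),
        mu (ball x (2 * r)%R) <= Cmu%:E * mu (ball x r) &
        Cmu%:E * mu (ball x r) < +oo]%E.

Definition relative_lower_mass_bound (C0 Q : R) :=
  forall (x y : X) (r r' : R), 0 < r -> r <= r' -> ball x r' y ->
    C0^-1 * (r / r') `^ Q <= fine (mu (ball y r)) / fine (mu (ball x r')).

Definition upper_gradient (g u : X -> \bar R) :=
  [/\ borel_function g,
      (forall x, 0 <= g x)%E &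
      forall (gamma : R -> X) (a b : R),
        nonconstant_rectifiable_curve gamma a b ->
        (u (gamma a) \is a fin_num -> u (gamma b) \is a fin_num ->
           `|u (gamma b) - u (gamma a)| <= line_integral g gamma a b)%E /\
        (~~ ((u (gamma a) \is a fin_num) && (u (gamma b) \is a fin_num)) ->
           line_integral g gamma a b = +oo%E)].

Definition poincare11 (CP tauP : R) :=
  [/\ 1 <= CP, 1 <= tauP &
      forall (x : X) (r : R), 0 < r ->
      forall u g : X -> \bar R, L1loc u -> upper_gradient g u ->
        (mean (ball x r) (fun y => `|u y - mean (ball x r) u|)
         <= (CP * r)%:E * mean (ball x (tauP * r)) g)%E].

Definition fractional_kernel (theta : R) (u : X -> \bar R) (x y : X) : \bar R :=
  if x == y then 0%E
  else (`|u x - u y| *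
        (mdist x y `^ theta * fine (mu (ball x (mdist x y))))^-1%:E)%E.

End metric_measure_space.

(* Main.v *)
Require Import Defs.
From HB Require Import structures.
From mathcomp Require Import all_boot all_order all_algebra.
From mathcomp Require Import all_classical all_reals all_analysis.
From mathcomp Require Import measurable_realfun ring lra.

(** The kernel [1 / (d^th * mu (B (x, d)))] dominates the supremum [k] of
    [s^(-th) / mu (B (x, s))] over the dyadic scales [s > d(x, y)], and the
    double integral is bounded below by the energy [P (u; O)] built from [k].

    For a set [E] with density bounded away from 0 and 1 in a ball of radius
    [rho], the (1,1)-Poincare inequality for the Lipschitz regularisation of
    [1_E] at scale [s <= rho] shows that the part of the energy carried by the
    pairs with [d(x, y) < s] is at least a multiple of [s / rho * mu (B)].
    Telescoping [k] over all scales below [rho], the contributions form a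
    geometric series of ratio [2^(th - 1)], whose sum produces the factor
    [1 / (1 - th)]:
      [mu (B) * rho^(-th) <= C * (1 - th) * P (1_E; (tauP + 2) B)].

    If [E] fills at most half of [B], almost every point of [E] in [B] is the
    center of a ball of intermediate density; a Vitali covering by such balls
    and the relative lower mass bound give a boxing inequality
      [(mu (E & B) / mu (B))^(1/q) <=
         C * (1 - th) * r^th / mu (B) * P (1_E; tau B)].
    Integrating it over the superlevel sets of [u - m0] and [m0 - u], with [m0]
    a median of [u] on [B], gives the claim for [m0] in place of the mean, and
    the case [q = 1] controls the distance from [m0] to the mean. *)

(** A set of finite fractional energy may have infinite perimeter, so the Poincare inequality is
    applied to a regularisation at a fixed scale, at the price of the factor [s / rho]. Charging a
    single scale would not produce the factor [1 - th], and charging every scale separately would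
    count the same pairs many times. The increments of [s^(-th)] between consecutive scales are the
    weights that avoid both: with them, all scales together stay below the one kernel [k].

    The kernel [k] does not involve [u] and is a countable supremum of measurable functions.
    Tonelli, superadditivity over disjoint balls and the coarea argument are carried out for [k];
    the original integrand enters only through a pointwise comparison.

    The role of the Lebesgue differentiation theorem is taken by the energy itself: a point of [E]
    at which [E] has density at most one half at every scale has an infinite energy integral, so
    such points form a null set as soon as the energy is finite. The restriction on [q] enters only
    as the numerical inequality [Q * (1 - 1 / q) <= th]. *)

Set Implicit Arguments.
Unset Strict Implicit.
Unset Printing Implicit Defensive.

Import Order.TTheory GRing.Theory Num.Theory.
Import numFieldNormedType.Exports.

Local Open Scope classical_set_scope.
Local Open Scope ring_scope.

(** * Curves and upper gradients *)

Section curve_length_theory.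
Context {R : realType} {X : metricType R}.
Implicit Types (gamma : R -> X) (a b c t : R) (s : seq R).

(** Recursive form of the sum in [curve_length]. The starting point is an argument, so that
    inductions over a partition can move it. *)
Fixpoint polygonal_length gamma a s : R :=
  if s is h :: s' then mdist (gamma a) (gamma h) + polygonal_length gamma h s'
  else 0.

Lemma polygonal_lengthE gamma a b s :
  \sum_(0 <= n < size s) mdist (gamma (nth b (a :: s) n))
                               (gamma (nth b (a :: s) n.+1)) =
  polygonal_length gamma a s.
Proof.
elim: s a => [a|h s ih a] /=; first by rewrite big_geq.
by rewrite big_nat_recl//= ih.
Qed.

Lemma polygonal_length_cat gamma a s1 s2 :
  polygonal_length gamma a (s1 ++ s2) =
  polygonal_length gamma a s1 + polygonal_length gamma (last a s1) s2.
Proof. by elim: s1 a => [a|h s ih a] /=; rewrite ?add0r// ih addrA. Qed.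

Lemma polygonal_length_ge0 gamma a s : 0 <= polygonal_length gamma a s.
Proof. by elim: s a => //= h s ih a; rewrite addr_ge0// mdist_ge0. Qed.

Lemma curve_lengthE gamma a b : curve_length gamma a b =
  ereal_sup [set (polygonal_length gamma a s)%:E | s in itv_partition a b].
Proof.
congr ereal_sup; apply/seteqP; split => _ [s abs <-]; exists s => //;
by rewrite -(polygonal_lengthE _ _ b).
Qed.

Lemma polygonal_length_le gamma a b s : itv_partition a b s ->
  ((polygonal_length gamma a s)%:E <= curve_length gamma a b)%E.
Proof. by move=> abs; rewrite curve_lengthE; apply: ereal_sup_ubound; exists s. Qed.

Lemma mdist_le_curve_length gamma a b : a <= b ->
  ((mdist (gamma a) (gamma b))%:E <= curve_length gamma a b)%E.
Proof.
rewrite le_eqVlt => /predU1P[<-|ab].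
  have := @polygonal_length_le gamma a a [::]; rewrite mdistxx; apply.
  by split.
have := @polygonal_length_le gamma a b [:: b]; rewrite /= addr0; apply.
exact: itv_partition1.
Qed.

Lemma curve_length_ge0 gamma a b : a <= b -> (0 <= curve_length gamma a b)%E.
Proof.
by move=> ab; apply: (le_trans _ (mdist_le_curve_length gamma ab)); rewrite lee_fin mdist_ge0.
Qed.

Lemma curve_lengthxx gamma a : curve_length gamma a a = 0%E.
Proof.
apply/eqP; rewrite eq_le curve_length_ge0// andbT curve_lengthE.
by apply: ge_ereal_sup => _ [s /itv_partitionxx -> <-].
Qed.

(** Partitions of the two pieces concatenate; the two suprema are then taken one after the other. *)
Lemma curve_length_superadditive gamma a c b : a <= c -> c <= b ->
  (curve_length gamma a c + curve_length gamma c b <= curve_length gamma a b)%E.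
Proof.
move=> ac cb.
have [->|] := eqVneq (curve_length gamma a b) +oo%E; first by rewrite leey.
rewrite -ltey => fin.
have H s1 s2 : itv_partition a c s1 -> itv_partition c b s2 ->
    ((polygonal_length gamma a s1)%:E + (polygonal_length gamma c s2)%:E
       <= curve_length gamma a b)%E.
  move=> acs cbs; rewrite -EFinD.
  have -> : polygonal_length gamma a s1 + polygonal_length gamma c s2 =
            polygonal_length gamma a (s1 ++ s2).
    by rewrite polygonal_length_cat; case: acs => _ /eqP ->.
  exact/polygonal_length_le/(itv_partition_cat acs cbs).
have H1 s1 : itv_partition a c s1 ->
    ((polygonal_length gamma a s1)%:E + curve_length gamma c b
       <= curve_length gamma a b)%E.
  move=> acs; rewrite -leeBrDl//.
  rewrite [leLHS]curve_lengthE; apply: ge_ereal_sup => _ [s2 cbs <-].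
  by rewrite leeBrDl// H.
(* The second supremum is taken after subtracting this length, which therefore has to be finite; the
   partition [[:: c]] of the first piece bounds it. *)
have cbfin : curve_length gamma c b \is a fin_num.
  rewrite ge0_fin_numE ?curve_length_ge0//; apply: le_lt_trans fin.
  move: ac; rewrite le_eqVlt => /predU1P[->//|ac].
  apply: le_trans (H1 [:: c] (itv_partition1 ac)).
  by rewrite leeDr// lee_fin polygonal_length_ge0.
rewrite -leeBrDr// [leLHS]curve_lengthE; apply: ge_ereal_sup => _ [s1 acs <-].
by rewrite leeBrDr// H1.
Qed.

(** The point [c] is inserted into a given partition: nodes before [c] are peeled off by induction,
    and the first node from [c] on is reached through [c] by the triangle inequality. *)
Lemma curve_length_subadditive gamma a c b : a <= c -> c <= b ->
  (curve_length gamma a b <= curve_length gamma a c + curve_length gamma c b)%E.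
Proof.
move=> ac cb; rewrite [leLHS]curve_lengthE; apply: ge_ereal_sup => _ [s abs <-].
elim: s a ac abs => [a ac|h s ih a ac abs] /=.
  by move=> _; rewrite adde_ge0 ?curve_length_ge0.
have [ah hs] : a < h /\ itv_partition h b s.
  by case: abs => /= /andP[ah hs] hb; split.
have [ch|hc] := leP c h.
  apply: (@le_trans _ _ ((mdist (gamma a) (gamma c))%:E +
    (mdist (gamma c) (gamma h) + polygonal_length gamma h s)%:E)%E).
    by rewrite -EFinD lee_fin addrA lerD2r metric_triangle.
  apply: leeD; first exact: mdist_le_curve_length.
  move: ch; rewrite le_eqVlt => /predU1P[->|ch].
    by rewrite mdistxx add0r polygonal_length_le.
  apply: (@polygonal_length_le gamma c b (h :: s)).
  by case: hs => hs hb; split => //=; rewrite ch.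
rewrite EFinD; apply: (le_trans (leeD (lexx _) (ih _ (ltW hc) hs))).
rewrite addeA leeD2r//.
apply: le_trans (curve_length_superadditive gamma (ltW ah) (ltW hc)).
by rewrite leeD2r// mdist_le_curve_length// ltW.
Qed.

Lemma within_continuous_mdist gamma a b t : {within `[a, b], continuous gamma} ->
  t \in `[a, b] -> forall e : R, 0 < e -> exists2 d : R, 0 < d &
  forall t', t' \in `[a, b] -> `|t - t'| < d -> mdist (gamma t) (gamma t') < e.
Proof.
move=> /subspace_continuousP/(_ t) + tab e e0 => /(_ tab).
move=> /(_ (ball (gamma t) e))[|d /= d0 H]; first exact: nbhsx_ballx.
exists d => // t' t'ab tt'; have := H t' tt' t'ab.
by rewrite /= ballEmdist.
Qed.

Section rectifiable.
Variables (gamma : R -> X) (a b : R).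
Hypotheses (ab : a <= b) (cgamma : {within `[a, b], continuous gamma}).
Hypothesis rect : (curve_length gamma a b < +oo)%E.

Let len t t' := fine (curve_length gamma t t').

Let fin_curve t t' : a <= t -> t <= t' -> t' <= b ->
  curve_length gamma t t' \is a fin_num.
Proof.
move=> at_ tt' t'b; rewrite ge0_fin_numE ?curve_length_ge0//.
apply: le_lt_trans rect.
apply: le_trans (curve_length_superadditive gamma (le_trans at_ tt') t'b).
apply: (@le_trans _ _ (curve_length gamma a t')); last first.
  by rewrite leeDl// curve_length_ge0.
apply: le_trans (curve_length_superadditive gamma at_ tt').
by rewrite leeDr// curve_length_ge0.
Qed.

Let lenE t t' : a <= t -> t <= t' -> t' <= b ->
  curve_length gamma t t' = (len t t')%:E.
Proof. by move=> *; rewrite /len fineK// fin_curve. Qed.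

Let lenD t t' t'' : a <= t -> t <= t' -> t' <= t'' -> t'' <= b ->
  len t t'' = len t t' + len t' t''.
Proof.
move=> at_ tt' t't'' t''b; apply: EFin_inj; rewrite EFinD -!lenE//.
- by apply/eqP; rewrite eq_le curve_length_subadditive// curve_length_superadditive.
- exact: le_trans tt'.
- exact: le_trans t''b.
- exact: le_trans t't''.
Qed.

Let mdist_len t t' : a <= t -> t <= t' -> t' <= b ->
  mdist (gamma t) (gamma t') <= len t t'.
Proof. by move=> *; rewrite -lee_fin -lenE// mdist_le_curve_length. Qed.

(** Intermediate value property of the length function, drawn directly from the continuity of
    [gamma]: the supremum of the times of length at most [s] has length exactly [s]. *)
Lemma arc_length_surj (s : R) : 0 <= s -> s <= len a b ->
  exists2 t, t \in `[a, b] & curve_length gamma a t = s%:E.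
Proof.
move=> s0 sL; pose S := [set t | t \in `[a, b] /\ len a t <= s].
have Sa : S a by rewrite /S/= in_itv/= lexx ab /len curve_lengthxx.
have supS : has_sup S by split; [exists a|exists b => t [] + _; rewrite in_itv/= => /andP[]].
set tau := sup S.
have atau : a <= tau by apply: ub_le_sup => //; case: supS.
have taub : tau <= b by apply: sup_le_ub; [exists a|move=> t []; rewrite in_itv/= => /andP[]].
have tauab : tau \in `[a, b] by rewrite in_itv/= atau.
exists tau => //; rewrite lenE//; congr EFin; apply/eqP; rewrite eq_le; apply/andP; split.
(* Length at most [s]: in a partition ending at [tau], the last node is moved back to a nearby [t]
   in [S], beyond the previous node [p]. By continuity this costs less than [e]. *)
- move: atau; rewrite [a <= tau]le_eqVlt => /predU1P[<-|atau]; first by rewrite /len curve_lengthxx.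
  have at_ := ltW atau; rewrite -lee_fin -lenE// curve_lengthE; apply: ge_ereal_sup => _ [sg [psg lsg] <-].
  rewrite lee_fin; apply/ler_addgt0Pl => e e0.
  case/lastP: sg psg lsg => [|sg x] /=; first by move=> _ /eqP atau'; rewrite atau' ltxx in atau.
  rewrite rcons_path last_rcons => /andP[psg lx] /eqP xtau; subst x.
  set p := last a sg in lx.
  have ap : a <= p.
    by apply: (@itv_partition_le _ _ a p sg); split.
  have [d d0 Hd] := within_continuous_mdist cgamma tauab e0.
  have m0 : 0 < Num.min d (tau - p) by rewrite lt_min d0 subr_gt0.
  have [t St] := sup_adherent m0 supS; rewrite -/tau => tt.
  have ttau : t <= tau by apply: ub_le_sup => //; case: supS.
  have pt : p <= t.
    apply: ltW; apply: le_lt_trans tt; rewrite lerBrDr -lerBrDl.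
    by rewrite ge_min lexx orbT.
  have dt : tau - t < d.
    by rewrite ltrBlDr -ltrBlDl; apply: le_lt_trans tt; rewrite lerD2l lerN2 ge_min lexx.
  case: St => tab lt.
  have et : mdist (gamma tau) (gamma t) < e by apply: Hd => //; rewrite ger0_norm ?subr_ge0.
  rewrite -cats1 polygonal_length_cat /= addr0 -/p.
  have pb : p <= b := le_trans (ltW lx) taub.
  have tb : t <= b := le_trans ttau taub.
  have h1 : polygonal_length gamma a sg <= len a p.
    rewrite -lee_fin -lenE//.
    by apply: polygonal_length_le; split.
  have h2 : mdist (gamma p) (gamma t) <= len p t by exact: mdist_len.
  have h3 := @metric_triangle _ _ (gamma p) (gamma t) (gamma tau).
  have h4 : len a t = len a p + len p t by exact: lenD.
  by rewrite (metric_sym (gamma t)) in h3; lra.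
(* Otherwise a gap of [3 * e] is left. A partition of [[tau, b]] that is optimal up to [e] has its
   first segment cut at a point [t] within [e] of [tau]; the arc from [tau] to [t] then has length
   below [2 * e], so [t] still lies in [S], beyond its supremum. *)
- rewrite leNgt; apply/negP => lts.
  have taub' : tau < b.
    by rewrite lt_neqAle taub andbT; apply/eqP => tb; rewrite tb in lts; lra.
  pose e := (s - len a tau) / 3.
  have e0 : 0 < e by rewrite divr_gt0// subr_gt0.
  have : (curve_length gamma tau b - e%:E < curve_length gamma tau b)%E.
    by rewrite lteBlDr ?fin_curve// lteDl ?fin_curve// lte_fin.
  rewrite [X in (_ < X)%E]curve_lengthE => /ereal_sup_gt[_ [[|h sg] [psg lsg] <-]].
    by move: lsg => /= /eqP tb; rewrite tb ltxx in taub'.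
  move: psg => /= /andP[tauh psg].
  rewrite lenE// -EFinB lte_fin => hl.
  have hb : h <= b by apply: (@itv_partition_le _ _ h b sg); split.
  have [d d0 Hd] := within_continuous_mdist cgamma tauab e0.
  pose t := Num.min (tau + d / 2) h.
  have taut : tau < t by rewrite lt_min tauh andbT ltrDl divr_gt0.
  have th : t <= h by rewrite ge_min lexx orbT.
  have tab : t \in `[a, b] by rewrite in_itv/= (le_trans atau (ltW taut)) (le_trans th).
  have et : mdist (gamma tau) (gamma t) < e.
    apply: Hd => //; rewrite ler0_norm ?opprB ?subr_le0 ?ltW//.
    rewrite ltrBlDl; apply: (@le_lt_trans _ _ (tau + d / 2)); first by rewrite ge_min lexx.
    by rewrite ltrD2l; lra.
  have h1 : mdist (gamma t) (gamma h) <= len t h.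
    by apply: mdist_len => //; move: tab; rewrite in_itv/= => /andP[].
  have h2 : polygonal_length gamma h sg <= len h b.
    rewrite -lee_fin -lenE//; first by apply: polygonal_length_le; split.
    by rewrite (le_trans atau)// ltW.
  have h3 := @metric_triangle _ _ (gamma tau) (gamma t) (gamma h).
  move: (tab); rewrite in_itv/= => /andP[at_ tb].
  have h4 : len t b = len t h + len h b by exact: lenD.
  have h5 : len a b = len a t + len t b by exact: lenD.
  have h6 : len a b = len a tau + len tau b by exact: lenD.
  have : len a t <= s by rewrite /e in et hl; lra.
  move=> lt; suff : t <= tau by rewrite leNgt taut.
  by apply: ub_le_sup => //; case: supS.
Qed.

(** Two times with the same length from [a] enclose an arc of length zero, so [gamma] agrees at
    both; continuity carries the common value to the supremum. *)
Lemma arc_length_paramE (s t : R) : t \in `[a, b] -> curve_length gamma a t = s%:E ->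
  arc_length_param gamma a b s = gamma t.
Proof.
move=> tab ts; rewrite /arc_length_param; set S := [set t | _].
have St : S t by [].
have supS : has_sup S by split; [exists t|exists b => z [] + _; rewrite in_itv/= => /andP[]].
set tau := sup S.
have ttau : t <= tau by apply: ub_le_sup => //; case: supS.
have taub : tau <= b by apply: sup_le_ub; [exists t|move=> z []; rewrite in_itv/= => /andP[]].
move: (tab); rewrite in_itv/= => /andP[at_ tb].
have tauab : tau \in `[a, b] by rewrite in_itv/= (le_trans at_).
apply: mdist_positivity; apply/eqP; rewrite eq_le mdist_ge0 andbT.
apply/ler_addgt0Pl => e e0; rewrite addr0.
have [d d0 Hd] := within_continuous_mdist cgamma tauab e0.
have [t' St'] := sup_adherent d0 supS; rewrite -/tau => tt'.
have t'tau : t' <= tau by apply: ub_le_sup => //; case: supS.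
suff -> : gamma t = gamma t'.
  by apply: ltW; apply: Hd; [case: St'|rewrite ger0_norm ?subr_ge0//; lra].
wlog tlt : t t' tab ts St St' {tt' t'tau ttau at_ tb} / t <= t'.
  move=> H; have [/H|/ltW/H/esym] := leP t t'; apply => //.
  - by case: St'.
  - by case: St'.
apply: mdist_positivity; apply/eqP; rewrite eq_le mdist_ge0 andbT.
case: St' => + t's; rewrite in_itv/= => /andP[at' t'b].
move: tab; rewrite in_itv/= => /andP[at_ tb].
apply: (le_trans (mdist_len at_ tlt t'b)).
have := lenD (lexx a) at_ tlt t'b.
by rewrite {1 2}/len ts t's/=; lra.
Qed.

Lemma arc_length_param_lipschitz (s s' : R) :
  0 <= s -> s <= s' -> s' <= len a b ->
  mdist (arc_length_param gamma a b s) (arc_length_param gamma a b s') <= s' - s.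
Proof.
move=> s0 ss' s'L.
have [t tab ts] := arc_length_surj s0 (le_trans ss' s'L).
have [t' t'ab t's] := arc_length_surj (le_trans s0 ss') s'L.
rewrite (arc_length_paramE tab ts) (arc_length_paramE t'ab t's).
move: tab t'ab; rewrite !in_itv/= => /andP[at_ tb] /andP[at' t'b].
have [tt'|/ltW t't] := leP t t'.
  apply: (le_trans (mdist_len at_ tt' t'b)).
  by have := lenD (lexx a) at_ tt' t'b; rewrite {1 2}/len ts t's/=; lra.
rewrite metric_sym; apply: (le_trans (mdist_len at' t't tb)).
by have := lenD (lexx a) at' t't tb; rewrite {1 2}/len ts t's/=; lra.
Qed.

Lemma arc_length_param0 : arc_length_param gamma a b 0 = gamma a.
Proof.
by apply: arc_length_paramE; rewrite ?curve_lengthxx// in_itv/= lexx.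
Qed.

Lemma arc_length_param_end : arc_length_param gamma a b (len a b) = gamma b.
Proof.
by apply: arc_length_paramE; rewrite ?lenE// in_itv/= lexx andbT.
Qed.

End rectifiable.
End curve_length_theory.

(** The integral of a nonnegative function is the supremum over the simple functions below it, and
    this is monotone for arbitrary functions, measurable or not. The double integral of the theorem
    is compared with the dyadic energy in this way. *)
Lemma ge0_le_integral_ext d (T : measurableType d) (R : realType)
    (mu : {measure set T -> \bar R}) (D : set T) (f g : T -> \bar R) :
  (forall x, D x -> 0 <= f x)%E -> (forall x, D x -> f x <= g x)%E ->
  (\int[mu]_(x in D) f x <= \int[mu]_(x in D) g x)%E.
Proof.
move=> f0 fg; have g0 x : D x -> (0 <= g x)%E.
  by move=> Dx; apply: le_trans (fg _ Dx); exact: f0.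
rewrite !ge0_integralE//; apply: le_ereal_sup => _ [h hf <-]; exists h => // x.
apply: (le_trans (hf x)); rewrite /patch; case: ifPn => //; rewrite inE; exact: fg.
Qed.

(** * Upper gradient of a Lipschitz function that varies only near a given open set *)

Section upper_gradient_indicator.
Context {R : realType} {X : pointedMetricType R}.
Variables (v : X -> R) (d : R) (M : set X).
Hypotheses (d0 : 0 < d) (oM : open M).
Hypothesis vlip : forall x x', `|v x - v x'| <= mdist x x' / d.
Hypothesis vM : forall x x' w, v x <> v x' -> mdist w x < d -> mdist w x' < d -> M w.

(** The curve is cut into arcs shorter than [d]. Across an arc, either [v] takes the same value at
    both ends, or every point of the arc is within [d] of both ends and so lies in [M], where the
    gradient equals the Lipschitz constant. *)
Lemma upper_gradient_indicator :
  upper_gradient (fun x => (d^-1 * \1_M x)%:E) (EFin \o v).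
Proof.
split.
- move=> Y mY.
  suff -> : (fun x : X => (d^-1 * \1_M x)%:E) @^-1` Y =
      (if `[< Y (d^-1)%:E >] then M else set0) `|`
      (if `[< Y 0%:E >] then ~` M else set0).
    have bM : borel_set M by apply: sub_sigma_algebra.
    have bMC : borel_set (~` M).
      by rewrite -setTD; exact: sigma_algebraCD.
    have b0 : borel_set (@set0 X) by exact: sigma_algebra0.
    rewrite -bigcup2E; apply: sigma_algebra_bigcup => -[|[|n]] /=; by [|case: ifP].
  apply/seteqP; split => x /=; rewrite indicE.
    have [xM|xM] := pselect (M x).
      by rewrite mem_set// mulr1 => Yx; left; rewrite asboolT.
    by rewrite memNset// mulr0 => Yx; right; rewrite asboolT.
  by case=> [|]; case: ifPn => // /asboolP Yx xM;
    [rewrite mem_set// mulr1|rewrite memNset// mulr0].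
- by move=> x; rewrite lee_fin mulr_ge0// ?invr_ge0 ?ltW// indicE.
move=> gamma a b [ab cg _ rect]; split => // _ _.
set L := fine (curve_length gamma a b).
have L0 : 0 <= L by rewrite fine_ge0// curve_length_ge0.
pose G := arc_length_param gamma a b.
have [N NL] : exists N : nat, L / N.+1%:R < d.
  have := Num.Theory.archi_boundP (divr_ge0 L0 (ltW d0)).
  set N := Num.bound _; rewrite ltr_pdivrMr// => LN; exists N.
  rewrite ltr_pdivrMr//; apply: (lt_le_trans LN).
  by rewrite mulrC ler_pM2l// ler_nat.
pose p (i : nat) : R := i%:R * (L / N.+1%:R).
have pS i : p i.+1 - p i = L / N.+1%:R by rewrite /p -mulrBl -natrB// subSnn mul1r.
have p0 i : 0 <= p i by rewrite mulr_ge0// divr_ge0.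
have pN : p N.+1 = L by rewrite /p mulrCA divff ?mulr1// pnatr_eq0.
have ple i j : (i <= j)%N -> p i <= p j.
  by move=> ij; rewrite ler_wpM2r ?ler_nat// divr_ge0.
(* The union [U] of the half-open steps across which [v] changes stands in for the preimage of [M]
   along the curve: it is measurable by construction and its length controls the variation of [v] so
   far. *)
have step i : (i <= N.+1)%N -> exists U : set R,
    [/\ measurable U, U `<=` `[0, p i[, (forall s, U s -> M (G s)) &
     (`|v (G (p i)) - v (G 0)|%:E <= (d^-1)%:E * lebesgue_measure U)%E].
  elim: i => [_|i ih iN].
    exists set0; split => //.
    by rewrite /p mul0r subrr normr0 measure0 mule0.
  have [U [mU Ui UM hU]] := ih (ltnW iN).
  have piL : p i.+1 <= L by rewrite -pN ple.
  have pii : p i <= p i.+1 by rewrite ple.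
  have [vv|vv] := pselect (v (G (p i.+1)) = v (G (p i))).
    exists U; split => //; last by rewrite vv.
    by move=> s /Ui /=; rewrite !in_itv/= => /andP[-> /lt_le_trans]; apply.
  exists (U `|` `[p i, p i.+1[%classic); split.
  - exact: measurableU.
  - move=> s [/Ui|] /=; rewrite !in_itv/= => /andP[h1 h2]; rewrite ?h2 ?andbT.
      by rewrite h1 (lt_le_trans h2).
    by rewrite (le_trans (p0 i)).
  - move=> s [/UM//|]; rewrite /= in_itv/= => /andP[h1 h2].
    apply: (vM vv).
      apply: (@le_lt_trans _ _ (p i.+1 - s)); last by rewrite (le_lt_trans _ NL)// -(pS i) lerD2l lerN2.
      by apply: arc_length_param_lipschitz => //; [rewrite (le_trans (p0 i))|exact: ltW].
    apply: (@le_lt_trans _ _ (s - p i)).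
      by rewrite metric_sym; apply: arc_length_param_lipschitz => //; rewrite (le_trans (ltW h2)).
    by rewrite (le_lt_trans _ NL)// -(pS i) lerD2r ltW.
  - have dU : U `&` `[p i, p i.+1[%classic = set0.
      rewrite -subset0 => s [/Ui]; rewrite /= !in_itv/= => /andP[_ h1] /andP[h2 _].
      by rewrite ltNge h2 in h1.
    have hI : (`|v (G (p i.+1)) - v (G (p i))|%:E <=
        (d^-1)%:E * lebesgue_measure `[p i, p i.+1[%classic)%E.
      rewrite lebesgue_measure_itv/= lte_fin; case: ifPn => [|].
        move=> _; rewrite -EFinB -EFinM lee_fin mulrC; apply: (le_trans (vlip _ _)).
        rewrite ler_pM2r ?invr_gt0// metric_sym.
        exact: arc_length_param_lipschitz.
      rewrite -leNgt => ppi; exfalso; apply: vv.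
      by congr (v (G _)); apply/eqP; rewrite eq_le ppi pii.
    rewrite measureU// ge0_muleDr//.
    apply: (@le_trans _ _ (`|v (G (p i)) - v (G 0)|%:E + `|v (G (p i.+1)) - v (G (p i))|%:E)%E).
      by rewrite -EFinD lee_fin [leRHS]addrC; exact: ler_distD.
    exact: leeD.
have [U [mU UL UM]] := step N.+1 (leqnn _).
rewrite pN /G /L arc_length_param_end// arc_length_param0// => hU.
apply: (le_trans hU).
have -> : lebesgue_measure U = (\int[lebesgue_measure]_s (\1_U s)%:E)%E.
  by rewrite integral_indic// setIT.
rewrite -ge0_integralZl_EFin//; last 2 first.
- by apply/measurable_EFinP; exact: measurable_indic.
- by rewrite invr_ge0 ltW.
rewrite /line_integral [leRHS]integral_mkcond.
apply: ge0_le_integral_ext => s _.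
  by rewrite -EFinM lee_fin mulr_ge0// invr_ge0 ltW.
rewrite /patch indicE; case: ifPn => sL.
  rewrite -EFinM lee_fin ler_pM2l ?invr_gt0// indicE ler_nat.
  case: (boolP (s \in U)) => // sU.
  by rewrite mem_set//; apply: UM; rewrite inE in sU.
have : s \notin U.
  apply: contra sL; rewrite !inE => /UL; rewrite pN /= !in_itv/= => /andP[-> h].
  exact: ltW.
by move=> /negbTE ->; rewrite mule0.
Qed.

End upper_gradient_indicator.

(** * Doubling measures *)

(** Stated for set functions rather than measures because it also serves for the energy over squares
    [A * A], which is superadditive but loses the cross terms. *)
Lemma superadditive_seq d (T : measurableType d) (R : realType)
    (Phi : set T -> \bar R) (I : choiceType) (F : I -> set T) (l : seq I) (O : set T) :
  (forall A B, measurable A -> measurable B -> A `&` B = set0 ->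
     Phi A + Phi B <= Phi (A `|` B))%E ->
  (forall A B, measurable A -> measurable B -> A `<=` B -> Phi A <= Phi B)%E ->
  (0 <= Phi set0)%E ->
  measurable O -> (forall i, measurable (F i)) ->
  pairwise (fun i j => `[< F i `&` F j = set0 >]) l ->
  {in l, forall i, F i `<=` O} ->
  (\sum_(i <- l) Phi (F i) <= Phi O)%E.
Proof.
move=> PhiD Phile Phi0 mO mF pl lO.
have mU (s : seq I) : measurable (\big[setU/set0]_(j <- s) F j).
  by apply: bigsetU_measurable.
apply: (@le_trans _ _ (Phi (\big[setU/set0]_(j <- l) F j))); last first.
  by apply: Phile => //; rewrite -bigcup_seq; apply: bigcup_sub => j /= /lO.
elim: l pl {lO} => [_|i l ih /= /andP[/allP il pl]]; first by rewrite !big_nil.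
rewrite !big_cons; apply: le_trans (PhiD _ _ _ _ _) => //.
  by rewrite leeD2l// ih.
by rewrite -bigcup_seq setI_bigcupr bigcup0// => j /= /il /asboolP.
Qed.

(** * Balls, nets and compactness in a complete doubling space *)

Section metric_balls.
Context {R : realType} {X : metricType R}.

Lemma open_ball (x : X) (r : R) : open (ball x r).
Proof.
rewrite openE => y; rewrite {1}ballEmdist/= => xy.
apply/nbhs_ballP; exists (r - mdist x y); first by rewrite /= subr_gt0.
move=> z; rewrite !ballEmdist/= ltrBrDl; apply: le_lt_trans.
exact: metric_triangle.
Qed.

Lemma sub_ball (x y : X) (r s : R) : mdist x y + s <= r -> ball y s `<=` ball x r.
Proof.
move=> xyr z; rewrite !ballEmdist/= => yz.
apply: (le_lt_trans (metric_triangle x y z)); apply: lt_le_trans xyr.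
by rewrite ltrD2l.
Qed.

Lemma disjoint_ball (x y : X) (r s : R) : r + s <= mdist x y ->
  ball x r `&` ball y s = set0.
Proof.
move=> rs; rewrite -subset0 => z []; rewrite !ballEmdist/= => xz yz.
have := metric_triangle x z y; rewrite (metric_sym z); lra.
Qed.

End metric_balls.

Section doubling_space.
Context {R : realType} {X : completeMetricType R}.
Variables (mu : {outer_measure set X -> \bar R}) (D C0 Q : R).
Hypotheses (breg : borel_regular mu) (dbl : doubling mu D).
Hypotheses (lmb : relative_lower_mass_bound mu C0 Q) (C01 : 1 <= C0).

Local Notation T := (caratheodory_type mu).
Local Notation m A := (fine (mu A)).

Lemma measurable_open (U : set X) : open U -> measurable (U : set T).
Proof. by move=> oU; apply: breg.1; exact: sub_sigma_algebra. Qed.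

Lemma measurable_ball_cara (x : X) (r : R) : measurable (ball x r : set T).
Proof. exact/measurable_open/open_ball. Qed.
Hint Resolve measurable_ball_cara : core.

Lemma D_ge1 : 1 <= D. Proof. by case: dbl. Qed.

Let D0 : 0 < D. Proof. exact: lt_le_trans D_ge1. Qed.

Lemma ball_fin (x : X) (r : R) : mu (ball x r) \is a fin_num.
Proof.
have [r0|r0] := leP r 0.
  suff -> : ball x r = set0 by rewrite outer_measure0.
  rewrite -subset0 => y; rewrite ballEmdist/=.
  by rewrite ltNge (le_trans r0 (mdist_ge0 _ _)).
have r20 : 0 < r / 2 by rewrite divr_gt0.
have [_ + fin] := dbl.2 x _ r20; rewrite mulrC divfK// => h.
by rewrite ge0_fin_numE ?outer_measure_ge0//; exact: le_lt_trans fin.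
Qed.

Lemma sub_ball_fin (A : set X) x r : A `<=` ball x r -> mu A \is a fin_num.
Proof.
move=> Ar; rewrite ge0_fin_numE ?outer_measure_ge0//.
by apply: (le_lt_trans (le_outer_measure mu _ _ Ar)); rewrite ltey_eq ball_fin.
Qed.

Lemma m_ge0 (A : set X) : 0 <= m A.
Proof. by rewrite fine_ge0// outer_measure_ge0. Qed.

Lemma m_ball_gt0 (x : X) (r : R) : 0 < r -> 0 < m (ball x r).
Proof.
move=> r0; have r20 : 0 < r / 2 by rewrite divr_gt0.
have [+ _ _] := dbl.2 x _ r20; rewrite mulrC divfK// => h.
by apply: fine_gt0; rewrite h ltey_eq ball_fin.
Qed.

Lemma le_m (A B : set X) x r : A `<=` B -> B `<=` ball x r -> m A <= m B.
Proof.
move=> AB Br; rewrite fine_le//; last exact: le_outer_measure.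
  exact/(@sub_ball_fin _ x r)/(subset_trans AB).
exact: (@sub_ball_fin _ x r).
Qed.

Lemma mu_sub_ballE (A : set X) x r : A `<=` ball x r -> mu A = (m A)%:E.
Proof. by move=> /sub_ball_fin /fineK. Qed.

Lemma mu_ballE (x : X) (r : R) : mu (ball x r) = (m (ball x r))%:E.
Proof. by rewrite fineK// ball_fin. Qed.

Lemma m_ball_double (x : X) (r : R) : 0 < r ->
  m (ball x (2 * r)) <= D * m (ball x r).
Proof.
move=> r0; have [_ h _] := dbl.2 x _ r0.
have : (mu (ball x (2 * r)) <= D%:E * mu (ball x r))%E := h.
by rewrite (mu_ballE x r) (mu_ballE x (2 * r)) -EFinM lee_fin.
Qed.

Lemma m_ball_doubling n (x : X) (r : R) : 0 < r ->
  m (ball x (2 ^+ n * r)) <= D ^+ n * m (ball x r).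
Proof.
move=> r0; elim: n => [|n ih]; first by rewrite !expr0 !mul1r.
have p0 : 0 < 2 ^+ n * r by rewrite mulr_gt0// exprn_gt0.
rewrite exprS -mulrA; apply: (le_trans (m_ball_double x p0)).
by rewrite exprS -mulrA ler_pM2l.
Qed.

Lemma m_ball_le n (x y : X) (r s : R) : 0 < s -> mdist x y + r <= 2 ^+ n * s ->
  m (ball y r) <= D ^+ n * m (ball x s).
Proof.
move=> s0 xy; apply: le_trans (m_ball_doubling n x s0).
by apply: (@le_m _ _ x _ _ (subset_refl _)); exact: sub_ball.
Qed.

Lemma m_superadditive (I : choiceType) (F : I -> set X) (l : seq I) (O : set X) :
  measurable (O : set T) -> (forall i, measurable (F i : set T)) ->
  pairwise (fun i j => `[< F i `&` F j = set0 >]) l ->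
  {in l, forall i, F i `<=` O} ->
  (\sum_(i <- l) mu (F i) <= mu O)%E.
Proof.
apply: (@superadditive_seq _ T R mu) => //.
- by move=> A B mA mB AB; rewrite (@measureU _ _ _ (cara_measure mu)).
- by move=> A B _ _; exact: le_outer_measure.
Qed.

(** The balls of radius [s / 2] about separated points are disjoint, lie in one ball of radius
    [rho + s], and each carries the fraction [c] of its mass by the lower mass bound. *)
Lemma separated_size (z : X) (rho s : R) : 0 < s ->
  exists N, forall l : seq X, {in l, forall x, ball z rho x} ->
    pairwise (fun x y => s <= mdist x y) l -> (size l <= N)%N.
Proof.
move=> s0.
have [rho0|rho0] := leP rho 0.
  exists 0%N => -[//|x l] /(_ x); rewrite mem_head ballEmdist/= => /(_ isT).
  by rewrite ltNge (le_trans rho0 (mdist_ge0 _ _)).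
have rs0 : 0 < rho + s by rewrite addr_gt0.
pose c := C0^-1 * ((s / 2) / (rho + s)) `^ Q.
have c0 : 0 < c.
  rewrite mulr_gt0 ?invr_gt0 ?(lt_le_trans _ C01)// powR_gt0//.
  by rewrite !divr_gt0.
exists (Num.bound c^-1) => l lz pl.
have h1 : (\sum_(x <- l) mu (ball x (s / 2)) <= mu (ball z (rho + s)))%E.
  apply: m_superadditive; first exact: measurable_ball_cara.
  - by move=> i; exact: measurable_ball_cara.
  - apply: sub_pairwise pl => x y xy; apply/asboolP.
    by apply: disjoint_ball; lra.
  - move=> x /lz; rewrite ballEmdist/= => zx; apply: sub_ball; lra.
have h2 : (\sum_(x <- l) (c * m (ball z (rho + s)))%:E <= mu (ball z (rho + s)))%E.
  apply: le_trans h1; rewrite big_seq [leRHS]big_seq; apply: lee_sum => x xl.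
  rewrite [leRHS]mu_ballE lee_fin -ler_pdivlMr; last exact: m_ball_gt0.
  apply: lmb; [by rewrite divr_gt0|lra|].
  by have := lz _ xl; rewrite !ballEmdist/=; lra.
move: h2; rewrite mu_ballE sumEFin lee_fin big_const_seq count_predT.
rewrite iter_addr_0 -mulr_natr mulrAC -[leRHS]mul1r ler_pM2r ?m_ball_gt0//.
rewrite mulrC -ler_pdivlMr// div1r => h.
have ci : 0 <= c^-1 by rewrite invr_ge0 ltW.
by have := le_lt_trans h (archi_boundP ci); rewrite ltr_nat => /ltnW.
Qed.

(** Without a maximal separated list, every separated list could be lengthened, against the bound on
    its size. *)
Lemma finite_net (S : set X) (z : X) (rho s : R) : 0 < s -> S `<=` ball z rho ->
  exists l : seq X, [/\ pairwise (fun x y => s <= mdist x y) l,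
    {in l, forall x, S x} &
    forall y, S y -> exists2 x, x \in l & mdist x y < s].
Proof.
move=> s0 Sz; have [N HN] := separated_size z rho s0.
apply: contrapT => H.
have ext n : exists l : seq X, [/\ size l = n, pairwise (fun x y => s <= mdist x y) l &
    {in l, forall x, S x}].
  elim: n => [|n [l [sl pl lS]]]; first by exists [::].
  have [y Sy Hy] : exists2 y, S y & {in l, forall x, s <= mdist x y}.
    apply: contrapT => H'; apply: H; exists l; split => // y Sy.
    apply: contrapT => H''; apply: H'; exists y => // x xl.
    by rewrite leNgt; apply/negP => xy; apply: H''; exists x.
  exists (y :: l); split => /=; first by rewrite sl.
    by rewrite pl andbT; apply/allP => x /Hy; rewrite metric_sym.
  by move=> x; rewrite inE => /predU1P[->//|/lS].
have [l [sl pl lS]] := ext N.+1.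
suff : (size l <= N)%N by rewrite sl ltnn.
by apply: HN => // x /lS /Sz.
Qed.

(** Total boundedness and completeness: an ultrafilter containing the ball contains, for each [e],
    one of the finitely many balls of a net, hence is Cauchy. *)
Lemma compact_closure_ball (z : X) (rho : R) : compact (closure (ball z rho)).
Proof.
rewrite compact_ultra => F UF FA.
have FB : F (ball z (rho + 1)).
  apply: filterS FA => x /(_ (ball x 1) (nbhsx_ballx _ _ ltr01)) [y []].
  rewrite !ballEmdist/= => zy xy.
  by have := metric_triangle z y x; rewrite (metric_sym y x); lra.
have : cauchy F.
  apply: cauchy_exP => e e0.
  have [l [_ _ lS]] := finite_net e0 (@subset_refl _ (ball z (rho + 1))).
  have : F (\bigcup_(x in [set` l]) ball x e).
    by apply: filterS FB => y /lS[x xl xy]; exists x => //; rewrite ballEmdist.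
  rewrite bigcup_seq; elim: l {lS} => [|x l ih].
    by rewrite big_nil => /filter_not_empty.
  rewrite big_cons => Fl.
  have [|Fx] := in_ultra_setVsetC (ball x e) UF; first by exists x.
  apply: ih; apply: filterS2 Fl Fx => y; by case.
move=> /cauchy_cvg Fp; exists (lim F); split => //.
have /closure_id -> := @closed_closure _ (ball z rho).
move=> B /Fp FB'.
have FAB : F (closure (ball z rho) `&` B) by apply: filterI.
exact: filter_ex FAB.
Qed.

Lemma L1loc_ball (u : X -> \bar R) (x : X) (r : R) : L1loc mu u ->
  (cara_measure mu).-integrable (ball x r : set T) u.
Proof. by apply; [exact: open_ball|exact: compact_closure_ball]. Qed.

Lemma dense_net : exists net : nat -> seq X, forall n y,
  ball (point : X) n%:R y -> exists2 x, x \in net n & mdist x y < n.+1%:R^-1.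
Proof.
suff /choice[net H] : forall n : nat, exists l : seq X, forall y,
    ball (point : X) n%:R y -> exists2 x, x \in l & mdist x y < n.+1%:R^-1.
  by exists net.
move=> n; have n0 : 0 < n.+1%:R^-1 :> R by rewrite invr_gt0.
have [l [_ _ lS]] := finite_net n0 (@subset_refl _ (ball (point : X) n%:R)).
by exists l.
Qed.

Lemma ball_point_cover (y : X) : exists N, forall n, (N <= n)%N -> ball (point : X) n%:R y.
Proof.
exists (Num.bound (mdist point y)) => n Nn; rewrite ballEmdist/=.
by apply: (lt_le_trans (archi_boundP (mdist_ge0 _ _))); rewrite ler_nat.
Qed.

(** Measurability with respect to the product sigma-algebra, for which openness in the product is
    not enough by itself: separability writes the set as a countable union of products of balls with
    centers in the nets. *)
Lemma measurable_mdist_lt (s : R) :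
  measurable [set xy : T * T | mdist (xy.1 : X) (xy.2 : X) < s].
Proof.
have [net Hnet] := dense_net.
have netP (x y : X) : mdist x y < s <-> exists n, exists2 w, w \in net n &
    ball w n.+1%:R^-1 x /\ ball w (s - n.+1%:R^-1) y.
  split=> [xy|[n [w wn []]]]; last first.
    rewrite !ballEmdist/=; set e := _^-1 => wx wy.
    by have := metric_triangle x w y; rewrite (metric_sym x w); lra.
  have [N HN] := ball_point_cover x.
  have sxy : 0 < (s - mdist x y) / 2 by rewrite divr_gt0// subr_gt0.
  have si : 0 <= ((s - mdist x y) / 2)^-1 by rewrite invr_ge0 ltW.
  have := archi_boundP si; set N' := Num.bound _ => hN'.
  pose n := maxn N N'.
  have [w wn wx] := Hnet n x (HN _ (leq_maxl _ _)).
  exists n; exists w => //; rewrite /= !ballEmdist/=; split => //.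
  have hn : n.+1%:R^-1 < (s - mdist x y) / 2.
    rewrite -[ltRHS]invrK ltf_pV2 ?posrE ?invr_gt0//.
    by apply: (lt_le_trans hN'); rewrite ler_nat (leq_trans (leq_maxr N N')).
  move: hn wx; set e := n.+1%:R^-1 => hn wx.
  by have := metric_triangle w x y; lra.
suff -> : [set xy : T * T | mdist (xy.1 : X) (xy.2 : X) < s] =
    \bigcup_n \bigcup_(w in [set` net n])
      ((ball w n.+1%:R^-1 : set T) `*` (ball w (s - n.+1%:R^-1) : set T)).
  apply: bigcup_measurable => n _; rewrite bigcup_seq; apply: bigsetU_measurable => w _.
  by apply: measurableX; exact: measurable_ball_cara.
apply/seteqP; split => [[x y]/= /netP[n [w wn [h1 h2]]]|[x y] /= [n _ [w wn [h1 h2]]]].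
  by exists n => //; exists w.
by apply/netP; exists n; exists w.
Qed.

Lemma sigma_finite_cara : sigma_finite setT (cara_measure mu).
Proof.
exists (fun n => ball (point : X) n%:R).
  apply/seteqP; split => // y _; have [N HN] := ball_point_cover y.
  by exists N => //; apply: HN.
move=> n; split; first exact: measurable_ball_cara.
by rewrite ltey_eq; apply/orP; left; exact: ball_fin.
Qed.

End doubling_space.

(** * A Poincare inequality for sets at a fixed scale *)

Lemma ge0_le_measure_integral_cst d (T : measurableType d) (R : realType)
    (mu : {measure set T -> \bar R}) (A O : set T) (e : T -> \bar R) (c : R) :
  measurable A -> measurable O -> A `<=` O -> measurable_fun O e ->
  (forall x, O x -> 0 <= e x)%E -> (forall x, A x -> c%:E <= e x)%E -> 0 <= c ->
  (c%:E * mu A <= \int[mu]_(x in O) e x)%E.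
Proof.
move=> mA mO AO me e0 ce c0.
apply: le_trans (ge0_subset_integral mu mA mO me e0 AO).
rewrite -(integral_cst mu mA c%:E); exact: ge0_le_integral_ext.
Qed.

Section lipschitz_bump.
Context {R : realType} {X : metricType R}.
Variables (A : set X) (d : R).
Hypothesis d0 : 0 < d.

Let S (x : X) : set R := [set 0] `|` [set 1 - mdist x a / d | a in A].

(** The cutoff [max (0, 1 - dist (x, A) / d)]. The value 0 belongs to [S x], which gives the
    truncation and keeps the set nonempty for empty [A]. *)
Definition bump (x : X) : R := sup (S x).

Let S_le1 x r : S x r -> r <= 1.
Proof.
case=> [->//|[a _ <-]].
by rewrite gerBl divr_ge0 ?mdist_ge0 ?ltW.
Qed.

Let has_sup_S x : has_sup (S x).
Proof. by split; [exists 0; left|exists 1 => r /S_le1]. Qed.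

Let S_le_bump x r : S x r -> r <= bump x.
Proof. by move=> Sr; apply: ub_le_sup => //; case: (has_sup_S x). Qed.

Lemma bump_ge0 x : 0 <= bump x.
Proof. by apply: S_le_bump; left. Qed.

Lemma bump_le1 x : bump x <= 1.
Proof. by apply: sup_le_ub; [exists 0; left|move=> r /S_le1]. Qed.

Lemma bump1 x : A x -> bump x = 1.
Proof.
move=> Ax; apply/eqP; rewrite eq_le bump_le1/=.
by apply: S_le_bump; right; exists x => //; rewrite mdistxx mul0r subr0.
Qed.

Lemma bump_gt0 x : 0 < bump x -> exists2 a, A a & mdist x a < d.
Proof.
move=> v0; have [_ [->|[a Aa <-]]] := sup_adherent v0 (has_sup_S x).
  by rewrite subrr ltxx.
by rewrite subrr subr_gt0 ltr_pdivrMr// mul1r => xa; exists a.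
Qed.

Let bump_le x x' : bump x <= bump x' + mdist x x' / d.
Proof.
apply: sup_le_ub; first by exists 0; left.
move=> r [->|[a Aa <-]]; first by rewrite addr_ge0 ?bump_ge0// divr_ge0 ?mdist_ge0 ?ltW.
have h : 1 - mdist x' a / d <= bump x' by apply: S_le_bump; right; exists a.
apply: le_trans (_ : 1 - mdist x' a / d + mdist x x' / d <= _); last by rewrite lerD2r.
have : mdist x' a / d <= (mdist x x' + mdist x a) / d.
  rewrite ler_pM2r ?invr_gt0// (metric_sym x); exact: metric_triangle.
by rewrite mulrDl; lra.
Qed.

Lemma bump_lip x x' : `|bump x - bump x'| <= mdist x x' / d.
Proof.
by rewrite ler_norml; have := bump_le x x'; have := bump_le x' x;
  rewrite (metric_sym x'); lra.
Qed.

Lemma continuous_bump : continuous bump.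
Proof.
move=> x; apply/(@cvgrPdist_lt _ R^o) => e e0; apply/nbhs_ballP.
exists (e * d) => /=; first by rewrite mulr_gt0.
move=> y; rewrite ballEmdist/= => xy; apply: (le_lt_trans (bump_lip _ _)).
by rewrite ltr_pdivrMr.
Qed.

Definition transition_set : set X :=
  [set w | (exists2 a, A a & mdist w a < 2 * d) /\
           (exists2 b, ~ A b & mdist w b < 2 * d)].

Lemma open_transition_set : open transition_set.
Proof.
have H (P : set X) : open [set w | exists2 a, P a & mdist w a < 2 * d].
  rewrite (_ : [set w | _] = \bigcup_(a in P) ball a (2 * d)).
    by apply: bigcup_open => a _; exact: open_ball.
  apply/seteqP; split => w [a Pa wa]; exists a => //; move: wa;
    by rewrite ballEmdist/= metric_sym.
exact: openI (H A) (H (~` A)).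
Qed.

(** The point with the larger value has a positive one, so it is within [d] of [A]; the other has a
    value below 1, so it lies outside [A]. Adding the distance to [w] gives the radius [2 * d] in
    [transition_set]. *)
Lemma bump_transition x x' w : bump x <> bump x' ->
  mdist w x < d -> mdist w x' < d -> transition_set w.
Proof.
wlog lt : x x' / bump x < bump x'.
  move=> H vv wx wx'; have [lt|lt|//] := ltgtP (bump x) (bump x').
    exact: (H x x').
  by apply: (H x' x) => //; exact/nesym.
move=> _ wx wx'; split.
  have [a Aa xa] := bump_gt0 (le_lt_trans (bump_ge0 x) lt).
  exists a => //; apply: (le_lt_trans (metric_triangle w x' a)).
  by rewrite mulr_natl mulr2n ltrD.
exists x; last by rewrite (lt_trans wx)// ltr_pMl// ltr1n.
by move=> /bump1 v1; rewrite v1 ltNge bump_le1 in lt.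
Qed.

End lipschitz_bump.

Section set_poincare.
Context {R : realType} {X : completeMetricType R}.
Variables (mu : {outer_measure set X -> \bar R}) (D C0 Q CP tauP : R).
Hypotheses (breg : borel_regular mu) (dbl : doubling mu D).
Hypotheses (lmb : relative_lower_mass_bound mu C0 Q) (C01 : 1 <= C0).
Hypothesis poi : poincare11 mu CP tauP.

Local Notation T := (caratheodory_type mu).
Local Notation m A := (fine (mu A)).
Local Notation M := (cara_measure mu).

Let D1 := D_ge1 dbl.
Let D0 : 0 < D. Proof. exact: lt_le_trans D1. Qed.

Lemma continuous_measurable_cara (f : X -> R) : continuous f ->
  measurable_fun setT (f : T -> R).
Proof.
move=> cf; apply: (measurability _ (RGenOInfty.measurableE R)).
move=> _ [_ [r ->] <-]; rewrite setTI; apply: (measurable_open breg).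
by apply: open_comp => //; exact: interval_open.
Qed.

Lemma compact_sub_ball (K : set X) : compact K -> exists r, K `<=` ball (point : X) r.
Proof.
move=> cK.
have cd : continuous (fun y : X => mdist point y : R^o).
  move=> x; apply/(@cvgrPdist_lt _ R^o) => e e0; apply/nbhs_ballP; exists e => //= y.
  rewrite ballEmdist/= => xy; apply: le_lt_trans xy; rewrite ler_norml.
  have := metric_triangle point x y; have := metric_triangle point y x.
  by rewrite (metric_sym y); lra.
have := continuous_compact (continuous_subspaceT cd) cK.
move=> /compact_bounded[B [_ HB]]; exists (B + 2) => y Ky; rewrite ballEmdist/=.
have B1 : B < B + 1 by rewrite ltrDl.
have := HB (B + 1) B1 (mdist point y); rewrite /= ger0_norm ?mdist_ge0//.
by move=> /(_ (ex_intro2 _ _ y Ky erefl)); lra.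
Qed.

Lemma le_measure_integral (A O : set T) (e : T -> \bar R) (c : R) :
  measurable A -> measurable O -> A `<=` O -> measurable_fun O e ->
  (forall x, O x -> 0 <= e x)%E -> (forall x, A x -> c%:E <= e x)%E -> 0 <= c ->
  (c%:E * mu A <= \int[M]_(x in O) e x)%E.
Proof. exact: (@ge0_le_measure_integral_cst _ _ _ M). Qed.

Lemma outer_measure_seq (I : choiceType) (F : I -> set X) (l : seq I) :
  (mu (\bigcup_(i in [set` l]) F i) <= \sum_(i <- l) mu (F i))%E.
Proof.
rewrite bigcup_seq; elim: l => [|i l ih]; first by rewrite !big_nil outer_measure0.
by rewrite !big_cons; apply: (le_trans (outer_measureU2 _ _ _)); rewrite leeD2l.
Qed.

Lemma m_setID (A : set X) (E : set T) x r : measurable E -> measurable (A : set T) ->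
  A `<=` ball x r -> m A = m (A `&` E) + m (A `\` E).
Proof.
move=> mE' mA Ax.
have fAE : mu (A `&` E) \is a fin_num.
  by apply: (sub_ball_fin dbl (x := x) (r := r)) => y [/Ax].
have fAD : mu (A `\` E) \is a fin_num.
  by apply: (sub_ball_fin dbl (x := x) (r := r)) => y [/Ax].
rewrite -fineD// -(@measureU _ _ _ M) ?setUIDK//.
- exact: measurableI.
- exact: measurableD.
- by rewrite -subset0 => y [[_ Ey] [_ /(_ Ey)]].
Qed.

Section one_scale.
Variables (E : set T) (z : X) (rho d c : R) (e : T -> \bar R).
Hypotheses (mE' : measurable E) (d0 : 0 < d) (drho : 8 * d <= rho) (c0 : 0 < c).
Let B : set T := ball z rho.
Let O : set T := ball z ((tauP + 2) * rho).
Hypotheses (me : measurable_fun setT e) (e0 : forall x, (0 <= e x)%E).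
Hypothesis eE : forall (x : T) (V : set T), measurable V -> O x -> E x ->
  V `<=` O `&` ball (x : X) (8 * d) `\` E ->
  ((m V / m (ball (x : X) (8 * d)))%:E <= e x)%E.
Hypothesis eEC : forall (x : T) (V : set T), measurable V -> O x -> ~ E x ->
  V `<=` O `&` ball (x : X) (8 * d) `&` E ->
  ((m V / m (ball (x : X) (8 * d)))%:E <= e x)%E.
Hypothesis EB : c * m B <= m (E `&` B).
Hypothesis ECB : c * m B <= m (B `\` E).

(** [E] is replaced by its majority set at scale [d]. Near a point where [A] meets its complement
    there are two balls of radius [d], one half filled by [E] and one half filled by the complement
    of [E]; the function [e] detects such pairs. *)
Let A : set X := [set a | m (ball a d) < 2 * m (ball a d `&` E)].
Let W := transition_set A d.
Let v := bump A d.

Let rho0 : 0 < rho. Proof. by apply: lt_le_trans drho; rewrite mulr_gt0. Qed.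
Let tauP1 : 1 <= tauP. Proof. by case: poi. Qed.
Let CP1 : 1 <= CP. Proof. by case: poi. Qed.

Let mball (x : X) r : measurable (ball x r : set T).
Proof. exact: measurable_ball_cara. Qed.

Let half_split (a : X) : m (ball a d) = m (ball a d `&` E) + m (ball a d `\` E).
Proof. exact: m_setID (@subset_refl _ _). Qed.

Let ball_d_gt0 (x : X) k : 0 < k -> 0 < m (ball x (k * d)).
Proof. by move=> k0; apply: (m_ball_gt0 dbl); rewrite mulr_gt0. Qed.

Let ballO (w : X) k : mdist z w < tauP * rho -> k <= 8 -> ball w (k * d) `<=` O.
Proof.
move=> zw k8; apply: sub_ball.
have : k * d <= 8 * d by rewrite ler_pM2r.
by rewrite mulrDl => kd; have := rho0; move: drho zw; lra.
Qed.

(* Either [e] is large or the point lies in the transition set wherever the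
   Lipschitz function differs from the indicator. *)
Let v_indic (x : T) : B x ->
  `|v x - \1_E x| <= \1_([set x | O x /\ ((2 * D ^+ 3)^-1)%:E <= e x]%E `|` W) x.
Proof.
move=> Bx.
have zx : mdist z (x : X) < tauP * rho.
  move: Bx; rewrite /B ballEmdist/= => /lt_le_trans; apply.
  by rewrite ler_peMl// ltW.
have Ox : O x.
  have := ballO zx (_ : 1 <= 8); rewrite mul1r => /(_ _ x); apply; first by lra.
  by rewrite ballEmdist/= mdistxx.
have dx0 : 0 < m (ball (x : X) d) by have := ball_d_gt0 (x : X) ltr01; rewrite mul1r.
have dx80 : 0 < m (ball (x : X) (8 * d)) by apply: ball_d_gt0.
(* A factor 2 for half of the ball of radius [d], and three doublings from [d] to [8 * d]. *)
have big (V : set T) : measurable V -> m (ball (x : X) d) <= 2 * m V ->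
    (2 * D ^+ 3)^-1 <= m V / m (ball (x : X) (8 * d)).
  move=> mV hV; have D30 : 0 < 2 * D ^+ 3 by rewrite mulr_gt0// exprn_gt0.
  rewrite ler_pdivlMr// mulrC ler_pdivrMr//.
  have h8 : m (ball (x : X) (8 * d)) <= D ^+ 3 * m (ball (x : X) d).
    by apply: (m_ball_le dbl) => //; rewrite mdistxx add0r; lra.
  apply: (le_trans h8); rewrite mulrA [leRHS]mulrC ler_pM2l ?exprn_gt0//.
  by rewrite mulrC.
have subO : ball (x : X) d `<=` O `&` ball (x : X) (8 * d).
  move=> y xy; split; first by have := ballO zx (_ : 1 <= 8); rewrite mul1r; apply => //; lra.
  by apply: (le_ball _ xy); have := d0; lra.
have v01 : 0 <= v x <= 1 by rewrite /v bump_ge0 ?bump_le1.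
have toW : ([set x | O x /\ ((2 * D ^+ 3)^-1)%:E <= e x]%E `|` W) x ->
  `|v x - \1_E x| <= \1_([set x | O x /\ ((2 * D ^+ 3)^-1)%:E <= e x]%E `|` W) x.
  move=> Wx; rewrite [leRHS](_ : _ = 1); last by rewrite indicE mem_set.
  rewrite ler_norml; have [->|->] : \1_E x = 0 :> R \/ \1_E x = 1 :> R.
  - by rewrite indicE; case: (x \in E); [right|left].
  - by move: v01; lra.
  - by move: v01; lra.
have [Ex|nEx] := pselect (E x).
  have [Ax|nAx] := pselect (A x).
    by rewrite /v bump1// indicE mem_set// subrr normr0.
  apply: toW => //; left; split => //.
  apply: le_trans (eE (V := ball (x : X) d `\` E) _ Ox Ex _); last 2 first.
  - exact: measurableD.
  - by move=> y [/subO[? ?] ?].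
  rewrite lee_fin; apply: big; first exact: measurableD.
  by move/negP: nAx; rewrite /A/= -leNgt; have := half_split x; lra.
have [Ax|nAx] := pselect (A x).
  apply: toW => //; left; split => //.
  apply: le_trans (eEC (V := ball (x : X) d `&` E) _ Ox nEx _); last 2 first.
  - exact: measurableI.
  - by move=> y [/subO[? ?] ?].
  rewrite lee_fin; apply: big; first exact: measurableI.
  exact: ltW.
have [v0|] := eqVneq (v x) 0; first by rewrite v0 indicE memNset// subrr normr0.
move=> vn0; apply: toW => //; right.
have [a Aa xa] : exists2 a, A a & mdist (x : X) a < d.
  by apply: bump_gt0 => //; rewrite lt_neqAle eq_sym vn0 bump_ge0.
split; first by exists a => //; rewrite (lt_trans xa)// ltr_pMl// ltr1n.
by exists x => //; rewrite mdistxx mulr_gt0.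
Qed.

(** Around a point [w] of [W], the parts [A'] of [E] and [V] of its complement each fill half of a
    ball of radius [d], and each point of [A'] sees all of [V]. This gives [e] an integral over
    [ball w (3 * d)] comparable to the mass of [ball w (6 * d)]: two halves make the factor 4, and
    [D ^+ 7] is [D ^+ 4] times [D ^+ 3]. *)
Let transition_measure :
  (mu (W `&` ball z (tauP * rho)) <= (4 * D ^+ 7)%:E * \int[M]_(x in O) e x)%E.
Proof.
have d60 : 0 < 6 * d by rewrite mulr_gt0.
(* Centers at mutual distance at least [6 * d]: the balls of radius [6 * d] cover, while those of
   radius [3 * d], which contain the balls of radius [d] about [a] and [b], are disjoint. *)
have [l [pl lW lcov]] := finite_net breg dbl lmb C01 d60 (@subIsetr _ W (ball z (tauP * rho))).
have mO : measurable O by exact: mball.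
have D70 : 0 < D ^+ 7 by rewrite exprn_gt0.
apply: (@le_trans _ _ (\sum_(w <- l) mu (ball w (6 * d)))%E).
  apply: le_trans (outer_measure_seq _ _); apply: le_outer_measure.
  by move=> y /lcov[x xl xy]; exists x => //; rewrite ballEmdist.
apply: (@le_trans _ _ (\sum_(w <- l) (4 * D ^+ 7)%:E * \int[M]_(x in ball w (3 * d)) e x)%E); last first.
  rewrite -ge0_sume_distrr; last by move=> w _; apply: integral_ge0.
  apply: lee_wpmul2l; first by rewrite lee_fin mulr_ge0// ltW.
  apply: (@superadditive_seq _ T R (fun S => \int[M]_(x in S) e x)%E) => //.
  - move=> S1 S2 mS1 mS2 S12; rewrite ge0_integral_setU//.
      exact: measurable_funS me.
    by apply/disj_setPS; rewrite S12.
  - by move=> S1 S2 mS1 mS2 S12; apply: ge0_subset_integral => //; exact: measurable_funS me.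
  - by rewrite integral_set0.
  - apply: sub_pairwise pl => x y xy; apply/asboolP.
    by apply: disjoint_ball; lra.
  - by move=> w /lW[_]; rewrite ballEmdist/= => zw; apply: ballO => //; lra.
rewrite big_seq [leRHS]big_seq; apply: lee_sum => w /lW[[[a Aa wa] [b nAb wb]]].
rewrite ballEmdist/= => zw.
pose A' := ball a d `&` E; pose V := ball b d `\` E.
have mA' : measurable (A' : set T) by exact: measurableI.
have mV : measurable (V : set T) by exact: measurableD.
have ad0 : 0 < m (ball a d) by apply: (m_ball_gt0 dbl).
have bd0 : 0 < m (ball b d) by apply: (m_ball_gt0 dbl).
have hA' : m (ball a d) <= 2 * m A' by apply: ltW; exact: Aa.
have hV : m (ball b d) <= 2 * m V.
  by move/negP: nAb; rewrite /A/= -leNgt; have := half_split b; rewrite -/V; lra.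
have V0 : 0 < m V by lra.
(* For [x] within [d] of [a], the ball of radius [8 * d] about [x] lies in the ball of radius
   [16 * d] about [a], hence four doublings. *)
pose c2 := m V / (D ^+ 4 * m (ball a d)).
have D40 : 0 < D ^+ 4 by rewrite exprn_gt0.
have c20 : 0 < c2 by rewrite divr_gt0// mulr_gt0.
have key : (c2%:E * mu A' <= \int[M]_(x in ball w (3 * d)) e x)%E.
  apply: le_measure_integral => //; last exact: ltW.
  - move=> x [ax _]; move: ax; rewrite !ballEmdist/= => ax.
    by have := metric_triangle w a x; lra.
  - exact: measurable_funS me.
  - move=> x [ax Ex]; move: ax; rewrite ballEmdist/= => ax.
    have wx : mdist w (x : X) < 3 * d by have := metric_triangle w a x; lra.
    have Ox : O x by apply: (ballO (k := 3) zw); [lra|rewrite ballEmdist].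
    apply: le_trans (eE (V := V) mV Ox Ex _); last first.
      move=> y [by_ nEy]; split => //; move: by_; rewrite ballEmdist/= => by_.
      have wy : mdist w y < 3 * d by have := metric_triangle w b y; lra.
      split; first by apply: (ballO (k := 3) zw); [lra|rewrite ballEmdist].
      rewrite ballEmdist/=.
      by have := metric_triangle (x : X) w y; rewrite (metric_sym (x : X) w); lra.
    rewrite lee_fin /c2 ler_pM2l// lef_pV2 ?posrE ?mulr_gt0 ?ball_d_gt0//.
    by apply: (m_ball_le dbl) => //; lra.
have -> : mu (ball w (6 * d)) = (m (ball w (6 * d)))%:E by apply: (mu_ballE dbl).
apply: (@le_trans _ _ ((4 * D ^+ 7)%:E * (c2%:E * mu A'))%E); last first.
  by apply: lee_wpmul2l => //; rewrite lee_fin mulr_ge0// ltW.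
have -> : mu A' = (m A')%:E by apply: (mu_sub_ballE dbl (x := a) (r := d)) => y [].
rewrite -!EFinM lee_fin.
have h6 : m (ball w (6 * d)) <= D ^+ 3 * m (ball b d).
  by apply: (m_ball_le dbl) => //; rewrite metric_sym; lra.
have -> : 4 * D ^+ 7 * (c2 * m A') = D ^+ 3 * (2 * m V) * (2 * m A' / m (ball a d)).
  by rewrite /c2; field; rewrite !gt_eqF//.
apply: (le_trans h6); apply: (@le_trans _ _ (D ^+ 3 * (2 * m V))).
  by rewrite ler_pM2l// exprn_gt0.
rewrite ler_peMr//; first by rewrite mulr_ge0 ?mulr_ge0 ?exprn_ge0// ltW.
by rewrite ler_pdivlMr// mul1r.
Qed.

Let L1loc_v : L1loc mu (EFin \o v).
Proof.
move=> U oU cU; have [r Ur] := compact_sub_ball cU.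
have mU : measurable (U : set T) by exact: measurable_open.
apply: measurable_bounded_integrable => //.
- rewrite ltey_eq; apply/orP; left.
  by apply: (sub_ball_fin dbl (x := point) (r := r)) => y /subset_closure /Ur.
- by apply: (measurable_funS measurableT) => //; apply: continuous_measurable_cara; exact: continuous_bump.
- exists 1; split => // y y1 x _ /=; rewrite (le_trans _ (ltW y1))//.
  by rewrite ger0_norm ?bump_ge0// bump_le1.
Qed.

(** The Poincare inequality on [B] for the cutoff [v] with the upper gradient [d^-1 * 1_W]. Its
    right-hand side is [rho / d] times the mass of [W], up to [CP], and is charged to [e] by
    [transition_measure]; on the left [v] may be exchanged for the indicator of [E], since they
    differ only on a set that is charged to [e] as well. *)
Lemma set_poincare_scale :
  ((c * (d / rho) * m B)%:E <= (10 * CP * D ^+ 7)%:E * \int[M]_(x in O) e x)%E.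
Proof.
have D70 : 0 < D ^+ 7 by rewrite exprn_gt0.
have D31 : D ^+ 3 <= D ^+ 7 by rewrite ler_weXn2l.
have D30 : 0 < D ^+ 3 by rewrite exprn_gt0.
have CP0 : 0 < CP by exact: lt_le_trans CP1.
have mO : measurable O by exact: mball.
have mB : measurable B by exact: mball.
have I0 : (0 <= \int[M]_(x in O) e x)%E by apply: integral_ge0.
have [->|Ifin] := eqVneq (\int[M]_(x in O) e x)%E +oo%E.
  by rewrite gt0_muley ?leey// lte_fin !mulr_gt0.
have {}Ifin : (\int[M]_(x in O) e x)%E \is a fin_num by rewrite ge0_fin_numE// ltey.
have := transition_measure; rewrite -(fineK Ifin); set J := fine _.
have J0 : 0 <= J by rewrite fine_ge0.
pose W1 : set T := [set x | O x /\ ((2 * D ^+ 3)^-1)%:E <= e x]%E.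
have mW1 : measurable W1.
  have := measurable_funS measurableT (@subsetT _ O) me mO.
  move=> /(_ `[((2 * D ^+ 3)^-1)%:E, +oo[%classic (emeasurable_itv _)).
  congr measurable; apply/seteqP; split => x /=; rewrite in_itv/= ?andbT; case=> //.
have W1J : m W1 <= 2 * D ^+ 3 * J.
  have c10 : 0 < (2 * D ^+ 3)^-1 by rewrite invr_gt0 mulr_gt0.
  have : (((2 * D ^+ 3)^-1)%:E * mu W1 <= \int[M]_(x in O) e x)%E.
    apply: le_measure_integral => //.
    - by move=> x [].
    - exact: measurable_funS me.
    - by move=> x [].
    - exact: ltW.
  have -> : mu W1 = (m W1)%:E by apply: (mu_sub_ballE dbl (x := z)) => y [Oy _]; exact: Oy.
  rewrite -(fineK Ifin) -/J -EFinM lee_fin ler_pdivrMl//; first by rewrite mulr_gt0.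
set tB := ball z (tauP * rho).
have tB0 : 0 < m tB by apply: (m_ball_gt0 dbl); rewrite mulr_gt0// (lt_le_trans _ tauP1).
have B0 : 0 < m B by apply: (m_ball_gt0 dbl).
have BtB : B `<=` tB by apply: le_ball; rewrite ler_peMl// ltW.
have mBtB : m B <= m tB by apply: (le_m dbl BtB (@subset_refl _ _)).
have -> : mu (W `&` tB) = (m (W `&` tB))%:E by apply: (mu_sub_ballE dbl (x := z) (r := tauP * rho)) => y [].
rewrite -EFinM lee_fin => WJ.
have mW : measurable (W : set T) by apply: (measurable_open breg); exact: open_transition_set.
have [_ _ /(_ z rho rho0 (EFin \o v) (fun x => (d^-1 * \1_W x)%:E) L1loc_v)] := poi.
have UG : upper_gradient (fun x : X => (d^-1 * \1_W x)%:E) (EFin \o v).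
  apply: upper_gradient_indicator; [exact: d0|exact: open_transition_set| |].
    exact: bump_lip.
  exact: bump_transition.
move=> /(_ UG).
have mv : measurable_fun setT (v : T -> R).
  by apply: continuous_measurable_cara; exact: continuous_bump.
have iv : M.-integrable B (EFin \o v) := L1loc_ball breg dbl lmb C01 z rho L1loc_v.
have fv : (\int[M]_(x in B) (EFin \o v) x)%E \is a fin_num := integrable_fin_num mB iv.
set t' := mean mu (ball z rho) (EFin \o v).
have [t tE] : exists t, t' = t%:E by exists (fine t'); rewrite fineK// fin_numM.
rewrite tE /mean /mint.
have -> : (\int[M]_(x in ball z (tauP * rho)) (d^-1 * \1_W x)%:E)%E = (d^-1 * m (W `&` tB))%:E.
  under eq_integral do rewrite EFinM.
  rewrite ge0_integralZl_EFin; last 4 first.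
  - exact: mball.
  - by move=> x _; rewrite lee_fin.
  - by apply/measurable_EFinP; exact: measurable_indic.
  - by rewrite invr_ge0 ltW.
  rewrite integral_indic//.
  rewrite EFinM; congr (_ * _)%E.
  by apply: (mu_sub_ballE dbl (x := z) (r := tauP * rho)) => y [].
move=> h.
have {h} : (((m B)^-1)%:E * \int[M]_(x in B) `|v x - t|%:E <=
    (CP * rho)%:E * ((m tB)^-1%:E * (d^-1 * m (W `&` tB))%:E))%E := h.
set I1 := (\int[M]_(x in B) _)%E => h.
have I10 : (0 <= I1)%E by apply: integral_ge0 => x _; rewrite lee_fin.
have I1fin : I1 \is a fin_num.
  rewrite ge0_fin_numE// ltey; apply/eqP => I1y; move: h.
  by rewrite I1y gt0_muley ?lte_fin ?invr_gt0// -!EFinM leye_eq.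
have mW1W : measurable (W1 `|` W) by exact: measurableU.
(* Whatever the mean [t] is, [|1 - t| + |t| >= 1], and both [E] and its complement have mass at
   least [c * m B] in [B]. *)
have low : ((c * m B)%:E <= I1 + mu ((W1 `|` W) `&` B))%E.
  rewrite -[X in (_ <= _ + X)%E](@integral_indic _ _ _ M B mB (W1 `|` W))//.
  rewrite -ge0_integralD; last 5 first.
  - exact: mB.
  - by move=> x _; rewrite lee_fin.
  - apply/measurable_EFinP; apply: measurableT_comp => //.
    by apply: measurable_funB => //; exact: measurable_funS mv.
  - by move=> x _; rewrite lee_fin.
  - by apply/measurable_EFinP; exact: measurable_indic.
  apply: (@le_trans _ _ (\int[M]_(x in B) (`|1 - t|%:E * (\1_E x)%:E + `|t|%:E * (\1_(~` E) x)%:E))%E).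
    have mEC : measurable (~` E) by exact: measurableC.
    rewrite ge0_integralD; last 5 first.
    - exact: mB.
    - by move=> x _; rewrite -EFinM lee_fin mulr_ge0.
    - by apply/measurable_EFinP; apply: measurable_funM => //; exact: measurable_indic.
    - by move=> x _; rewrite -EFinM lee_fin mulr_ge0.
    - by apply/measurable_EFinP; apply: measurable_funM => //; exact: measurable_indic.
    rewrite ge0_integralZl_EFin; last 4 first.
    - exact: mB.
    - by move=> x _; rewrite lee_fin.
    - by apply/measurable_EFinP; exact: measurable_indic.
    - exact: normr_ge0.
    rewrite ge0_integralZl_EFin; last 4 first.
    - exact: mB.
    - by move=> x _; rewrite lee_fin.
    - by apply/measurable_EFinP; exact: measurable_indic.
    - exact: normr_ge0.
    rewrite !integral_indic// (setIC (~` E)) -setDE.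
    rewrite [X in (_ <= _ * X + _)%E](mu_sub_ballE dbl (x := z) (r := rho)); last by move=> y [].
    rewrite [X in (_ <= _ + _ * X)%E](mu_sub_ballE dbl (x := z) (r := rho)); last by move=> y [].
    rewrite -!EFinM -EFinD lee_fin.
    have t1 : 1 <= `|1 - t| + `|t|.
      by apply: le_trans (ler_normD _ _); rewrite subrK normr1.
    have cB0 : 0 < c * m B by rewrite mulr_gt0.
    apply: (@le_trans _ _ ((`|1 - t| + `|t|) * (c * m B))); first by rewrite ler_peMl// ltW.
    by rewrite mulrDl lerD// ler_wpM2l.
  apply: ge0_le_integral_ext => x Bx.
    by rewrite -!EFinM -EFinD lee_fin addr_ge0// mulr_ge0.
  rewrite -!EFinM -!EFinD lee_fin.
  have := v_indic Bx; set w := \1_(_ `|` _) x => hw.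
  apply: le_trans (_ : `|v x - t| + `|v x - \1_E x| <= _); last by rewrite lerD2l.
  rewrite [X in `|t| * X](_ : _ = 1 - \1_E x); last first.
    by rewrite !indicE in_setC; case: (x \in E); rewrite ?subrr ?subr0.
  have [->|->] : \1_E x = 0 :> R \/ \1_E x = 1 :> R.
    by rewrite indicE; case: (x \in E); [right|left].
  - rewrite mulr0 subr0 mulr1 add0r subr0 addrC.
    by have := ler_normB (v x) (v x - t); rewrite subKr.
  - rewrite subrr mulr1 mulr0 addr0 [leRHS]addrC (distrC (v x) 1).
    exact: ler_distD.
have W1WB : mu ((W1 `|` W) `&` B) = (m ((W1 `|` W) `&` B))%:E.
  by apply: (mu_sub_ballE dbl (x := z) (r := rho)) => y [].
have W1WB' : m ((W1 `|` W) `&` B) <= m W1 + m (W `&` tB).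
  rewrite -lee_fin -W1WB EFinD.
  rewrite -(mu_sub_ballE dbl (x := z) (r := (tauP + 2) * rho)); last by move=> y [].
  rewrite -(mu_sub_ballE dbl (x := z) (r := tauP * rho)); last by move=> y [].
  apply: le_trans (outer_measureU2 mu _ _); apply: le_outer_measure.
  by move=> y [[Wy|Wy] By]; [left|right; split => //; exact: BtB].
move: low h; rewrite W1WB -(fineK I1fin); set i1 := fine I1.
rewrite -!EFinM -EFinD !lee_fin => low h.
have {}h : i1 <= CP * (rho / d) * m (W `&` tB).
  rewrite ler_pdivrMl// in h; apply: (le_trans h).
  have -> : m B * (CP * rho * ((m tB)^-1 * (d^-1 * m (W `&` tB)))) =
      CP * (rho / d) * m (W `&` tB) * (m B / m tB).
    by field; rewrite !gt_eqF//.
  rewrite ler_piMr//; last by rewrite ler_pdivrMr// mul1r.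
  by rewrite mulr_ge0 ?m_ge0// mulr_ge0 ?divr_ge0// ltW.
have rd : 1 <= rho / d.
  by rewrite ler_pdivlMr// mul1r; apply: le_trans drho; rewrite ler_peMl ?ler1n// ltW.
(* The constant 10 is 4 from the gradient term, 2 from [W1] and 4 from [W]; the last two are
   absorbed using [1 <= CP * (rho / d)]. *)
have cB : c * m B <= (10 * CP * D ^+ 7 * J) * (rho / d).
  set x := rho / d in h rd *.
  have x0 : 0 < x by lra.
  apply: (le_trans low); apply: (le_trans (lerD h W1WB')).
  apply: (@le_trans _ _ (CP * x * (4 * D ^+ 7 * J) + (2 * D ^+ 3 * J + 4 * D ^+ 7 * J))).
    apply: lerD; last exact: lerD.
    by rewrite ler_pM2l// mulr_gt0.
  have DJ0 : 0 <= D ^+ 7 * J by rewrite mulr_ge0// ltW.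
  have DJ : D ^+ 3 * J <= D ^+ 7 * J by rewrite ler_wpM2r.
  have CPx : 1 <= CP * x by rewrite -[1]mulr1 ler_pM.
  have h1 : D ^+ 7 * J <= CP * x * (D ^+ 7 * J) by rewrite ler_peMl.
  by have -> : 10 * CP * D ^+ 7 * J * x = 10 * (CP * x * (D ^+ 7 * J)) by [ring|]; lra.
rewrite [leLHS](_ : _ = (c * m B) / (rho / d)); last by rewrite invf_div; ring.
by rewrite ler_pdivrMr// divr_gt0.
Qed.

End one_scale.
End set_poincare.

(** * The dyadic kernel *)

Section setX_integral.
Local Open Scope ereal_scope.
Context d1 d2 (T1 : measurableType d1) (T2 : measurableType d2) (R : realType).
Variables (m1 : {sigma_finite_measure set T1 -> \bar R}).
Variables (m2 : {sigma_finite_measure set T2 -> \bar R}).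
Variables (A : set T1) (B : set T2) (f : T1 * T2 -> \bar R).
Hypotheses (mA : measurable A) (mB : measurable B).
Hypotheses (mf : measurable_fun setT f) (f0 : forall z, 0 <= f z).

Let fAB : T1 * T2 -> \bar R := f \_ (A `*` B).

Let mfAB : measurable_fun setT fAB.
Proof.
apply/(measurable_restrictT f); first exact: measurableX.
exact: measurable_funS mf.
Qed.

Let fAB0 z : 0 <= fAB z.
Proof. by apply: erestrict_ge0. Qed.

Lemma ge0_integral_setX :
  \int[m1 \x m2]_(z in A `*` B) f z = \int[m1]_(x in A) \int[m2]_(y in B) f (x, y).
Proof.
rewrite integral_mkcond -/fAB (fubini_tonelli1 fAB mfAB fAB0) [RHS]integral_mkcond.
apply: eq_integral => x _; rewrite /fubini_F /patch; case: ifPn => xA.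
  rewrite [RHS]integral_mkcond; apply: eq_integral => y _.
  by rewrite /fAB /patch in_setX/= xA.
by under eq_integral do rewrite /fAB /patch in_setX/= (negbTE xA)/=; rewrite integral0.
Qed.

Lemma ge0_integral_setX_swap :
  \int[m1]_(x in A) \int[m2]_(y in B) f (x, y) =
  \int[m2]_(y in B) \int[m1]_(x in A) f (x, y).
Proof.
rewrite -ge0_integral_setX integral_mkcond -/fAB (fubini_tonelli2 fAB mfAB fAB0).
rewrite [RHS]integral_mkcond.
apply: eq_integral => y _; rewrite /fubini_G /patch; case: ifPn => yB.
  rewrite [RHS]integral_mkcond; apply: eq_integral => x _.
  by rewrite /fAB /patch in_setX/= yB andbT.
by under eq_integral do rewrite /fAB /patch in_setX/= (negbTE yB) andbF/=; rewrite integral0.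
Qed.

End setX_integral.

Lemma measurable_fun_integral_section d1 d2 (T1 : measurableType d1)
    (T2 : measurableType d2) (R : realType)
    (m2 : {sigma_finite_measure set T2 -> \bar R}) (B : set T2)
    (f : T1 * T2 -> \bar R) : measurable B ->
  measurable_fun setT f -> (forall z, 0 <= f z)%E ->
  measurable_fun setT (fun x => \int[m2]_(y in B) f (x, y))%E.
Proof.
move=> mB mf f0; pose g : T1 * T2 -> \bar R := f \_ (setT `*` B).
have mg : measurable_fun setT g.
  apply/(measurable_restrictT f); first exact: measurableX.
  exact: measurable_funS mf.
have g0 z : (0 <= g z)%E by apply: erestrict_ge0.
apply: (eq_measurable_fun (fubini_F m2 g)); last first.
  exact: measurable_fun_fubini_tonelli_F.
move=> x _.
rewrite /fubini_F [RHS]integral_mkcond; apply: eq_integral => y _.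
by rewrite /g /patch in_setX/= in_setT.
Qed.

(** * Weights of the dyadic scales and the factor [1 / (1 - th)] *)

Section dyadic_weights.
Context {R : realType}.
Implicit Types (th x : R) (n : nat).

(** From [exp x >= 1 + x] and [ln 2 <= 1]. It turns the sum [1 / (1 - 2^(th - 1))] of the geometric
    series into [1 / (1 - th)]. *)
Lemma powR2_ge th : th <= 1 -> 1 - 2 `^ (th - 1) <= 1 - th :> R.
Proof.
move=> th1; rewrite lerD2l lerN2 -[in leRHS]opprB.
have e : 2 `^ (- (1 - th)) = expR (- (1 - th) * ln 2) :> R by rewrite /powR pnatr_eq0.
rewrite e; apply: le_trans (expR_ge1Dx _).
have l2 : ln 2 <= 1 :> R.
  by have := @le_ln1Dx R 1; rewrite -[1 + 1]/2%:R; apply; lra.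
have l20 : 0 <= ln 2 :> R by rewrite ln_ge0// ler1n.
by nra.
Qed.

(** With [x = y / 2] the summands are [(x - 1 / 2) * x^i], a geometric progression. *)
Lemma geometric_weights (y : R) n : y != 0 ->
  (1 + \sum_(i < n) (y ^+ i.+1 - y ^+ i) / 2 ^+ i.+1) * (1 - y / 2) =
  2^-1 - (y / 2 - 2^-1) * (y / 2) ^+ n.
Proof.
move=> y0; elim: n => [|n ih]; first by rewrite big_ord0 expr0; field.
rewrite big_ord_recr/= addrA mulrDl ih !exprS !exprMn !exprVn.
have : (2 : R) ^+ n != 0 by rewrite expf_neq0// pnatr_eq0.
move: (2 ^+ n) (y ^+ n) => a b a0.
by field.
Qed.

Lemma expr_small (x : R) : 0 <= x -> x < 1 -> exists n, x ^+ n <= 2^-1.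
Proof.
move=> x0 x1; have xn : `|x| < 1 by rewrite ger0_norm.
have h0 : 0 < 2^-1 :> R by rewrite invr_gt0.
have [N _ HN] := cvgr0_norm_lt (fun n => x ^+ n) (cvg_expr xn) _ h0.
exists N; have := HN N (leqnn N); rewrite /= ger0_norm ?exprn_ge0// => /ltW; exact.
Qed.

(** The number [n] of scales grows as [th] tends to 1, but the constant 4 does not: with
    [x = 2^(th - 1)] in [(1 / 2, 1)] and [x^n <= 1 / 2], the closed form is at least
    [1 / 2 - 1 / 4]. *)
Lemma dyadic_weights_ge th : 0 < th -> th < 1 -> exists n,
  (4 * (1 - th))^-1 <=
  1 + \sum_(i < n) ((2 `^ th) ^+ i.+1 - (2 `^ th) ^+ i) / 2 ^+ i.+1.
Proof.
move=> th0 th1; set y := 2 `^ th.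
have p1 (r : R) : 0 < r -> 1 < 2 `^ r.
  by move=> r0; have := congr1 (@^~ r) (powR1 R) => /= h1; rewrite -[ltLHS]h1; apply: gt0_ltr_powR => //; rewrite ?nnegrE ?ltr1n.
have y1 : 1 < y by exact: p1.
have y2 : y / 2 = 2 `^ (th - 1).
  by rewrite powRD ?pnatr_eq0 ?implybT// powR_inv1.
have x1 : y / 2 < 1.
  by rewrite y2 -opprB powRN invf_lt1 ?(lt_trans ltr01)// p1// subr_gt0.
have x0 : 0 < y / 2 by rewrite divr_gt0//; lra.
have [n xn] := expr_small (ltW x0) x1; exists n.
have yn0 : y != 0 by rewrite gt_eqF//; lra.
have := geometric_weights n yn0.
have := powR2_ge (ltW th1); rewrite -y2.
have xn0 : 0 < (y / 2) ^+ n by rewrite exprn_gt0.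
set x := y / 2 in x0 x1 xn xn0 *; set s := 1 + \sum_(i < n) _; set p := x ^+ n in xn xn0 *.
move=> h1 h2.
have : 4^-1 <= s * (1 - x) by rewrite h2; nra.
move=> h3; rewrite invfM -ler_pdivlMr ?invr_gt0 ?subr_gt0// invrK.
apply: (le_trans h3); rewrite ler_pM2l//; nra.
Qed.

End dyadic_weights.

Definition cara_sigma_finite_measure (R : realType) (X : pointedMetricType R)
    (mu : {outer_measure set X -> \bar R})
    (h : sigma_finite setT (cara_measure mu)) :
    {sigma_finite_measure set (caratheodory_type mu) -> \bar R} :=
  HB.pack (Measure.sort (cara_measure mu))
          (Measure_isSigmaFinite.Build _ _ _ (cara_measure mu) h).

Section dyadic_kernel.
Context {R : realType} {X : completeMetricType R}.
Variables (mu : {outer_measure set X -> \bar R}) (D C0 Q CP tauP : R).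
Hypotheses (breg : borel_regular mu) (dbl : doubling mu D).
Hypotheses (lmb : relative_lower_mass_bound mu C0 Q) (C01 : 1 <= C0).
Hypothesis poi : poincare11 mu CP tauP.
Variables (th r0 : R).
Hypotheses (th0 : 0 < th) (th1 : th < 1) (r00 : 0 < r0).

Local Notation T := (caratheodory_type mu).
Local Notation m A := (fine (mu A)).
Local Notation M := (cara_measure mu).

Let D1 := D_ge1 dbl.
Let D0 : 0 < D. Proof. exact: lt_le_trans D1. Qed.

Definition Ms := cara_sigma_finite_measure (sigma_finite_cara breg dbl).

Definition dyadic_scale (j : nat) : R := r0 / 2 ^+ j.

Lemma scale_gt0 j : 0 < dyadic_scale j.
Proof. by rewrite divr_gt0// exprn_gt0. Qed.

Lemma scaleS j : dyadic_scale j = 2 * dyadic_scale j.+1.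
Proof.
rewrite /dyadic_scale exprS; have : (2 : R) ^+ j != 0 by rewrite expf_neq0// pnatr_eq0.
by move: (2 ^+ j) => a a0; field.
Qed.

Definition near_diag (s : R) : set (T * T) :=
  [set xy : T * T | mdist (xy.1 : X) (xy.2 : X) < s].

Definition scale_density (s : R) (xy : T * T) : R :=
  \1_(near_diag s) xy / m (ball (xy.1 : X) s).

Lemma scale_density_ge0 s xy : 0 <= scale_density s xy.
Proof. by rewrite mulr_ge0// invr_ge0 m_ge0. Qed.

(** The ball about [x] is the section at [x] of the measurable set [near_diag s]. *)
Lemma measurable_m_ball s : measurable_fun setT (fun x : T => m (ball (x : X) s)).
Proof.
have mN : measurable (near_diag s) by exact: (measurable_mdist_lt breg dbl lmb C01).
have h := measurable_fun_xsection Ms mN.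
apply: (eq_measurable_fun (fine \o (Ms \o xsection (near_diag s)))); last first.
  by apply: measurableT_comp => //; exact: measurable_fine.
move=> x _; rewrite /= xsectionE ballEmdist; congr fine; congr (mu _).
Qed.

Lemma measurable_scale_density s : measurable_fun setT (scale_density s).
Proof.
apply: measurable_funM.
  by apply: measurable_indic; exact: (measurable_mdist_lt breg dbl lmb C01).
apply: (eq_measurable_fun (fun xy : T * T => m (ball (xy.1 : X) s) `^ (-1))).
  by move=> xy _; rewrite powR_inv1// m_ge0.
apply: (measurableT_comp (measurable_powR _)).
exact: (measurableT_comp (measurable_m_ball s) measurable_fst).
Qed.

(** Measurable as a countable supremum. A supremum rather than a sum over scales keeps it below the
    fractional kernel with constant 1, uniformly in [th]. *)
Definition dyadic_kernel (xy : T * T) : \bar R :=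
  esups (fun j => (dyadic_scale j `^ (- th) * scale_density (dyadic_scale j) xy)%:E) 0.

Lemma dyadic_kernel_ge j xy :
  ((dyadic_scale j `^ (- th) * scale_density (dyadic_scale j) xy)%:E <= dyadic_kernel xy)%E.
Proof. by apply: ereal_sup_ubound; exists j. Qed.

Lemma dyadic_kernel_ge0 xy : (0 <= dyadic_kernel xy)%E.
Proof.
apply: le_trans (dyadic_kernel_ge 0 xy).
by rewrite lee_fin mulr_ge0 ?powR_ge0// scale_density_ge0.
Qed.

Lemma measurable_dyadic_kernel : measurable_fun setT dyadic_kernel.
Proof.
apply: (@measurable_fun_esups _ _ _ _ (fun j xy => (dyadic_scale j `^ (- th) * scale_density (dyadic_scale j) xy)%:E)).
move=> j; apply/measurable_EFinP; apply: measurable_funM => //.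
exact: measurable_scale_density.
Qed.

(** Only scales [s > d(x, y)] contribute, and both [s^th] and the mass of the ball of radius [s]
    increase with [s]. *)
Lemma dyadic_kernel_le (x y : X) : x != y ->
  (dyadic_kernel (x : T, y : T) <=
   ((mdist x y `^ th * m (ball x (mdist x y)))^-1)%:E)%E.
Proof.
move=> xy; have d0 : 0 < mdist x y by rewrite mdist_gt0.
apply: ge_ereal_sup => _ [j _ <-]; rewrite lee_fin /scale_density indicE.
have R0 : 0 < mdist x y `^ th * m (ball x (mdist x y)).
  by rewrite mulr_gt0 ?powR_gt0//; apply: (m_ball_gt0 dbl).
case: (boolP (_ \in near_diag _)) => [|_]; last by rewrite mul0r mulr0 invr_ge0 ltW.
rewrite inE /near_diag/= => ds; have s0 := scale_gt0 j.
rewrite mul1r powRN -invfM lef_pV2 ?posrE//; last first.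
  by rewrite mulr_gt0 ?powR_gt0//; apply: (m_ball_gt0 dbl).
apply: ler_pM; rewrite ?powR_ge0 ?m_ge0//.
  by apply: ge0_ler_powR; rewrite ?nnegrE ltW.
by apply: (le_m dbl _ (@subset_refl _ _)); apply: le_ball; exact: ltW.
Qed.

(** Summation by parts: the density [1 / mu (B (x, s))] increases as [s] decreases, so replacing it
    in every increment by its value at the smallest scale still above [d(x, y)] leaves a telescoping
    sum equal to one term of the supremum. *)
Lemma dyadic_kernel_telescope j n xy :
  ((dyadic_scale j `^ (- th) * scale_density (dyadic_scale j) xy +
   \sum_(i < n) (dyadic_scale (j + i.+1) `^ (- th) - dyadic_scale (j + i) `^ (- th)) *
                scale_density (dyadic_scale (j + i.+1)) xy)%:E <= dyadic_kernel xy)%E.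
Proof.
pose S n := dyadic_scale j `^ (- th) * scale_density (dyadic_scale j) xy +
   \sum_(i < n) (dyadic_scale (j + i.+1) `^ (- th) - dyadic_scale (j + i) `^ (- th)) *
                scale_density (dyadic_scale (j + i.+1)) xy.
(* The induction carries the sharper bound by the current term as long as the pair is within the
   current scale; afterwards the increments vanish and only the first bound is kept. *)
suff : ((S n)%:E <= dyadic_kernel xy)%E /\
  (near_diag (dyadic_scale (j + n)) xy ->
   S n <= dyadic_scale (j + n) `^ (- th) * scale_density (dyadic_scale (j + n)) xy) by case.
elim: n => [|n [ih1 ih2]].
  by rewrite /S big_ord0 addr0 addn0; split => //; exact: dyadic_kernel_ge.
have SS : S n.+1 = S n + (dyadic_scale (j + n.+1) `^ (- th) - dyadic_scale (j + n) `^ (- th)) *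
                scale_density (dyadic_scale (j + n.+1)) xy.
  by rewrite /S big_ord_recr/= addrA.
have [nd|nnd] := pselect (near_diag (dyadic_scale (j + n.+1)) xy); last first.
  by rewrite SS /scale_density [X in X / _]indicE memNset// mul0r mulr0 addr0; split.
have sS : dyadic_scale (j + n) = 2 * dyadic_scale (j + n.+1) by rewrite addnS -scaleS.
have sj0 := scale_gt0 (j + n.+1).
have nd' : near_diag (dyadic_scale (j + n)) xy.
  by move: nd; rewrite /near_diag/= sS; lra.
suff h : S n.+1 <= dyadic_scale (j + n.+1) `^ (- th) * scale_density (dyadic_scale (j + n.+1)) xy.
  by split => //; apply: le_trans (dyadic_kernel_ge (j + n.+1) xy); rewrite lee_fin.
rewrite SS mulrBl addrCA gerDl subr_le0; apply: (le_trans (ih2 nd')).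
rewrite ler_wpM2l ?powR_ge0// /scale_density !indicE !mem_set// !mul1r.
rewrite lef_pV2 ?posrE ?(m_ball_gt0 dbl) ?scale_gt0//.
by apply: (le_m dbl _ (@subset_refl _ _)); apply: le_ball; rewrite sS; lra.
Qed.

Definition dyadic_energy (w : T -> R) (O : set T) : \bar R :=
  (\int[Ms \x Ms]_(xy in O `*` O) (`|w xy.1 - w xy.2|%:E * dyadic_kernel xy))%E.

Lemma scale_powRN j i : dyadic_scale (j + i) `^ (- th) = dyadic_scale j `^ (- th) * (2 `^ th) ^+ i.
Proof.
have -> : dyadic_scale (j + i) = dyadic_scale j * (2^-1 ^+ i).
  by rewrite /dyadic_scale exprD invfM mulrA exprVn.
rewrite powRM ?exprn_ge0 ?invr_ge0 ?ltW ?scale_gt0//; congr (_ * _).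
elim: i => [|i ih]; first by rewrite !expr0 powR1.
rewrite !exprS powRM ?exprn_ge0 ?invr_ge0// ih; congr (_ * _).
by rewrite -powR_inv1// -powRrM mulN1r opprK.
Qed.

Lemma measurable_energy_integrand (w : T -> R) : measurable_fun setT w ->
  measurable_fun setT (fun xy : T * T => `|w xy.1 - w xy.2|).
Proof.
move=> mw; apply: measurableT_comp => //; apply: measurable_funB.
  exact: (measurableT_comp mw measurable_fst).
exact: (measurableT_comp mw measurable_snd).
Qed.

(** The one-scale inequality is applied at all scales [j + i] in the same ball and summed with the
    telescoping weights, whose total against [2^-i] is at least [1 / (4 * (1 - th))]. *)
Lemma energy_ge_scale (E : set T) (z : X) (c : R) (j : nat) :
  measurable E -> 0 < c ->
  c * m (ball z (dyadic_scale j)) <= m (E `&` ball z (dyadic_scale j)) ->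
  c * m (ball z (dyadic_scale j)) <= m (ball z (dyadic_scale j) `\` E) ->
  ((c * m (ball z (dyadic_scale j)) * dyadic_scale j `^ (- th))%:E <=
   (320 * CP * D ^+ 7 * (1 - th))%:E *
   dyadic_energy \1_E (ball z ((tauP + 2) * dyadic_scale j)))%E.
Proof.
move=> mE' c0 EB ECB; set O : set T := ball z ((tauP + 2) * dyadic_scale j); set B := ball z (dyadic_scale j).
have mO : measurable O by exact: (measurable_ball_cara breg).
have CP0 : 0 < CP by case: poi => /(lt_le_trans ltr01).
have D70 : 0 < D ^+ 7 by rewrite exprn_gt0.
have sj0 := scale_gt0 j.
have [n hn] := dyadic_weights_ge th0 th1.
pose g i (xy : T * T) := (`|\1_E xy.1 - \1_E xy.2| * scale_density (dyadic_scale (j + i)) xy)%:E.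
have mg i : measurable_fun setT (g i).
  apply/measurable_EFinP; apply: measurable_funM; last exact: measurable_scale_density.
  by apply: measurable_energy_integrand; exact: measurable_indic.
have g0 i xy : (0 <= g i xy)%E by rewrite lee_fin mulr_ge0// scale_density_ge0.
pose e i x := (\int[Ms]_(y in O) g i (x, y))%E.
have me i : measurable_fun setT (e i) by exact: measurable_fun_integral_section.
have e0 i x : (0 <= e i x)%E by exact: integral_ge0.
have ge i (x : T) (V : set T) : measurable V -> V `<=` O `&` ball (x : X) (dyadic_scale (j + i)) ->
    (forall y, V y -> `|\1_E x - \1_E y| = 1 :> R) ->
    ((m V / m (ball (x : X) (dyadic_scale (j + i))))%:E <= e i x)%E.
  move=> mV VO VE.
  rewrite mulrC EFinM -(mu_sub_ballE dbl (x := x) (r := dyadic_scale (j + i))); last by move=> y /VO[].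
  apply: le_measure_integral => //; last 2 first.
  - move=> y Vy; rewrite /g/= VE// mul1r lee_fin /scale_density indicE mem_set ?mul1r//.
    by have [_] := VO _ Vy; rewrite ballEmdist.
  - by rewrite invr_ge0 m_ge0.
  - by move=> y /VO[].
  - apply: (@measurable_funS _ _ _ _ setT) => //.
    exact: (measurableT_comp (mg i) (measurable_pair1 x)).
(* [set_poincare_scale] with [d] equal to an eighth of [dyadic_scale (j + i)], so that its balls of
   radius [8 * d] have that scale; the factor [2^-i / 8] is [d / rho]. *)
have hi i : ((c * ((2 ^+ i)^-1 / 8) * m B)%:E <= (10 * CP * D ^+ 7)%:E * \int[Ms \x Ms]_(xy in O `*` O) g i xy)%E.
  rewrite (ge0_integral_setX _ _ mO mO (mg i) (g0 i)) -/(e i).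
  have s8 : 8 * (dyadic_scale (j + i) / 8) = dyadic_scale (j + i) by rewrite mulrC divfK// pnatr_eq0.
  have := @set_poincare_scale R X mu D C0 Q CP tauP breg dbl lmb C01 poi E z (dyadic_scale j) (dyadic_scale (j + i) / 8) c (e i).
  rewrite !s8 => /(_ mE'); rewrite divr_gt0 ?scale_gt0// => /(_ isT).
  have sle : dyadic_scale (j + i) <= dyadic_scale j.
    by rewrite /dyadic_scale ler_pM2l// lef_pV2 ?posrE ?exprn_gt0// ler_weXn2l ?ler1n// leq_addr.
  move=> /(_ sle c0 (me i) (e0 i)).
  have -> : dyadic_scale (j + i) / 8 / dyadic_scale j = (2 ^+ i)^-1 / 8.
    by rewrite /dyadic_scale exprD; field; rewrite !expf_neq0 ?pnatr_eq0// gt_eqF.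
  move=> H; apply: H => //.
  - move=> x V mV Ox Ex VO; apply: ge => //; first by move=> y /VO[].
    by move=> y /VO[_ nEy]; rewrite !indicE mem_set// memNset// subr0 normr1.
  - move=> x V mV Ox nEx VO; apply: ge => //; first by move=> y /VO[].
    by move=> y /VO[_ Ey]; rewrite !indicE memNset// mem_set// sub0r normrN normr1.
pose W i := dyadic_scale (j + i.+1) `^ (- th) - dyadic_scale (j + i) `^ (- th).
have y1 : 1 <= 2 `^ th :> R.
  have := @ler_powR R 2 (ler1n _ _) 0 th (ltW th0); by rewrite powRr0.
have W0 i : 0 <= W i.
  by rewrite /W !scale_powRN subr_ge0 ler_pM2l ?powR_gt0// ler_weXn2l.
have mOO : measurable (O `*` O) by exact: measurableX.
have low : (((dyadic_scale j `^ (- th))%:E * \int[Ms \x Ms]_(xy in O `*` O) g 0%N xy +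
   \sum_(i < n) (W i)%:E * \int[Ms \x Ms]_(xy in O `*` O) g i.+1 xy) <= dyadic_energy \1_E O)%E.
  have mgO i : measurable_fun (O `*` O) (g i) by exact: measurable_funS (mg i).
  rewrite -ge0_integralZl_EFin ?powR_ge0//.
  under eq_bigr do rewrite -ge0_integralZl_EFin//.
  rewrite -(@ge0_integral_sum _ _ _ (Ms \x Ms)%E _ mOO _ (fun (i : 'I_n) xy => (W i)%:E * g i.+1 xy)%E); last 2 first.
  - by move=> i; apply: emeasurable_funM => //.
  - by move=> i xy _; rewrite mule_ge0// lee_fin.
  rewrite -ge0_integralD//; last 4 first.
  - by move=> xy _; rewrite mule_ge0// lee_fin powR_ge0.
  - by apply: emeasurable_funM.
  - by move=> xy _; apply: sume_ge0 => i _; rewrite mule_ge0// lee_fin.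
  - by apply: emeasurable_sum => i; apply: emeasurable_funM.
  apply: ge0_le_integral_ext => xy _.
    rewrite adde_ge0// ?mule_ge0// ?lee_fin ?powR_ge0//.
    by apply: sume_ge0 => i _; rewrite mule_ge0// lee_fin.
  apply: le_trans (lee_wpmul2l _ (dyadic_kernel_telescope j n xy)); last by rewrite lee_fin.
  rewrite le_eqVlt; apply/orP; left; apply/eqP.
  rewrite -!EFinM; under eq_bigr do rewrite -EFinM.
  rewrite sumEFin -EFinD; congr EFin; rewrite mulrDr addn0 mulrCA; congr (_ + _).
  by rewrite mulr_sumr; apply: eq_bigr => i _; rewrite mulrCA.
set A := 10 * CP * D ^+ 7 in hi.
have A0 : 0 < A by rewrite !mulr_gt0.
have : ((dyadic_scale j `^ (- th) * (c * ((2 ^+ 0)^-1 / 8) * m B) +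
    \sum_(i < n) W i * (c * ((2 ^+ i.+1)^-1 / 8) * m B))%:E <= A%:E * dyadic_energy \1_E O)%E.
  apply: le_trans (lee_wpmul2l _ low); last by rewrite lee_fin ltW.
  rewrite ge0_muleDr; last 2 first.
  - by rewrite mule_ge0 ?lee_fin ?powR_ge0// integral_ge0.
  - by apply: sume_ge0 => i _; rewrite mule_ge0 ?lee_fin// integral_ge0.
  rewrite EFinD; apply: leeD.
    by rewrite muleCA EFinM; apply: lee_wpmul2l => //; rewrite lee_fin powR_ge0.
  rewrite ge0_sume_distrr; last by move=> i _; rewrite mule_ge0 ?lee_fin// integral_ge0.
  rewrite -sumEFin; apply: lee_sum => i _.
  by rewrite muleCA EFinM; apply: lee_wpmul2l => //; rewrite lee_fin.
set L := (X in (X%:E <= _)%E) => hL.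
have B0 : 0 < m B by apply: (m_ball_gt0 dbl).
have LE : L = c * m B * dyadic_scale j `^ (- th) / 8 *
   (1 + \sum_(i < n) ((2 `^ th) ^+ i.+1 - (2 `^ th) ^+ i) / 2 ^+ i.+1).
  rewrite /L mulrDr mulr1 expr0 invr1; congr (_ + _); first by ring.
  rewrite mulr_sumr; apply: eq_bigr => i _; rewrite /W !scale_powRN -mulrBr.
  by ring.
have {}hL : ((c * m B * dyadic_scale j `^ (- th) / 8 * (4 * (1 - th))^-1)%:E <= A%:E * dyadic_energy \1_E O)%E.
  apply: le_trans hL; rewrite lee_fin LE ler_pM2l//.
  by rewrite divr_gt0// mulr_gt0 ?powR_gt0// mulr_gt0.
have th1' : 0 < 1 - th by rewrite subr_gt0.
(* Here 320 is 10 from the one-scale inequality, 8 from the choice of [d] and 4 from the weights. *)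
have -> : 320 * CP * D ^+ 7 * (1 - th) = (32 * (1 - th)) * A by rewrite /A; ring.
rewrite [in leRHS]EFinM -muleA.
apply: le_trans (lee_wpmul2l _ hL); last by rewrite lee_fin mulr_ge0// ltW.
rewrite -EFinM lee_fin le_eqVlt; apply/orP; left; apply/eqP.
by field; rewrite gt_eqF.
Qed.

End dyadic_kernel.

(** * Boxing inequality *)

(** Applied to relative masses [a i] and relative radii [t i] of balls. Write [S^(1/q)] as
    [S * S^(-al)] with [al = 1 - 1/q]; each [S^(-al)] is bounded through [S >= a i >= t i^Q / C0],
    which gives [C0 * t i^(-Q * al)], at most [C0 * t i^(-th)]. *)
Lemma sum_powR_le (R : realType) (I : eqType) (l : seq I) (a t : I -> R)
    (C0 Q th q : R) :
  1 <= C0 -> 1 < Q -> 0 < th -> th < 1 -> 1 <= q -> q <= Q / (Q - th) ->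
  {in l, forall i, [/\ 0 < a i, 0 < t i, t i <= 1 & C0^-1 * t i `^ Q <= a i]} ->
  (\sum_(i <- l) a i) `^ q^-1 <= C0 * \sum_(i <- l) a i * t i `^ (- th).
Proof.
move=> C01 Q1 th0 th1 q1 qQ H; set S := \sum_(i <- l) a i.
have q0 : 0 < q by lra.
have C00 : 0 < C0 by lra.
have S0 : 0 <= S by rewrite /S big_seq; apply: sumr_ge0 => i /H[/ltW].
have [S00|Sn0] := eqVneq S 0.
  rewrite S00 powR0 ?invr_eq0 ?gt_eqF// mulr_ge0 ?(ltW C00)//.
  by rewrite big_seq; apply: sumr_ge0 => i /H[/ltW ai _ _ _]; rewrite mulr_ge0// powR_ge0.
have Sp : 0 < S by rewrite lt_neqAle eq_sym Sn0.
pose al := 1 - q^-1.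
have al0 : 0 <= al by rewrite subr_ge0 invf_le1.
have al1 : al <= 1 by rewrite /al gerBl invr_ge0 ltW.
have Qth : 0 < Q - th by lra.
(* This is the hypothesis [q <= Q / (Q - th)] rewritten, the only use of the upper bound on [q]. *)
have Qal : Q * al <= th.
  have : (Q - th) / Q <= q^-1 by rewrite -invf_div lef_pV2 ?posrE ?divr_gt0//; lra.
  rewrite ler_pdivrMr; last by lra.
  by rewrite /al mulrBr mulr1 mulrC; lra.
have -> : S `^ q^-1 = S * S `^ (- al).
  rewrite -{2}(powRr1 S0) -powRD; last by rewrite Sn0 implybT.
  by congr (_ `^ _); rewrite /al opprB addrCA subrr addr0.
rewrite {1}/S mulr_suml mulr_sumr big_seq [leRHS]big_seq; apply: ler_sum => i il.
have [ai ti ti1 hi] := H i il.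
rewrite mulrCA ler_pM2l//.
have aS : a i <= S.
  rewrite /S (big_rem i)//= lerDl big_seq; apply: sumr_ge0 => k kl.
  by have [/ltW] := H k (mem_rem kl).
have b0 : 0 < C0^-1 * t i `^ Q by rewrite mulr_gt0 ?invr_gt0// powR_gt0.
have bS : C0^-1 * t i `^ Q <= S by exact: le_trans aS.
apply: (@le_trans _ _ ((C0^-1 * t i `^ Q) `^ (- al))).
  rewrite !powRN lef_pV2 ?posrE ?powR_gt0//.
  by apply: ge0_ler_powR; rewrite ?nnegrE ?(ltW b0).
rewrite powRM ?invr_ge0 ?powR_ge0 ?(ltW C00)//.
apply: ler_pM; rewrite ?powR_ge0//.
  rewrite -powR_inv1 ?(ltW C00)// -powRrM mulN1r opprK.
  by rewrite -[leRHS](powRr1 (ltW C00)); apply: ler_powR.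
have tE x : t i `^ (- x) = (t i)^-1 `^ x.
  by rewrite -(powR_inv1 (ltW ti)) -powRrM mulN1r.
by rewrite -powRrM mulrN !tE; apply: ler_powR => //; rewrite invf_ge1.
Qed.

Section boxing.
Context {R : realType} {X : completeMetricType R}.
Variables (mu : {outer_measure set X -> \bar R}) (D C0 Q CP tauP : R).
Hypotheses (breg : borel_regular mu) (dbl : doubling mu D).
Hypotheses (lmb : relative_lower_mass_bound mu C0 Q) (C01 : 1 <= C0).
Hypothesis poi : poincare11 mu CP tauP.
Variables (th r0 : R).
Hypotheses (th0 : 0 < th) (th1 : th < 1) (r00 : 0 < r0).

Local Notation T := (caratheodory_type mu).
Local Notation m A := (fine (mu A)).
Local Notation M := (cara_measure mu).
Local Notation energy := (dyadic_energy breg dbl th r0).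
Local Notation scale := (dyadic_scale r0).

Let D1 := D_ge1 dbl.
Let D0 : 0 < D. Proof. exact: lt_le_trans D1. Qed.

(** Greedy selection from large to small radii. Only the centers have to be covered and later radii
    are no larger, so enlarging by 2 suffices. Stopping at finitely many scales [K] keeps the family
    a finite list. *)
Lemma vitali_scales (G : nat -> set X) (t : nat -> R) (z : X) (rho : R) :
  (forall k, 0 < t k) -> {homo t : i j / (i <= j)%N >-> j <= i} ->
  (forall k, G k `<=` ball z rho) -> forall K, exists l : seq (X * nat),
  [/\ pairwise (fun a b => `[< ball a.1 (t a.2) `&` ball b.1 (t b.2) = set0 >]) l,
      {in l, forall a, G a.2 a.1 /\ (a.2 < K)%N} &
      forall k y, (k < K)%N -> G k y -> exists2 a, a \in l & mdist a.1 y < 2 * t a.2].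
Proof.
move=> t0 tle Gz; elim=> [|K [l [pl lG lcov]]]; first by exists [::].
(* Centers of scale [K] not covered so far: their balls miss the earlier ones because
   [t K + t a.2 <= 2 * t a.2]. *)
pose S := [set y | G K y /\ {in l, forall a, 2 * t a.2 <= mdist a.1 y}].
have tK0 : 0 < 2 * t K by rewrite mulr_gt0.
have Sz : S `<=` ball z rho by move=> y [/Gz].
have [n [pn nS ncov]] := finite_net breg dbl lmb C01 tK0 Sz.
exists ([seq (x, K) | x <- n] ++ l); split.
- rewrite pairwise_cat pl andbT; apply/andP; split.
    apply/allrelP => _ a /mapP[x /nS[_ Sx] ->] al; apply/asboolP => /=.
    apply: disjoint_ball; have [_ aK] := lG _ al.
    have := Sx _ al; rewrite metric_sym.
    by have := tle _ _ (ltnW aK); lra.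
  rewrite pairwise_map; apply: sub_pairwise pn => x y xy; apply/asboolP => /=.
  by apply: disjoint_ball; lra.
- move=> a; rewrite mem_cat => /orP[/mapP[x /nS[Gx _] ->]//|/lG[Ga aK]].
  by split => //; exact: ltn_trans aK _.
- move=> k y; rewrite ltnS leq_eqVlt => /predU1P[->|kK] Gy; last first.
    by have [a al ay] := lcov k y kK Gy; exists a => //; rewrite mem_cat al orbT.
  have [Sy|nSy] := pselect (S y).
    have [x xn xy] := ncov _ Sy; exists (x, K) => //.
    by rewrite mem_cat map_f.
  apply: contrapT => H; apply: nSy; split => // a al.
  rewrite leNgt; apply/negP => ay; apply: H.
  by exists a => //; rewrite mem_cat al orbT.
Qed.

Lemma measurable_m_setI_ball (E : set T) s : measurable E ->
  measurable_fun setT (fun x : T => m (E `&` ball (x : X) s)).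
Proof.
move=> mE'.
have mN : measurable (@near_diag R X mu s `&` (setT `*` E)).
  apply: measurableI; first exact: (measurable_mdist_lt breg dbl lmb C01).
  exact: measurableX.
have h := measurable_fun_xsection (Ms breg dbl) mN.
apply: (eq_measurable_fun (fine \o (Ms breg dbl \o xsection (@near_diag R X mu s `&` (setT `*` E))))); last first.
  by apply: measurableT_comp => //; exact: measurable_fine.
move=> x _; rewrite /= xsectionE ballEmdist; congr fine; congr (mu _).
by apply/seteqP; split => y /=; [case=> h1 [_ Ey]|case=> Ey h1].
Qed.

Lemma measurable_set_le (f g : T -> R) : measurable_fun setT f ->
  measurable_fun setT g -> measurable [set x | f x <= g x].
Proof.
move=> mf mg; have mgf : measurable_fun setT (g \- f) by exact: measurable_funB.
have := mgf measurableT `[0, +oo[%classic (measurable_itv _).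
by congr measurable; apply/seteqP; split => x /=; rewrite in_itv/= andbT subr_ge0; [case|].
Qed.

(** The squares of disjoint sets are disjoint subsets of the square of their union; the pairs
    between different sets are discarded. *)
Lemma energy_superadditive (w : T -> R) (I : choiceType) (F : I -> set X)
    (l : seq I) (O : set X) :
  measurable_fun setT w ->
  measurable (O : set T) -> (forall i, measurable (F i : set T)) ->
  pairwise (fun i j => `[< F i `&` F j = set0 >]) l ->
  {in l, forall i, F i `<=` O} ->
  (\sum_(i <- l) energy w (F i) <= energy w O)%E.
Proof.
move=> mw; have mf : measurable_fun setT (fun xy : T * T =>
    `|w xy.1 - w xy.2|%:E * dyadic_kernel th r0 xy)%E.
  apply: emeasurable_funM.
    by apply/measurable_EFinP; exact: measurable_energy_integrand.
  exact: (measurable_dyadic_kernel breg dbl lmb C01).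
have f0 (xy : T * T) : (0 <= `|w xy.1 - w xy.2|%:E * dyadic_kernel th r0 xy)%E.
  by rewrite mule_ge0 ?lee_fin// dyadic_kernel_ge0.
apply: (@superadditive_seq _ T R (energy w)) => //.
- move=> A B mA mB AB; rewrite /dyadic_energy -ge0_integral_setU//; last 4 first.
  + exact: measurableX.
  + exact: measurableX.
  + exact: measurable_funS mf.
  + apply/disj_setPS => -[x y] [[/= Ax _] [/= Bx _]].
    by have : (A `&` B) x by []; rewrite AB.
  apply: ge0_subset_integral => //.
  + by apply: measurableU; exact: measurableX.
  + by apply: measurableX; exact: measurableU.
  + exact: measurable_funS mf.
  + by move=> [x y] [[? ?]|[? ?]]; split; [left|left|right|right].
- move=> A B mA mB AB; apply: ge0_subset_integral => //.
  + exact: measurableX.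
  + exact: measurableX.
  + exact: measurable_funS mf.
  + by move=> [x y] [/AB ? /AB ?].
- by rewrite integral_ge0.
Qed.

Lemma scale_le (i j : nat) : (i <= j)%N -> scale j <= scale i.
Proof.
move=> ij; rewrite /dyadic_scale ler_pM2l// lef_pV2 ?posrE ?exprn_gt0//.
by rewrite ler_weXn2l// ler1n.
Qed.

Lemma scale_powRN_unbounded (A : R) : exists k, A <= scale k `^ (- th).
Proof.
have y1 : 1 < 2 `^ th :> R.
  have := congr1 (@^~ th) (powR1 R) => /= h1; rewrite -[ltLHS]h1.
  by apply: gt0_ltr_powR => //; rewrite ?nnegrE ?ltr1n.
have s0 : 0 < scale 0 `^ (- th) by rewrite powR_gt0// scale_gt0.
have A0 : 0 <= `|A| / scale 0 `^ (- th) by rewrite divr_ge0// ltW.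
have [n hn] : exists n, `|A| / scale 0 `^ (- th) <= (2 `^ th) ^+ n.
  pose z := (2 `^ th)^-1 : R.
  have zn : `|z| < 1 by rewrite ger0_norm ?invr_ge0 ?powR_ge0// invf_lt1// (lt_trans ltr01).
  have a1 : 0 < `|A| / scale 0 `^ (- th) + 1 by lra.
  have e0 : 0 < (`|A| / scale 0 `^ (- th) + 1)^-1 by rewrite invr_gt0.
  have yN n : 0 < (2 `^ th) ^+ n :> R by rewrite exprn_gt0// powR_gt0.
  have [N _ HN] := cvgr0_norm_lt (fun n => z ^+ n) (cvg_expr zn) _ e0.
  exists N; have /= := HN N (leqnn N).
  rewrite ger0_norm ?exprn_ge0 ?invr_ge0 ?powR_ge0// exprVn ltf_pV2 ?posrE ?yN//; lra.
exists n; rewrite -(add0n n) (scale_powRN _ r00) mulrC.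
by apply: (le_trans (ler_norm _)); rewrite -ler_pdivrMr.
Qed.

Section boxing_inequality.
Variables (p : nat) (q Kc : R) (x0 : X) (E : set T).
Hypotheses (Kc0 : 0 < Kc) (hKc : 320 * CP * D ^+ 7 <= Kc).
Hypotheses (hp : 2 * (tauP + 2) <= 2 ^+ p) (Q1 : 1 < Q).
Hypotheses (q1 : 1 <= q) (qQ : q <= Q / (Q - th)) (mE' : measurable E).
(** With radius [r0 / 2], the ball of the top scale [r0] about any point of [B] contains [B]. The
    radius of [O] is [r0 / 2 + (tauP + 2) * r0], enough for the balls that [energy_ge_scale] places
    about points of [B]. *)
Let B : set T := ball x0 (r0 / 2).
Let N := m (ball x0 r0).
Let O : set T := ball x0 ((2 * tauP + 5) * (r0 / 2)).
Hypothesis half : 2 * m (E `&` B) <= m B.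
Hypothesis fin : (energy \1_E O < +oo)%E.

Let e := fine (energy \1_E O).
Let c := (2 * D ^+ 2)^-1.
Let tauP1 : 1 <= tauP. Proof. by case: poi. Qed.
Let CP1 : 1 <= CP. Proof. by case: poi. Qed.
Let r20 : 0 < r0 / 2. Proof. by rewrite divr_gt0. Qed.
Let N0 : 0 < N. Proof. exact: (m_ball_gt0 dbl). Qed.
Let mball (x : X) s : measurable (ball x s : set T).
Proof. exact: (measurable_ball_cara breg). Qed.
Let DD0 : 0 < D ^+ 2. Proof. by rewrite exprn_gt0. Qed.
Let c0 : 0 < c. Proof. by rewrite invr_gt0 mulr_gt0. Qed.

Let f (xy : T * T) := (`|\1_E xy.1 - \1_E xy.2|%:E * dyadic_kernel th r0 xy)%E.

Let mf : measurable_fun setT f.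
Proof.
apply: emeasurable_funM.
  by apply/measurable_EFinP; apply: measurable_energy_integrand; exact: measurable_indic.
exact: (measurable_dyadic_kernel breg dbl lmb C01).
Qed.

Let f0 xy : (0 <= f xy)%E.
Proof. by rewrite mule_ge0 ?lee_fin// dyadic_kernel_ge0. Qed.

Let energyE : energy \1_E O = (\int[M]_(x in O) \int[M]_(y in O) f (x, y))%E.
Proof. exact: (ge0_integral_setX (Ms breg dbl) (Ms breg dbl) (mball _ _) (mball _ _) mf f0). Qed.

Let energy_fin : energy \1_E O = e%:E.
Proof.
rewrite fineK// ge0_fin_numE//; apply: integral_ge0 => xy _; exact: f0.
Qed.

Let e0 : 0 <= e.
Proof. by apply: fine_ge0; apply: integral_ge0 => xy _; exact: f0. Qed.

Let dense k (x : X) := m (ball x (scale k)) < 2 * m (E `&` ball x (scale k)).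
Let good k : set T := [set x | (E `&` B) x /\
  (c * m (ball (x : X) (scale k)) <= m (E `&` ball (x : X) (scale k)) /\
   c * m (ball (x : X) (scale k)) <=
     m (ball (x : X) (scale k)) - m (E `&` ball (x : X) (scale k)))].
Let bad : set T := [set x | (E `&` B) x /\
  forall k, 2 * m (E `&` ball (x : X) (scale k)) <= m (ball (x : X) (scale k))].

Let mEB : measurable (E `&` B). Proof. by apply: measurableI => //; exact: mball. Qed.

Let mgood k : measurable (good k).
Proof.
have h1 := measurable_m_ball breg dbl lmb C01 (scale k).
have h2 := measurable_m_setI_ball (scale k) mE'.
have h3 : measurable_fun setT (fun x : T => c * m (ball (x : X) (scale k))).
  exact: measurable_funM.
have h4 := measurable_set_le h3 h2.
have h5 := measurable_set_le h3 (measurable_funB h1 h2).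
exact: measurableI mEB (measurableI _ _ h4 h5).
Qed.

Let mbad : measurable bad.
Proof.
have -> : bad = (E `&` B) `&` \bigcap_k [set x : T |
    2 * m (E `&` ball (x : X) (scale k)) <= m (ball (x : X) (scale k))].
  by apply/seteqP; split => x [? H]; split => // k; [move=> _; exact: H|exact: (H k Logic.I)].
apply: measurableI => //; apply: bigcap_measurable => [|k _]; first by exists 0%N.
apply: measurable_set_le; last exact: (measurable_m_ball breg dbl lmb C01).
by apply: measurable_funM => //; exact: measurable_m_setI_ball.
Qed.

Let m_split (x : X) s : m (ball x s) = m (E `&` ball x s) + m (ball x s `\` E).
Proof. by rewrite (setIC E); exact: (m_setID dbl mE' (mball _ _) (@subset_refl _ _)). Qed.

Let Bball (x : X) : B x -> mdist x0 x < r0 / 2.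
Proof. by rewrite /B ballEmdist. Qed.

Let subO (x : X) k : B x -> ball x ((tauP + 2) * scale k) `<=` O.
Proof.
move=> /Bball Bx; apply: sub_ball.
have := scale_le (leq0n k); rewrite {2}/dyadic_scale expr0 divr1 => sk.
have : (tauP + 2) * scale k <= (tauP + 2) * r0 by rewrite ler_pM2l//; have := tauP1; lra.
by lra.
Qed.

(** At the coarsest scale where [E] fills more than half of the ball, one steps back by one scale:
    there the density is at most one half, and by doubling still at least [1 / (2 * D)]. *)
Let cover : E `&` B `<=` bad `|` \bigcup_k good k.
Proof.
move=> x EBx; have [[k0 dk0]|H] := pselect (exists k, dense k x); last first.
  left; split => // k; rewrite leNgt; apply/negP => dk; apply: H; by exists k.
right.
have /ex_minnP[k /asboolP dk kmin] : exists k, `[< dense k x >] by exists k0; exact/asboolP.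
have xx s : 0 < s -> 0 < m (ball (x : X) s) by exact: (m_ball_gt0 dbl).
have D2 : D <= D ^+ 2 by rewrite expr2 ler_peMl// ltW.
(* At the top scale no coarser one is available. There the complement is large because it fills half
   of [B], and the ball of radius [r0] has mass at most [D ^+ 2 * m B]; hence the value of [c]. *)
case: k dk kmin => [|k] dk kmin.
  exists 0%N => //; split => //; split.
    move: dk; rewrite /dense; set a := m (ball _ _); set b := m _ => dk.
    have a0 : 0 < a by apply: xx; exact: scale_gt0.
    apply: le_trans (_ : 2^-1 * a <= _); last by lra.
    by rewrite ler_pM2r// /c lef_pV2 ?posrE ?mulr_gt0// ler_peMr// (le_trans D1).
  have -> : m (ball (x : X) (scale 0)) - m (E `&` ball (x : X) (scale 0)) =
      m (ball (x : X) (scale 0) `\` E) by rewrite {1}(m_split x); lra.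
  have s0 : scale 0 = r0 by rewrite /dyadic_scale expr0 divr1.
  have Bx := Bball EBx.2.
  have h1 : m B <= 2 * m (B `\` E).
    by have := m_split x0 (r0 / 2); have := half; rewrite /B; lra.
  have h2 : m (B `\` E) <= m (ball (x : X) (scale 0) `\` E).
    apply: (le_m dbl (x := x) (r := scale 0)); last by move=> y [].
    move=> y [By nEy]; split => //; move: By => /Bball By; rewrite ballEmdist/= s0.
    by have := metric_triangle (x : X) x0 y; rewrite (metric_sym (x : X) x0); lra.
  have h3 : m (ball (x : X) (scale 0)) <= D ^+ 2 * m B.
    apply: (m_ball_le dbl) => //; rewrite s0 expr2.
    apply: (@le_trans _ _ (r0 / 2 + r0)); first by rewrite lerD2r ltW.
    by have := r00; lra.
  rewrite /c ler_pdivrMl ?mulr_gt0//; apply: (le_trans h3).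
  by rewrite [2 * D ^+ 2]mulrC -[leRHS]mulrA ler_pM2l//; lra.
exists k => //; split => //.
have nd : 2 * m (E `&` ball (x : X) (scale k)) <= m (ball (x : X) (scale k)).
  rewrite leNgt; apply/negP => dk'.
  by have := kmin k (asboolT dk'); rewrite ltnn.
have sk0 : 0 < m (ball (x : X) (scale k)) by apply: xx; exact: scale_gt0.
split; last first.
  set a := m (ball _ _) in nd sk0 *; set b := m _ in nd *.
  apply: le_trans (_ : 2^-1 * a <= _); last by lra.
  by rewrite ler_pM2r// /c lef_pV2 ?posrE ?mulr_gt0// ler_peMr// (le_trans D1).
have h1 : m (E `&` ball (x : X) (scale k.+1)) <= m (E `&` ball (x : X) (scale k)).
  apply: (le_m dbl (x := x) (r := scale k)); last by move=> y [].
  by move=> y [Ey xy]; split => //; apply: (le_ball _ xy); exact: scale_le.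
have h2 : m (ball (x : X) (scale k)) <= D * m (ball (x : X) (scale k.+1)).
  by rewrite scaleS; apply: (m_ball_double dbl); exact: scale_gt0.
rewrite /c ler_pdivrMl ?mulr_gt0//.
apply: (le_trans h2); rewrite [2 * _]mulrC -mulrA; apply: ler_pM => //.
- exact: ltW.
- exact: m_ge0.
- by move: dk; rewrite /dense; lra.
Qed.

(** At a bad point the complement of [E] fills half of each ball of radius [scale k], so the inner
    energy integral is at least half of [scale k^(-th)] for every [k]. These bounds are unbounded,
    while the total energy is finite. *)
Let bad_null : mu bad = 0%E.
Proof.
have badO : bad `<=` O.
  move=> x [[_ Bx] _]; apply: (subO (k := 0) Bx); rewrite ballEmdist/= mdistxx.
  by rewrite mulr_gt0 ?scale_gt0//; have := tauP1; lra.
have fbad : mu bad = (m bad)%:E by apply: (mu_sub_ballE dbl (x := x0)) => x /badO Ox; exact: Ox.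
have key A : 0 <= A -> A * m bad <= e.
  move=> A0; rewrite -lee_fin EFinM -fbad -energy_fin energyE.
  have mO : measurable O by exact: mball.
  apply: le_measure_integral => //.
  - apply: (@measurable_funS _ _ _ _ setT) => //.
    exact: (@measurable_fun_integral_section _ _ _ _ _ (Ms breg dbl)).
  - by move=> x _; apply: integral_ge0 => y _; exact: f0.
  move=> x [[Ex Bx] xk].
  have [k hk] := scale_powRN_unbounded (2 * A).
  pose V := ball (x : X) (scale k) `\` E.
  have mV : measurable (V : set T) by apply: measurableD => //; exact: mball.
  have xk0 : 0 < m (ball (x : X) (scale k)) by apply: (m_ball_gt0 dbl); exact: scale_gt0.
  have VO : V `<=` O.
    move=> y [xy _]; apply: (subO (k := k) Bx); apply: (le_ball _ xy).
    by rewrite ler_peMl ?ltW ?scale_gt0//; have := tauP1; lra.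
  apply: (@le_trans _ _ ((scale k `^ (- th) / m (ball (x : X) (scale k)))%:E * mu V)%E).
    have -> : mu V = (m V)%:E by apply: (mu_sub_ballE dbl (x := x) (r := scale k)) => y [].
    rewrite -EFinM lee_fin mulrAC ler_pdivlMr//.
    have hV : m (ball (x : X) (scale k)) <= 2 * m V.
      by have := m_split x (scale k); have := xk k; rewrite -/V; lra.
    apply: (@le_trans _ _ (A * (2 * m V))); first by rewrite ler_wpM2l.
    by rewrite mulrA [A * 2]mulrC ler_wpM2r// m_ge0.
  apply: le_measure_integral => //.
  - apply: (@measurable_funS _ _ _ _ setT) => //.
    exact: (measurableT_comp mf (measurable_pair1 x)).
  - move=> y [xy nEy]; rewrite /f/= !indicE mem_set// memNset// subr0 normr1 mul1e.
    apply: le_trans (dyadic_kernel_ge th r0 k (x, y)).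
    rewrite lee_fin /scale_density indicE mem_set ?mul1r//.
    by move: xy; rewrite ballEmdist.
  - by rewrite divr_ge0 ?powR_ge0// ltW.
rewrite fbad; congr EFin; apply/eqP; rewrite eq_le m_ge0 andbT leNgt; apply/negP => b0.
have := key ((e + 1) / m bad); rewrite divfK ?gt_eqF//.
have : 0 <= (e + 1) / m bad by rewrite divr_ge0 ?m_ge0//; have := e0; lra.
by move=> -> /(_ isT); lra.
Qed.

Let Y := C0 * (Kc * (2 * D ^+ 2)) * (1 - th) * r0 `^ th / N * e.

Let Y0 : 0 <= Y.
Proof.
have C00 : 0 <= C0 by exact: le_trans C01.
have th1' : 0 <= 1 - th by rewrite subr_ge0 ltW.
have DD : 0 <= 2 * D ^+ 2 by rewrite mulr_ge0// ltW.
rewrite /Y; apply: mulr_ge0 => //; apply: divr_ge0; last exact: m_ge0.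
apply: mulr_ge0; last exact: powR_ge0.
apply: mulr_ge0 => //; apply: mulr_ge0 => //; apply: mulr_ge0 => //.
exact: ltW Kc0.
Qed.

(** The selected balls enlarged to [2 * t] cover, at the cost [D ^+ p] relative to the balls of
    radius [scale k]. The relative masses of the latter sum to at most [Y^q], by [sum_powR_le] and
    the energies of the disjoint balls of radius [t]. The bound is independent of [K]. *)
Let good_measure K : (mu (\big[setU/set0]_(k < K) good k) <= (D ^+ p * N * Y `^ q)%:E)%E.
Proof.
(* The radius on which [energy_ge_scale] measures the energy: these balls, not those of radius
   [scale k], have to be disjoint. *)
pose t k := (tauP + 2) * scale k.
have tau0 : 0 < tauP + 2 by have := tauP1; lra.
have t0 k : 0 < t k by rewrite mulr_gt0 ?scale_gt0.
have tle : {homo t : i j / (i <= j)%N >-> j <= i}.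
  by move=> i j ij; rewrite ler_pM2l// scale_le.
have Gz k : good k `<=` ball x0 r0.
  move=> x [[_ /Bball Bx] _]; rewrite ballEmdist/=; have := r00; lra.
have [l [pl lG lcov]] := vitali_scales t0 tle Gz K.
pose a (i : X * nat) := m (ball i.1 (scale i.2)) / N.
pose s (i : X * nat) := scale i.2 / r0.
have sp : {in l, forall i, [/\ 0 < a i, 0 < s i, s i <= 1 & C0^-1 * s i `^ Q <= a i]}.
  move=> i /lG[Gi _]; split.
  - by rewrite divr_gt0//; apply: (m_ball_gt0 dbl); exact: scale_gt0.
  - by rewrite divr_gt0// scale_gt0.
  - rewrite ler_pdivrMr// mul1r; have := scale_le (leq0n i.2).
    by rewrite {2}/dyadic_scale expr0 divr1.
  - apply: lmb; [exact: scale_gt0| |exact: Gz Gi].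
    by have := scale_le (leq0n i.2); rewrite {2}/dyadic_scale expr0 divr1.
have h1 := sum_powR_le C01 Q1 th0 th1 q1 qQ sp.
have h2 : \sum_(i <- l) a i * s i `^ (- th) <= (Kc * (2 * D ^+ 2)) * (1 - th) * r0 `^ th / N * e.
  have hs : (\sum_(i <- l) (c * m (ball i.1 (scale i.2)) * scale i.2 `^ (- th))%:E <=
      (Kc * (1 - th))%:E * e%:E)%E.
    apply: (@le_trans _ _ (\sum_(i <- l) (Kc * (1 - th))%:E * energy \1_E (ball i.1 (t i.2)))%E).
      rewrite big_seq [leRHS]big_seq; apply: lee_sum => i /lG[[_ [g1 g2]] _].
      have g2' : c * m (ball i.1 (scale i.2)) <= m (ball i.1 (scale i.2) `\` E).
        by apply: (le_trans g2); have := m_split i.1 (scale i.2); lra.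
      apply: (le_trans (energy_ge_scale breg dbl lmb C01 poi th0 th1 r00 mE' c0 g1 g2')).
      apply: lee_wpmul2r; first by apply: integral_ge0 => xy _; exact: f0.
      by rewrite lee_fin ler_pM2r// subr_gt0.
    rewrite -ge0_sume_distrr; last by move=> i _; apply: integral_ge0 => xy _; exact: f0.
    apply: lee_wpmul2l.
      by rewrite lee_fin; apply: mulr_ge0; [exact: ltW Kc0|rewrite subr_ge0 ltW].
    rewrite -energy_fin.
    apply: (@energy_superadditive \1_E _ (fun i => ball i.1 (t i.2))) => //.
    - by move=> i; exact: mball.
    - by move=> i /lG[[[_ Bi] _] _]; exact: subO.
  move: hs; rewrite -EFinM sumEFin lee_fin => hs.
  have -> : \sum_(i <- l) a i * s i `^ (- th) =
      (\sum_(i <- l) (c * m (ball i.1 (scale i.2)) * scale i.2 `^ (- th))) * ((2 * D ^+ 2) * r0 `^ th / N).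
    rewrite mulr_suml; apply: eq_bigr => i _; rewrite /a /s.
    rewrite powRM ?invr_ge0 ?(ltW r00) ?(ltW (scale_gt0 _ _))//.
    have -> : r0^-1 `^ (- th) = r0 `^ th.
      by rewrite -powR_inv1 ?(ltW r00)// -powRrM mulN1r opprK.
    rewrite /c; move: (scale i.2 `^ (- th)) (r0 `^ th) (m (ball _ _)) => u v w.
    by field; rewrite !gt_eqF.
  have -> : Kc * (2 * D ^+ 2) * (1 - th) * r0 `^ th / N * e =
    (Kc * (1 - th) * e) * (2 * D ^+ 2 * r0 `^ th / N) by ring.
  apply: ler_wpM2r => //; apply: divr_ge0; last exact: m_ge0.
  by apply: mulr_ge0; [apply: mulr_ge0 => //; exact: ltW|exact: powR_ge0].
have S0 : 0 <= \sum_(i <- l) a i.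
  by rewrite big_seq; apply: sumr_ge0 => i /sp[/ltW].
have h3 : \sum_(i <- l) a i <= Y `^ q.
  have q0 : 0 < q by exact: lt_le_trans q1.
  have -> : \sum_(i <- l) a i = ((\sum_(i <- l) a i) `^ q^-1) `^ q.
    by rewrite -powRrM mulVf ?gt_eqF// powRr1.
  apply: ge0_ler_powR; rewrite ?nnegrE ?powR_ge0 ?(ltW q0)//.
  apply: (le_trans h1); have := C01 => C01'.
  have -> : Y = C0 * ((Kc * (2 * D ^+ 2)) * (1 - th) * r0 `^ th / N * e).
    by rewrite /Y; ring.
  by rewrite ler_pM2l// (lt_le_trans _ C01).
apply: (@le_trans _ _ (\sum_(i <- l) mu (ball i.1 (2 * t i.2)))%E).
  apply: le_trans (outer_measure_seq _ _ _); apply: le_outer_measure.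
  rewrite -bigcup_mkord => y [k /= kK Gy].
  by have [i il iy] := lcov k y kK Gy; exists i => //; rewrite ballEmdist.
apply: (@le_trans _ _ (\sum_(i <- l) (D ^+ p * N * a i)%:E)%E); last first.
  rewrite sumEFin lee_fin -mulr_sumr ler_wpM2l//.
  by rewrite mulr_ge0 ?m_ge0// exprn_ge0// ltW.
apply: lee_sum => i _.
have -> : mu (ball i.1 (2 * t i.2)) = (m (ball i.1 (2 * t i.2)))%:E by apply: (mu_ballE dbl).
rewrite lee_fin /a -mulrA [N * _]mulrC divfK ?gt_eqF//.
apply: (m_ball_le dbl); first exact: scale_gt0.
by rewrite mdistxx add0r /t mulrA ler_pM2r ?scale_gt0.
Qed.

(** The number of scales tends to infinity by continuity from below. The factor [D ^+ p] survives
    the root unchanged because it is at least 1 and [1 / q <= 1]. *)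
Lemma boxing_inequality : (m (E `&` B) / N) `^ q^-1 <= D ^+ p * Y.
Proof.
have fEB : mu (E `&` B) = (m (E `&` B))%:E.
  by apply: (mu_sub_ballE dbl (x := x0) (r := r0 / 2)) => y [].
have h : (mu (E `&` B) <= (D ^+ p * N * Y `^ q)%:E)%E.
  apply: (@le_trans _ _ (mu (bad `|` \bigcup_k good k))); first by apply: le_outer_measure; exact: cover.
  apply: (le_trans (outer_measureU2 _ _ _)); rewrite bad_null add0e.
  have -> : \bigcup_k good k = \bigcup_K \big[setU/set0]_(k < K) good k.
    apply/seteqP; split => [x [k _ Gx]|x [K _]]; last first.
      by rewrite -bigcup_mkord => -[k /= _ Gx]; exists k.
    by exists k.+1 => //; rewrite -bigcup_mkord; exists k => /=.
  have mU K : measurable (\big[setU/set0]_(k < K) good k : set T).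
    exact: bigsetU_measurable.
  have := @nondecreasing_cvg_mu _ T R M (fun K => \big[setU/set0]_(k < K) good k) mU.
  move=> /(_ (bigcup_measurable (fun k _ => mU k))) H.
  have {H} : (M \o (fun K => \big[setU/set0]_(k < K) good k)) @ \oo -->
      M (\bigcup_K \big[setU/set0]_(k < K) good k).
    by apply: H => i j ij; apply/subsetPset; exact: subset_bigsetU.
  move=> cvU; apply: (cvge_to_le cvU).
  by apply: nearW => K; exact: good_measure.
rewrite fEB lee_fin in h.
have q0 : 0 < q by exact: lt_le_trans q1.
have Dp : 1 <= D ^+ p by rewrite exprn_ege1.
have Dp0 : 0 <= D ^+ p by exact: le_trans Dp.
have : m (E `&` B) / N <= D ^+ p * Y `^ q.
  by rewrite ler_pdivrMr// mulrAC.
move=> h'; apply: (@le_trans _ _ ((D ^+ p * Y `^ q) `^ q^-1)).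
  apply: ge0_ler_powR; rewrite ?nnegrE ?invr_ge0 ?(ltW q0)//.
    by rewrite divr_ge0 ?m_ge0.
  by rewrite mulr_ge0 ?powR_ge0.
rewrite powRM ?powR_ge0// -powRrM mulfV ?gt_eqF// powRr1//.
rewrite ler_wpM2r// -[leRHS](powRr1 Dp0); apply: ler_powR => //.
by rewrite invf_le1.
Qed.

End boxing_inequality.
End boxing.

(** * Coarea inequality *)

Lemma superlevel_measurable d (T : measurableType d) (R : realType) (w : T -> R) :
  measurable_fun setT w -> measurable [set z : R * T | z.1 < w z.2].
Proof.
move=> mw; have h : measurable_fun setT (fun z : R * T => w z.2 - z.1).
  apply: measurable_funB; last exact: measurable_fst.
  exact: (measurableT_comp mw measurable_snd).
have := h measurableT `]0, +oo[%classic (measurable_itv _).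
by congr measurable; apply/seteqP; split => x /=; rewrite in_itv/= andbT subr_gt0; [case|].
Qed.

Lemma powR_pred (R : realType) (q x : R) : 1 <= q -> 0 <= x ->
  x `^ q = x `^ (q - 1) * x.
Proof.
move=> q1; rewrite le_eqVlt => /predU1P[<-|x0].
  by rewrite mulr0 powR0// gt_eqF// (lt_le_trans _ q1).
rewrite -{3}(powRr1 (ltW x0)) -powRD ?subrK//.
by rewrite (gt_eqF x0) implybT.
Qed.

(** The integrand is at least [(a / 2)^(q - 1)] on [[a / 2, a)]. The loss of [2^q] compared with the
    exact value [a^q / q] becomes a factor 2 after taking the root, so the final constant does not
    depend on [q]. *)
Lemma layer_cake_le (R : realType) (a q : R) : 1 <= q -> 0 < a ->
  (((a / 2) `^ q)%:E <=
   \int[lebesgue_measure]_(t in `[0%R, +oo[) (\1_[set t | (t < a)%R] t * t `^ (q - 1))%:E)%E.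
Proof.
move=> q1 a0; have a20 : 0 < a / 2 by rewrite divr_gt0.
have q10 : 0 <= q - 1 by rewrite subr_ge0.
have mf : measurable_fun setT (fun t : R => \1_[set t | (t < a)%R] t * t `^ (q - 1)).
  apply: measurable_funM; last exact: measurable_powR.
  apply: measurable_indic; rewrite (_ : [set t | _] = `]-oo, a[%classic)//.
have lm : lebesgue_measure `[a / 2, a[%classic = (a / 2)%:E.
  rewrite lebesgue_measure_itv/= lte_fin ifT; last lra.
  by rewrite -EFinB; congr EFin; lra.
have -> : (((a / 2) `^ q)%:E = ((a / 2) `^ (q - 1))%:E * lebesgue_measure `[(a / 2)%R, a[%classic)%E.
  rewrite lm -EFinM; congr EFin; rewrite [in LHS](_ : q = (q - 1) + 1); last by rewrite subrK.
  rewrite powRD; last by rewrite (gt_eqF a20) implybT.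
  by rewrite powRr1 ?ltW.
apply: ge0_le_measure_integral_cst => //.
- by move=> t /=; rewrite !in_itv/= andbT => /andP[h _]; rewrite (le_trans _ h)// ltW.
- by apply/measurable_EFinP; exact: measurable_funS mf.
- by move=> t _; rewrite lee_fin mulr_ge0 ?powR_ge0.
- move=> t /=; rewrite in_itv/= => /andP[h1 h2].
  rewrite lee_fin indicE mem_set// mul1r.
  by apply: ge0_ler_powR => //; rewrite nnegrE ?(le_trans _ h1)// ltW.
- exact: powR_ge0.
Qed.

Section coarea.
Context {R : realType} {X : completeMetricType R}.
Variables (mu : {outer_measure set X -> \bar R}) (D C0 Q CP tauP : R).
Hypotheses (breg : borel_regular mu) (dbl : doubling mu D).
Hypotheses (lmb : relative_lower_mass_bound mu C0 Q) (C01 : 1 <= C0).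
Hypothesis poi : poincare11 mu CP tauP.
Variables (th r0 : R).
Hypotheses (th0 : 0 < th) (th1 : th < 1) (r00 : 0 < r0).

Local Notation T := (caratheodory_type mu).
Local Notation m A := (fine (mu A)).
Local Notation M := (cara_measure mu).
Local Notation MM := (Ms breg dbl).
Local Notation energy := (dyadic_energy breg dbl th r0).
Local Notation K := (dyadic_kernel th r0).

Let D1 := D_ge1 dbl.
Let D0 : 0 < D. Proof. exact: lt_le_trans D1. Qed.

Variables (w : T -> R) (O : set T).
Hypotheses (mw : measurable_fun setT w) (mO : measurable O).

Definition superlevel (t : R) : set T := [set x | t < w x].

Let mE t : measurable (superlevel t).
Proof.
have := @mw measurableT `]t, +oo[%classic (measurable_itv _).
by congr measurable; apply/seteqP; split => x /=; rewrite in_itv/= andbT; [case|].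
Qed.

Let F (z : R * (T * T)) : \bar R :=
  (`|\1_(superlevel z.1) z.2.1 - \1_(superlevel z.1) z.2.2|%:E * K z.2)%E.

Let mF : measurable_fun setT F.
Proof.
apply: emeasurable_funM; last first.
  exact: (measurableT_comp (measurable_dyadic_kernel breg dbl lmb C01 th r0) measurable_snd).
apply/measurable_EFinP; apply: measurableT_comp => //.
have h (g : T * T -> T) : measurable_fun setT g ->
    measurable_fun setT (fun z : R * (T * T) => \1_(superlevel z.1) (g z.2) : R).
  move=> mg; have := superlevel_measurable (measurableT_comp mw mg).
  move=> /(@measurable_indic _ _ R setT); apply: eq_measurable_fun.
  by move=> z _; rewrite !indicE.
by apply: measurable_funB; [exact: (h fst measurable_fst)|exact: (h snd measurable_snd)].
Qed.

Let F0 z : (0 <= F z)%E.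
Proof. by rewrite mule_ge0 ?lee_fin// dyadic_kernel_ge0. Qed.

Let M2m : {measure set (T * T)%type -> \bar R} := (MM \x MM)%E.

Let sigma_finite_M2m : sigma_finite setT M2m.
Proof.
exists (fun n => (ball (point : X) n%:R : set T) `*` (ball (point : X) n%:R : set T)).
  apply/seteqP; split => // -[x y] _.
  have [Nx Hx] := ball_point_cover (x : X); have [Ny Hy] := ball_point_cover (y : X).
  by exists (maxn Nx Ny) => //; split; [apply: Hx; exact: leq_maxl|apply: Hy; exact: leq_maxr].
have mb n : measurable (ball (point : X) n%:R : set T) by exact: (measurable_ball_cara breg).
move=> n; split; first exact: measurableX.
rewrite [ltLHS](product_measure1E _ _ (mb n) (mb n)).
have h : mu (ball (point : X) n%:R) = (m (ball (point : X) n%:R))%:E by apply: (mu_ballE dbl).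
by rewrite /= h -EFinM ltry.
Qed.

Let M2 : {sigma_finite_measure set (T * T)%type -> \bar R} :=
  HB.pack (Measure.sort M2m) (Measure_isSigmaFinite.Build _ _ _ M2m sigma_finite_M2m).

Let mOO : measurable (O `*` O). Proof. exact: measurableX. Qed.

Lemma measurable_energy_superlevel :
  measurable_fun setT (fun t => energy \1_(superlevel t) O).
Proof. exact: (@measurable_fun_integral_section _ _ _ _ _ M2 _ _ mOO mF F0). Qed.

(** After exchanging the integrals, the level [t] separates [w x] from [w y] exactly on a half-open
    interval of length [|w x - w y|]. Restriction to [t >= 0] makes it an inequality. *)
Lemma energy_coarea :
  (\int[lebesgue_measure]_(t in `[0%R, +oo[) energy \1_(superlevel t) O <= energy w O)%E.
Proof.
have mI : measurable (`[0%R, +oo[%classic : set R) by exact: measurable_itv.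
rewrite [leLHS](@ge0_integral_setX_swap _ _ _ _ _ lebesgue_measure M2 _ _ F mI mOO mF F0).
apply: ge0_le_integral_ext => xy _; first by apply: integral_ge0.
have hx (x : T) : measurable_fun setT (fun t : R => \1_(superlevel t) x : R).
  apply: (eq_measurable_fun (\1_`]-oo, w x[%classic : R -> R)); last first.
    by apply: measurable_indic; exact: measurable_itv.
  move=> t _; rewrite !indicE (_ : (x \in superlevel t) = (t \in `]-oo, w x[%classic))//.
have mt : measurable_fun setT (fun t : R => `|\1_(superlevel t) xy.1 - \1_(superlevel t) xy.2| : R).
  by apply: measurableT_comp => //; apply: measurable_funB; exact: hx.
rewrite /F/= ge0_integralZr//; last 2 first.
- by apply/measurable_EFinP; exact: measurable_funS mt.
- exact: dyadic_kernel_ge0.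
apply: lee_wpmul2r; first exact: dyadic_kernel_ge0.
set a := w xy.1; set b := w xy.2.
pose J := `[Num.min a b, Num.max a b[%classic.
apply: (@le_trans _ _ (\int[lebesgue_measure]_(t in `[0%R, +oo[) (\1_J t)%:E)%E).
  apply: ge0_le_integral_ext => t _; first by rewrite lee_fin.
  rewrite lee_fin !indicE.
  have -> : (xy.1 \in superlevel t) = (t < a) by apply/idP/idP; rewrite inE.
  have -> : (xy.2 \in superlevel t) = (t < b) by apply/idP/idP; rewrite inE.
  have -> : (t \in J) = (Num.min a b <= t < Num.max a b).
    by apply/idP/idP; rewrite inE /J/= in_itv/=.
  rewrite ge_min lt_max.
  have [ta|ta] := ltP t a; have [tb|tb] := ltP t b => /=;
    rewrite ?subrr ?normr0 ?subr0 ?sub0r ?normrN ?normr1//.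
rewrite integral_indic//; last exact: measurable_itv.
apply: (@le_trans _ _ (lebesgue_measure J)).
  apply: le_measure; rewrite ?inE; [|exact: measurable_itv|exact: subIsetl].
  by apply: measurableI; exact: measurable_itv.
rewrite /J lebesgue_measure_itv/= lte_fin; case: ifPn => _; last by rewrite lee_fin.
by rewrite -EFinB lee_fin; case: (leP a b) => ab; rewrite ?ler_norm// distrC ler_norm.
Qed.

Section one_sided.
Variables (p : nat) (q Kc : R) (x0 : X).
Hypotheses (Kc0 : 0 < Kc) (hKc : 320 * CP * D ^+ 7 <= Kc).
Hypotheses (hp : 2 * (tauP + 2) <= 2 ^+ p) (Q1 : 1 < Q).
Hypotheses (q1 : 1 <= q) (qQ : q <= Q / (Q - th)).
Let B : set T := ball x0 (r0 / 2).
Let N := m (ball x0 r0).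
Hypothesis OE : O = ball x0 ((2 * tauP + 5) * (r0 / 2)).
Hypothesis half : 2 * m (superlevel 0 `&` B) <= m B.
Hypothesis fin : (energy w O < +oo)%E.

Let Z := D ^+ p * (C0 * (Kc * (2 * D ^+ 2)) * (1 - th) * r0 `^ th / N).
Let e := fine (energy w O).
Let a t := (m (superlevel t `&` B) / N) `^ q^-1.

Let q0 : 0 < q. Proof. exact: lt_le_trans q1. Qed.
Let N0 : 0 < N. Proof. exact: (m_ball_gt0 dbl). Qed.
Let mB : measurable B. Proof. exact: (measurable_ball_cara breg). Qed.

Let Z0 : 0 < Z.
Proof.
have C00 : 0 < C0 by exact: lt_le_trans C01.
have th1' : 0 < 1 - th by rewrite subr_gt0.
have DD : 0 < 2 * D ^+ 2 by rewrite mulr_gt0// exprn_gt0.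
apply: mulr_gt0; first by rewrite exprn_gt0.
apply: divr_gt0 => //; apply: mulr_gt0; last by rewrite powR_gt0.
by apply: mulr_gt0 => //; apply: mulr_gt0 => //; apply: mulr_gt0.
Qed.

Let energy_w : energy w O = e%:E.
Proof.
rewrite fineK// ge0_fin_numE//; apply: integral_ge0 => xy _.
by rewrite mule_ge0 ?lee_fin// dyadic_kernel_ge0.
Qed.

Let e0 : 0 <= e.
Proof.
apply: fine_ge0; apply: integral_ge0 => xy _.
by rewrite mule_ge0 ?lee_fin// dyadic_kernel_ge0.
Qed.

Let superlevel_le s t : s <= t -> superlevel t `&` B `<=` superlevel s `&` B.
Proof. by move=> st x [tx Bx]; split => //; exact: le_lt_trans tx. Qed.

Let m_superlevel_le s t : s <= t ->
  m (superlevel t `&` B) <= m (superlevel s `&` B).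
Proof.
move=> /superlevel_le h; apply: (le_m dbl (x := x0) (r := r0 / 2) h).
by move=> x [].
Qed.

Let a0 t : 0 <= a t. Proof. exact: powR_ge0. Qed.

Let a_le s t : s <= t -> a t <= a s.
Proof.
move=> st; apply: ge0_ler_powR; rewrite ?nnegrE ?divr_ge0 ?m_ge0 ?invr_ge0 ?(ltW q0)//.
by rewrite ler_pM2r ?invr_gt0// m_superlevel_le.
Qed.

Let a_energy t : 0 <= t -> ((a t)%:E <= Z%:E * energy \1_(superlevel t) O)%E.
Proof.
move=> t0; have en0 : (0 <= energy \1_(superlevel t) O)%E.
  apply: integral_ge0 => xy _.
  by rewrite mule_ge0 ?lee_fin// dyadic_kernel_ge0.
have [->|nfin] := eqVneq (energy \1_(superlevel t) O) +oo%E.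
  by rewrite gt0_muley ?lte_fin// leey.
have efin : (energy \1_(superlevel t) O < +oo)%E by rewrite ltey.
have ht : 2 * m (superlevel t `&` B) <= m B.
  by apply: le_trans half; rewrite ler_pM2l// m_superlevel_le.
have efin' : (energy \1_(superlevel t) (ball x0 ((2 * tauP + 5) * (r0 / 2))) < +oo)%E.
  by rewrite -OE.
have := boxing_inequality lmb C01 poi th0 th1 r00 Kc0 hKc hp Q1 q1 qQ (mE t) ht efin'.
rewrite -OE => h; have ef : energy \1_(superlevel t) O \is a fin_num by rewrite ge0_fin_numE.
rewrite -(fineK ef) -EFinM lee_fin /Z -[leRHS]mulrA; exact: h.
Qed.

Let measurable_m_superlevel : measurable_fun setT (fun t => m (superlevel t `&` B)).
Proof.
have mS : measurable ([set z : R * T | z.1 < w z.2] `&` (setT `*` B)).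
  by apply: measurableI; [exact: superlevel_measurable|exact: measurableX].
have h := measurable_fun_xsection MM mS.
apply: (eq_measurable_fun (fine \o (MM \o xsection ([set z : R * T | z.1 < w z.2] `&` (setT `*` B))))); last first.
  by apply: measurableT_comp => //; exact: measurable_fine.
move=> t _; rewrite /= xsectionE; congr fine; congr (mu _).
by apply/seteqP; split => y /=; [case=> h1 [_ Ey]|case=> Ey h1].
Qed.

Let ma : measurable_fun setT a.
Proof.
by apply: (measurableT_comp (measurable_powR _)); apply: measurable_funM.
Qed.

Let mI : measurable (`[0%R, +oo[%classic : set R). Proof. exact: measurable_itv. Qed.

Let int_a : (\int[lebesgue_measure]_(t in `[0%R, +oo[) (a t)%:E <= (Z * e)%:E)%E.
Proof.
apply: (@le_trans _ _ (\int[lebesgue_measure]_(t in `[0%R, +oo[) (Z%:E * energy \1_(superlevel t) O))%E).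
  apply: ge0_le_integral_ext => t; first by rewrite lee_fin.
  by rewrite /= in_itv/= andbT; exact: a_energy.
rewrite ge0_integralZl_EFin; last 4 first.
- exact: mI.
- move=> t _; apply: integral_ge0 => xy _.
  by rewrite mule_ge0 ?lee_fin// dyadic_kernel_ge0.
- exact: measurable_funS measurable_energy_superlevel.
- exact: ltW.
rewrite [(Z * e)%:E]EFinM -energy_w; apply: lee_wpmul2l; first by rewrite lee_fin ltW.
exact: energy_coarea.
Qed.

(** Since [a] is nonincreasing, [t * a t] is at most its integral over [[0, t)]. *)
Let ta_le t : 0 <= t -> t * a t <= Z * e.
Proof.
move=> t0; rewrite -lee_fin; apply: le_trans int_a.
have lm : lebesgue_measure `[0, t[%classic = t%:E.
  rewrite lebesgue_measure_itv/= lte_fin; case: ifPn; first by rewrite oppr0 adde0.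
  by rewrite -leNgt => t0'; congr EFin; apply/eqP; rewrite eq_le t0.
have -> : ((t * a t)%:E = (a t)%:E * lebesgue_measure `[0%R, t[%classic)%E.
  by rewrite lm -EFinM mulrC.
apply: ge0_le_measure_integral_cst => //.
- by move=> s /=; rewrite !in_itv/= => /andP[-> _].
- by apply/measurable_EFinP; exact: measurable_funS ma.
- by move=> s _; rewrite lee_fin.
- by move=> s /=; rewrite in_itv/= => /andP[_ /ltW st]; rewrite lee_fin a_le.
Qed.

Let G (z : T * R) : \bar R := (\1_(superlevel z.2) z.1 * z.2 `^ (q - 1))%:E.

Let mG : measurable_fun setT G.
Proof.
apply/measurable_EFinP; apply: measurable_funM; last first.
  exact: (measurableT_comp (measurable_powR _) measurable_snd).
have := superlevel_measurable mw => /(@measurable_indic _ _ R setT) h.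
have := measurableT_comp h (@measurable_swap _ _ T R).
by apply: eq_measurable_fun => z _; rewrite /= !indicE.
Qed.

Let G0 z : (0 <= G z)%E. Proof. by rewrite lee_fin mulr_ge0 ?powR_ge0. Qed.

(** By the layer cake formula the left side is controlled by the integral of [t^(q - 1) * a t^q],
    times [N] and [2^q]. In [(t * a t)^(q - 1) * a t] the first factor is at most [(Z * e)^(q - 1)]
    by [ta_le], and the remaining [a t] integrates to at most [Z * e]. *)
Lemma one_sided_sobolev :
  (\int[M]_(x in B) (Num.max (w x) 0 `^ q)%:E <= (N * (2 * (Z * e)) `^ q)%:E)%E.
Proof.
have Ze0 : 0 <= Z * e by rewrite mulr_ge0// ltW.
have q10 : 0 <= q - 1 by rewrite subr_ge0.
apply: (@le_trans _ _ (\int[M]_(x in B) ((2 `^ q)%:E * \int[lebesgue_measure]_(t in `[0%R, +oo[) G (x, t)))%E).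
  apply: ge0_le_integral_ext => x _; first by rewrite lee_fin powR_ge0.
  have [w0|w0] := leP (w x) 0.
    rewrite powR0 ?gt_eqF// mule_ge0 ?lee_fin ?powR_ge0//.
    by apply: integral_ge0 => t _; exact: G0.
  have := layer_cake_le q1 w0.
  move=> /(lee_wpmul2l (x := (2 `^ q)%:E)) h.
  apply: le_trans (h _); last by rewrite lee_fin powR_ge0.
  by rewrite -EFinM lee_fin -powRM// ?divr_ge0 ?(ltW w0)// mulrC divfK ?pnatr_eq0.
have mh : measurable_fun setT (fun x : T => \int[lebesgue_measure]_(t in `[0%R, +oo[) G (x, t))%E.
  exact: (@measurable_fun_integral_section _ _ _ _ _ lebesgue_measure _ _ mI mG G0).
rewrite ge0_integralZl_EFin; last 4 first.
- exact: mB.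
- by move=> x _; apply: integral_ge0 => t _; exact: G0.
- exact: measurable_funS mh.
- exact: powR_ge0.
rewrite [X in (_ * X)%E](@ge0_integral_setX_swap _ _ _ _ _ MM lebesgue_measure _ _ G mB mI mG G0).
apply: (@le_trans _ _ ((2 `^ q)%:E * \int[lebesgue_measure]_(t in `[0%R, +oo[) ((N * (Z * e) `^ (q - 1))%:E * (a t)%:E))%E).
  apply: lee_wpmul2l; first by rewrite lee_fin powR_ge0.
  apply: ge0_le_integral_ext => t; first by move=> _; apply: integral_ge0 => x _; exact: G0.
  rewrite /= in_itv/= andbT => t0.
  have -> : (\int[MM]_(x in B) G (x, t) = (m (superlevel t `&` B) * t `^ (q - 1))%:E)%E.
    rewrite /G/=; under eq_integral do rewrite EFinM.
    rewrite ge0_integralZr; last 4 first.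
    - exact: mB.
    - by apply/measurable_EFinP; exact: measurable_indic.
    - by move=> x _; rewrite lee_fin.
    - by rewrite lee_fin powR_ge0.
    rewrite (@integral_indic _ _ _ MM)// EFinM; congr (_ * _)%E.
    by apply: (mu_sub_ballE dbl (x := x0) (r := r0 / 2)) => y [].
  rewrite -EFinM lee_fin.
  have mN : 0 <= m (superlevel t `&` B) / N by rewrite divr_ge0 ?m_ge0.
  have -> : m (superlevel t `&` B) = N * (a t `^ (q - 1) * a t).
    rewrite -powR_pred// /a -powRrM mulVf ?gt_eqF// powRr1//.
    by rewrite mulrC divfK ?gt_eqF.
  have -> : N * (a t `^ (q - 1) * a t) * t `^ (q - 1) = N * (t * a t) `^ (q - 1) * a t.
    by rewrite powRM//; ring.
  rewrite ler_wpM2r// ler_pM2l//; apply: ge0_ler_powR => //.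
  - by rewrite nnegrE mulr_ge0.
  - exact: ta_le.
have NZ0 : 0 <= N * (Z * e) `^ (q - 1) by rewrite mulr_ge0 ?powR_ge0// ltW.
rewrite ge0_integralZl_EFin; last 4 first.
- exact: mI.
- by move=> t _; rewrite lee_fin.
- by apply/measurable_EFinP; exact: measurable_funS ma.
- exact: NZ0.
apply: (@le_trans _ _ ((2 `^ q)%:E * ((N * (Z * e) `^ (q - 1))%:E * (Z * e)%:E))%E).
  apply: lee_wpmul2l; first by rewrite lee_fin powR_ge0.
  by apply: lee_wpmul2l => //; rewrite lee_fin.
rewrite -!EFinM lee_fin [in leRHS]powRM// -mulrA -(powR_pred q1 Ze0).
by rewrite mulrCA.
Qed.

End one_sided.
End coarea.

(** * From medians to means *)

Lemma powR_normD_le (R : realType) (q a b : R) : 0 <= q ->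
  `|a + b| `^ q <= 2 `^ q * (`|a| `^ q + `|b| `^ q).
Proof.
move=> q0; apply: (@le_trans _ _ ((2 * Num.max `|a| `|b|) `^ q)).
  apply: ge0_ler_powR; rewrite ?nnegrE ?mulr_ge0 ?le_max ?normr_ge0//.
  apply: (le_trans (ler_normD _ _)); rewrite mulr_natl mulr2n lerD// le_max lexx ?orbT//.
rewrite powRM ?le_max ?normr_ge0// ler_pM2l ?powR_gt0//.
by case: (leP `|a| `|b|) => _; rewrite ?lerDl ?lerDr powR_ge0.
Qed.

Section median.
Context {R : realType} {X : completeMetricType R}.
Variables (mu : {outer_measure set X -> \bar R}) (D : R).
Hypotheses (breg : borel_regular mu) (dbl : doubling mu D).

Local Notation T := (caratheodory_type mu).
Local Notation m A := (fine (mu A)).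

Lemma m_bigcup_le (F : nat -> set T) (x : X) (r b : R) :
  (forall n, measurable (F n)) -> nondecreasing_seq F ->
  (forall n, F n `<=` ball x r) -> (forall n, m (F n) <= b) ->
  m (\bigcup_n F n) <= b.
Proof.
move=> mF ndF Fx Fb.
have Ux : \bigcup_n F n `<=` ball x r by apply: bigcup_sub => n _; exact: Fx.
rewrite -lee_fin -(mu_sub_ballE dbl Ux).
have := @nondecreasing_cvg_mu _ T R (cara_measure mu) F mF (bigcup_measurable (fun n _ => mF n)) ndF.
move=> cvF; apply: (cvge_to_le cvF); apply: nearW => n /=.
have -> : mu (F n) = (m (F n))%:E by apply: (mu_sub_ballE dbl); exact: Fx.
by rewrite lee_fin.
Qed.

Lemma median_exists (g : T -> R) (x : X) (r : R) : 0 < r ->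
  measurable_fun setT g -> exists m0,
  2 * m ([set y | m0 < g y] `&` ball x r) <= m (ball x r) /\
  2 * m ([set y | g y < m0] `&` ball x r) <= m (ball x r).
Proof.
move=> r0 mg; set B := ball x r.
have B0 : 0 < m B by apply: (m_ball_gt0 dbl).
have mB : measurable (B : set T) by exact: (measurable_ball_cara breg).
have mgt t : measurable [set y : T | t < g y].
  have := mg measurableT `]t, +oo[%classic (measurable_itv _).
  by congr measurable; apply/seteqP; split => y /=; rewrite in_itv/= andbT; [case|].
have mlt t : measurable [set y : T | g y < t].
  have := mg measurableT `]-oo, t[%classic (measurable_itv _).
  by congr measurable; apply/seteqP; split => y /=; rewrite in_itv/=; [case|].
pose gt t : set T := [set y | t < g y] `&` B.
pose lt t : set T := [set y | g y < t] `&` B.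
have mgtB t : measurable (gt t) by exact: measurableI.
have mltB t : measurable (lt t) by exact: measurableI.
have gtB t : gt t `<=` B by move=> y [].
have ltB t : lt t `<=` B by move=> y [].
have lt_gt s t : s <= t -> m (lt s) + m (gt t) <= m B.
  move=> st; have h1 : mu (lt s) = (m (lt s))%:E by apply: (mu_sub_ballE dbl (ltB s)).
  have h2 : mu (gt t) = (m (gt t))%:E by apply: (mu_sub_ballE dbl (gtB t)).
  have h3 : mu B = (m B)%:E by apply: (mu_sub_ballE dbl (@subset_refl _ _)).
  rewrite -lee_fin EFinD -h1 -h2 -h3.
  have disj : lt s `&` gt t = set0.
    by rewrite -subset0 => y [[/= gs _] [/= tg _]]; have := lt_trans tg gs; rewrite ltNge st.
  have := @measureU _ _ _ (cara_measure mu) _ _ (mltB s) (mgtB t) disj.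
  move=> /= <-; apply: le_outer_measure => y [[]//|[]//].
(* Its supremum is a median. [S] is nonempty and bounded above because [gt (- n)] and [lt n] exhaust
   [B]; levels beyond the supremum are not in [S], and a level in [S] has a small strict sublevel
   set by [lt_gt]. *)
pose S := [set t | m B < 2 * m (gt t)].
have [tS StS] : S !=set0.
  apply: contrapT => /forallNP nS.
  have : m (\bigcup_n gt (- n%:R)) <= m B / 2.
    apply: (@m_bigcup_le _ x r) => // [|n].
      move=> i j ij; apply/subsetPset => y [/= h By]; split => //=.
      by apply: le_lt_trans h; rewrite lerN2 ler_nat.
    by have /negP := nS (- n%:R); rewrite /S/= -leNgt; lra.
  have -> : \bigcup_n gt (- n%:R) = B.
    apply/seteqP; split => [y [n _ []//]|y By].
    exists (Num.bound `|g y|) => //; split => //=.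
    rewrite ltrNl; apply: (le_lt_trans (ler_norm _)); rewrite normrN.
    exact: archi_boundP.
  by lra.
have supS : has_sup S.
  split; first by exists tS.
  apply: contrapT => /forallNP nS.
  have : m (\bigcup_n lt n%:R) <= m B / 2.
    apply: (@m_bigcup_le _ x r) => // [|n].
      move=> i j ij; apply/subsetPset => y [/= h By]; split => //=.
      by apply: (lt_le_trans h); rewrite ler_nat.
    have /existsNP[t /not_implyP[St /negP]] := nS n%:R.
    rewrite -ltNge => nt; have := lt_gt _ _ (ltW nt); move: St; rewrite /S/=; lra.
  have -> : \bigcup_n lt n%:R = B.
    apply/seteqP; split => [y [n _ []//]|y By].
    exists (Num.bound `|g y|) => //; split => //=.
    by apply: (le_lt_trans (ler_norm _)); exact: archi_boundP.
  by lra.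
exists (sup S); split.
- suff : m (\bigcup_n gt (sup S + n.+1%:R^-1)) <= m B / 2.
    have -> : \bigcup_n gt (sup S + n.+1%:R^-1) = [set y | sup S < g y] `&` B.
      apply/seteqP; split => [y [n _ [/= h By]]|y [/= h By]].
        by split => //=; apply: lt_trans h; rewrite ltrDl invr_gt0.
      have d0 : 0 < g y - sup S by rewrite subr_gt0.
      have [n _ hn] := near_infty_natSinv_lt (PosNum d0).
      exists n => //; split => //=.
      by have := hn n (leqnn n); rewrite /= ltrBrDl.
    by lra.
  apply: (@m_bigcup_le _ x r) => // [|n].
    move=> i j ij; apply/subsetPset => y [/= h By]; split => //=.
    by apply: le_lt_trans h; rewrite lerD2l lef_pV2 ?posrE// ler_nat.
  rewrite leNgt; apply/negP => h.
  have : S (sup S + n.+1%:R^-1) by rewrite /S/=; lra.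
  move=> /(ub_le_sup supS.2); rewrite gerDl leNgt.
  by rewrite invr_gt0 ltr0Sn.
- suff : m (\bigcup_n lt (sup S - n.+1%:R^-1)) <= m B / 2.
    have -> : \bigcup_n lt (sup S - n.+1%:R^-1) = [set y | g y < sup S] `&` B.
      apply/seteqP; split => [y [n _ [/= h By]]|y [/= h By]].
        by split => //=; apply: (lt_trans h); rewrite gtrBl invr_gt0.
      have d0 : 0 < sup S - g y by rewrite subr_gt0.
      have [n _ hn] := near_infty_natSinv_lt (PosNum d0).
      exists n => //; split => //=.
      by have := hn n (leqnn n); rewrite /= ltrBrDl ltrBrDr addrC.
    by lra.
  apply: (@m_bigcup_le _ x r) => // [|n].
    move=> i j ij; apply/subsetPset => y [/= h By]; split => //=.
    by apply: (lt_le_trans h); rewrite lerD2l lerN2 lef_pV2 ?posrE// ler_nat.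
  have n0 : 0 < n.+1%:R^-1 :> R by rewrite invr_gt0.
  have [t St ht] := sup_adherent n0 supS.
  by have := lt_gt _ _ (ltW ht); move: St; rewrite /S/=; lra.
Qed.

End median.

(** The first-power bound gives [|m0 - t| <= A] for the mean [t]. Then [|g - t|^q] is at most [2^q]
    times the sum of two quantities, each integrating to at most [b * A^q]; the factor 2 of the sum
    is absorbed in a second [2^q], hence [4 * A]. *)
Lemma mean_oscillation_le d (T : measurableType d) (R : realType)
    (M : {measure set T -> \bar R}) (B : set T) (b A m0 q t : R) (g : T -> R) :
  measurable B -> M B = b%:E -> 0 < b -> 0 <= A -> 1 <= q ->
  measurable_fun setT g ->
  (\int[M]_(x in B) `|g x - m0|%:E <= (b * A)%:E)%E ->
  (\int[M]_(x in B) (`|g x - m0| `^ q)%:E <= (b * A `^ q)%:E)%E ->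
  t%:E = (b^-1%:E * \int[M]_(x in B) (g x)%:E)%E ->
  (\int[M]_(x in B) (`|g x - t| `^ q)%:E <= (b * (4 * A) `^ q)%:E)%E.
Proof.
move=> mB MB b0 A0 q1 mg h1 hq; set I := integral _ _ _ => /eqP tI.
have q0 : 0 <= q by apply: le_trans q1.
have mgc c : measurable_fun setT (fun x => g x - c).
  by apply: measurable_funB => //; exact: measurable_cst.
have mgcB c : measurable_fun B (EFin \o (fun x => g x - c)).
  by apply/measurable_EFinP; exact: measurable_funTS.
have mq c : measurable_fun B (fun x => (`|g x - c| `^ q)%:E).
  apply/measurable_EFinP/measurable_funTS.
  apply: (measurableT_comp (measurable_powR _)).
  exact: (measurableT_comp (@normr_measurable _ _) (mgc c)).
have igm : M.-integrable B (EFin \o (fun x => g x - m0)).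
  apply/integrableP; split => //.
  by apply: (le_lt_trans h1); rewrite ltry.
have icst : M.-integrable B (EFin \o (fun=> m0)).
  apply/integrableP; split; first exact: measurable_cst.
  by under eq_integral do rewrite /=; rewrite integral_cst// MB -EFinM ltry.
have ig : M.-integrable B (EFin \o g).
  have -> : EFin \o g = (EFin \o (fun x => g x - m0)) \+ (EFin \o (fun=> m0)).
    by apply/funext => x /=; rewrite -EFinD subrK.
  exact: integrableD.
have Ifin : I \is a fin_num by exact: integrable_fin_num.
have tE : t = b^-1 * fine I by move: tI; rewrite -(fineK Ifin) -EFinM eqe => /eqP.
have dist_t : `|m0 - t| <= A.
  have e1 : (\int[M]_(x in B) ((g x)%:E - m0%:E) = (fine I - m0 * b)%:E)%E.
    rewrite (@integralB_EFin _ _ _ M B g (fun=> m0))// -/I integral_cst// MB.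
    by rewrite EFinB fineK.
  have := le_abse_integral M mB (mgcB m0).
  under eq_integral do rewrite /= EFinB.
  rewrite e1 => h2.
  have {h2} : (`|(fine I - m0 * b)%:E| <= (b * A)%:E)%E.
    exact: (le_trans h2 h1).
  rewrite abse_EFin lee_fin => h2.
  rewrite -(ler_pM2l b0); apply: le_trans h2.
  rewrite -{1}(gtr0_norm b0) -normrM mulrBr tE mulVKf ?gt_eqF//.
  by rewrite distrC mulrC.
have mA c : measurable_fun B (fun x : T => c%:E : \bar R) by exact: measurable_cst.
apply: (@le_trans _ _ (\int[M]_(x in B) ((2 `^ q)%:E * ((`|g x - m0| `^ q)%:E + (A `^ q)%:E)))%E).
  apply: ge0_le_integral => //.
  - by apply: emeasurable_funM => //; exact: emeasurable_funD.
  - move=> x _; rewrite -EFinD -EFinM lee_fin.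
    have -> : g x - t = (g x - m0) + (m0 - t) by rewrite addrA subrK.
    apply: (le_trans (powR_normD_le _ _ q0)).
    rewrite ler_pM2l ?powR_gt0// lerD2l.
    by apply: ge0_ler_powR; rewrite ?nnegrE.
rewrite ge0_integralZl_EFin; last 4 first.
- by [].
- by move=> x _; rewrite adde_ge0// lee_fin powR_ge0.
- exact: emeasurable_funD.
- exact: powR_ge0.
rewrite ge0_integralD//; last by move=> x _; rewrite lee_fin powR_ge0.
rewrite integral_cst// MB.
apply: (@le_trans _ _ ((2 `^ q)%:E * ((b * A `^ q)%:E + (A `^ q)%:E * b%:E))%E).
  by apply: lee_wpmul2l; rewrite ?lee_fin ?powR_ge0//; exact: leeD.
rewrite -[((A `^ q)%:E * b%:E)%E]EFinM -EFinD -EFinM lee_fin.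
have -> : 4 * A = 2 * (2 * A) by rewrite mulrA -natrM.
rewrite [(2 * (2 * A)) `^ q]powRM ?mulr_ge0// [(2 * A) `^ q]powRM//.
have le2 : 2 <= 2 `^ q :> R.
  by rewrite -{1}(powRr1 (ler0n R 2)); apply: ler_powR => //; rewrite ler1n.
have P0 : 0 <= 2 `^ q * (b * A `^ q) by rewrite !mulr_ge0 ?powR_ge0// ltW.
have := ler_wpM2r P0 le2; move: (2 `^ q) (A `^ q) => x y.
have -> : x * (b * y + y * b) = 2 * (x * (b * y)).
  by rewrite [x * (_ + _)]mulrDr [y * b]mulrC [2 * _]mulr_natl mulr2n.
by rewrite [b * (x * _)]mulrCA [b * (x * y)]mulrCA.
Qed.

Section two_sided.
Context {R : realType} {X : completeMetricType R}.
Variables (mu : {outer_measure set X -> \bar R}) (D C0 Q CP tauP : R).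
Hypotheses (breg : borel_regular mu) (dbl : doubling mu D).
Hypotheses (lmb : relative_lower_mass_bound mu C0 Q) (C01 : 1 <= C0).
Hypothesis poi : poincare11 mu CP tauP.
Variables (th r0 : R).
Hypotheses (th0 : 0 < th) (th1 : th < 1) (r00 : 0 < r0).

Local Notation T := (caratheodory_type mu).
Local Notation m A := (fine (mu A)).
Local Notation M := (cara_measure mu).
Local Notation energy := (dyadic_energy breg dbl th r0).

Lemma energy_subr w (c : R) O : energy (fun x => w x - c) O = energy w O.
Proof.
by apply: eq_integral => xy _; congr (`| _ |%:E * _)%E; lra.
Qed.

Lemma energy_subl w (c : R) O : energy (fun x => c - w x) O = energy w O.
Proof.
apply: eq_integral => xy _; congr (_%:E * _)%E; rewrite distrC.
by congr `| _ |; lra.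
Qed.

(** The passage from the integral of the theorem to the energy, pointwise on [O * O]; both kernels
    contribute nothing on the diagonal because the values of [u] are the same there. *)
Lemma energy_le (u : X -> \bar R) (O : set T) : measurable O ->
  measurable_fun O u ->
  (energy (fun x => fine ((u \_ O) x)) O <=
   mint mu O (fun x => mint mu O (fun y => fractional_kernel mu th u x y)))%E.
Proof.
move=> mO mu_u; set g := fun x => fine ((u \_ O) x).
have mg : measurable_fun setT (g : T -> R).
  apply: (measurableT_comp (fine_measurable measurableT)).
  exact/(measurable_restrictT _ mO).
rewrite /dyadic_energy ge0_integral_setX//; last 2 first.
- apply: emeasurable_funM.
    by apply/measurable_EFinP; exact: measurable_energy_integrand.
  exact: (measurable_dyadic_kernel breg dbl lmb C01).
- by move=> z; rewrite mule_ge0 ?dyadic_kernel_ge0.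
apply: ge0_le_integral_ext => x Ox.
  by apply: integral_ge0 => y _; rewrite mule_ge0 ?dyadic_kernel_ge0.
apply: ge0_le_integral_ext => y Oy.
  by rewrite mule_ge0 ?dyadic_kernel_ge0.
rewrite /fractional_kernel /=; have [->|xy] := eqVneq x y.
  by rewrite subrr normr0 mul0e.
apply: lee_pmul.
- by rewrite lee_fin.
- exact: dyadic_kernel_ge0.
- rewrite /g !patchE !mem_set//.
  (* If [u x] or [u y] is infinite, then so is [u x - u y] by the conventions of extended
     arithmetic, even when both are the same infinity. *)
  by case: (u x) (u y) => [a| |] [b| |] //=; rewrite ?leey// abse_EFin lee_fin.
- exact: (dyadic_kernel_le dbl).
Qed.

Variables (p : nat) (Kc : R) (x0 : X).
Hypotheses (Kc0 : 0 < Kc) (hKc : 320 * CP * D ^+ 7 <= Kc).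
Hypotheses (hp : 2 * (tauP + 2) <= 2 ^+ p) (Q1 : 1 < Q).
Let B : set T := ball x0 (r0 / 2).
Let O : set T := ball x0 ((2 * tauP + 5) * (r0 / 2)).
Let N := m (ball x0 r0).
Let Z := D ^+ p * (C0 * (Kc * (2 * D ^+ 2)) * (1 - th) * r0 `^ th / N).

(** The one-sided estimate for [w - m0] and for [m0 - w]: the median property is exactly the
    half-density hypothesis at level 0 for both, and both have the energy of [w]. *)
Lemma two_sided_sobolev (q : R) (w : T -> R) (m0 : R) :
  1 <= q -> q <= Q / (Q - th) ->
  measurable_fun setT w ->
  2 * m ([set y | m0 < w y] `&` B) <= m B ->
  2 * m ([set y | w y < m0] `&` B) <= m B ->
  (energy w O < +oo)%E ->
  (\int[M]_(x in B) (`|w x - m0| `^ q)%:E <=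
   (2 * (N * (2 * (Z * fine (energy w O))) `^ q))%:E)%E.
Proof.
move=> q1 qQ mw h1 h2 fin.
have mB : measurable B by exact: (measurable_ball_cara breg).
have mO : measurable O by exact: (measurable_ball_cara breg).
have mw1 : measurable_fun setT (fun x => w x - m0).
  by apply: measurable_funB => //; exact: measurable_cst.
have mw2 : measurable_fun setT (fun x => m0 - w x).
  by apply: measurable_funB => //; exact: measurable_cst.
have E1 : superlevel (fun x => w x - m0) 0 = [set y | m0 < w y].
  by apply/seteqP; split => y; rewrite /superlevel/= subr_gt0.
have E2 : superlevel (fun x => m0 - w x) 0 = [set y | w y < m0].
  by apply/seteqP; split => y; rewrite /superlevel/= subr_gt0.
have mmax (v : T -> R) : measurable_fun setT v ->
    measurable_fun B (fun x => (Num.max (v x) 0 `^ q)%:E).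
  move=> mv; apply/measurable_EFinP/measurable_funTS.
  apply: (measurableT_comp (measurable_powR _)).
  by apply: measurable_maxr => //; exact: measurable_cst.
have I1 := @one_sided_sobolev _ _ mu D C0 Q CP tauP breg dbl lmb C01 poi
  th r0 th0 th1 r00 _ O mw1 mO p q Kc x0 Kc0 hKc hp Q1 q1 qQ erefl.
have I2 := @one_sided_sobolev _ _ mu D C0 Q CP tauP breg dbl lmb C01 poi
  th r0 th0 th1 r00 _ O mw2 mO p q Kc x0 Kc0 hKc hp Q1 q1 qQ erefl.
move: I1 I2; rewrite E1 E2 energy_subr energy_subl => /(_ h1 fin) I1 /(_ h2 fin) I2.
rewrite [2 * _]mulr_natl mulr2n EFinD; apply: le_trans (leeD I1 I2).
rewrite -ge0_integralD//; last 4 first.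
- by move=> x _; rewrite lee_fin powR_ge0.
- exact: mmax.
- by move=> x _; rewrite lee_fin powR_ge0.
- exact: mmax.
have q0 : q != 0 by rewrite gt_eqF// (lt_le_trans _ q1).
apply: ge0_le_integral_ext => x _; first by rewrite lee_fin powR_ge0.
rewrite -EFinD lee_fin; case: (leP m0 (w x)) => h.
  rewrite ger0_norm ?subr_ge0// [Num.max (w x - m0) 0]max_l ?subr_ge0//.
  by rewrite lerDl powR_ge0.
rewrite ltr0_norm ?subr_lt0// opprB [Num.max (m0 - w x) 0]max_l; last by rewrite subr_ge0 ltW.
by rewrite lerDr powR_ge0.
Qed.

Let D1 := D_ge1 dbl.
Let D0 : 0 < D. Proof. exact: lt_le_trans D1. Qed.
Let N0 : 0 < N. Proof. exact: (m_ball_gt0 dbl). Qed.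

Let Z0 : 0 < Z.
Proof.
rewrite /Z mulr_gt0 ?exprn_gt0// divr_gt0// mulr_gt0 ?powR_gt0//.
by rewrite mulr_gt0 ?subr_gt0// !mulr_gt0 ?exprn_gt0// (lt_le_trans _ C01).
Qed.

Lemma mint_fractional_kernel_ge0 (u : X -> \bar R) (A : set X) :
  (0 <= mint mu A (fun x => mint mu A (fun y => fractional_kernel mu th u x y)))%E.
Proof.
apply: integral_ge0 => x _; apply: integral_ge0 => y _; rewrite /fractional_kernel.
case: ifPn => // _; rewrite mule_ge0// lee_fin invr_ge0 mulr_ge0 ?powR_ge0//.
exact: m_ge0.
Qed.

Lemma fractional_sobolev_poincare (q : R) (u : X -> \bar R) :
  1 <= q -> q <= Q / (Q - th) -> L1loc mu u ->
  (poweR (mean mu B (fun x => poweR `|u x - mean mu B u| q)) q^-1 <=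
   (16 * D * Z)%:E *
   mint mu O (fun x => mint mu O (fun y => fractional_kernel mu th u x y)))%E.
Proof.
move=> q1 qQ lu; set J := mint mu O _.
have q0 : 0 < q by apply: lt_le_trans q1.
have J0 : (0 <= J)%E by exact: mint_fractional_kernel_ge0.
have K0 : 0 < 16 * D * Z by rewrite mulr_gt0// mulr_gt0.
have [->|Jfin] := eqVneq J +oo%E; first by rewrite gt0_muley ?lte_fin// leey.
have mB : measurable B by exact: (measurable_ball_cara breg).
have mO : measurable O by exact: (measurable_ball_cara breg).
have tauP1 : 1 <= tauP by case: poi.
have BO : B `<=` O.
  apply: le_ball; rewrite ler_peMl ?divr_ge0 ?ltW//.
  by move: tauP1; lra.
have iuO : M.-integrable O u by exact: (L1loc_ball breg dbl lmb C01).
have iu : M.-integrable B u by exact: (L1loc_ball breg dbl lmb C01).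
have muO : measurable_fun O u by exact: measurable_int iuO.
have muB : measurable_fun B u by exact: measurable_int iu.
pose g (x : T) := fine ((u \_ O) x).
have mg : measurable_fun setT g.
  apply: (measurableT_comp (fine_measurable measurableT)).
  exact/(measurable_restrictT _ mO).
have enJ : (energy g O <= J)%E by exact: energy_le.
have en0 : (0 <= energy g O)%E.
  by apply: integral_ge0 => z _; rewrite mule_ge0 ?dyadic_kernel_ge0.
have fin : (energy g O < +oo)%E by apply: (le_lt_trans enJ); rewrite ltey.
have r20 : 0 < r0 / 2 by rewrite divr_gt0.
have [m0 [h1 h2]] := median_exists breg dbl x0 r20 mg.
pose e := fine (energy g O).
have e0 : 0 <= e by exact: fine_ge0.
have eE : energy g O = e%:E by rewrite /e fineK// ge0_fin_numE.
pose b := m B.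
have b0 : 0 < b by exact: (m_ball_gt0 dbl).
have Bb : mu B = b%:E by exact: (mu_ballE dbl).
have Nb : N <= D * b.
  by have := m_ball_double dbl x0 r20; rewrite (_ : 2 * (r0 / 2) = r0)//; lra.
have Ze0 : 0 <= Z * e by rewrite mulr_ge0// ltW.
(* The factor 2 for the two sides and [D] for [N <= D * b] are moved under the power by
   [2 * D <= (2 * D)^s]. With the factor 4 of [mean_oscillation_le] this makes the constant
   [16 * D * Z]. *)
pose A := 2 * D * (2 * (Z * e)).
have A0 : 0 <= A by rewrite /A; apply: mulr_ge0; apply: mulr_ge0 => //; exact: ltW.
have bound s : 1 <= s -> s <= Q / (Q - th) ->
    (\int[M]_(x in B) (`|g x - m0| `^ s)%:E <= (b * A `^ s)%:E)%E.
  move=> s1 sQ; apply: (le_trans (two_sided_sobolev s1 sQ mg h1 h2 fin)).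
  have AE : A `^ s = (2 * D) `^ s * (2 * (Z * e)) `^ s.
    by rewrite /A powRM//; apply: mulr_ge0 => //; exact: ltW.
  rewrite lee_fin AE -/e [2 * (N * _)]mulrA [b * (_ * _)]mulrA.
  apply: ler_wpM2r; first exact: powR_ge0.
  have le2D : 2 * D <= (2 * D) `^ s.
    rewrite -{1}[2 * D]powRr1 ?mulr_ge0 ?(ltW D0)//; apply: ler_powR => //.
    by move: D1; lra.
  apply: (@le_trans _ _ (b * (2 * D))).
    by rewrite mulrC [leRHS]mulrCA mulrC ler_pM2l// mulrC.
  by rewrite ler_pM2l.
have bound1 : (\int[M]_(x in B) `|g x - m0|%:E <= (b * A)%:E)%E.
  have := bound 1 (lexx _) (le_trans q1 qQ); rewrite powRr1//.
  by under eq_integral do rewrite powRr1//.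
(* [g] is real valued and measurable on the whole space; it agrees with [u] wherever [u] is finite,
   thus almost everywhere by integrability. *)
have ugO : ae_eq M B u (EFin \o g).
  have := integrable_ae mO iuO; apply: filterS => x hx Bx.
  by rewrite /g/= patchE mem_set ?fineK//; [apply: hx|]; exact: BO.
have mgB : measurable_fun B (EFin \o g).
  by apply/measurable_EFinP; exact: measurable_funTS.
have Ifin : mint mu B u \is a fin_num by exact: integrable_fin_num.
pose t := b^-1 * fine (mint mu B u).
have meanE : mean mu B u = t%:E by rewrite /mean Bb/= EFinM fineK.
have tE : t%:E = (b^-1%:E * \int[M]_(x in B) (g x)%:E)%E.
  by rewrite -meanE /mean Bb /mint (@ae_eq_integral _ _ _ M B (EFin \o g) u mB muB mgB ugO).
have osc := mean_oscillation_le mB Bb b0 A0 q1 mg bound1 (bound q q1 qQ) tE.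
rewrite meanE /mean Bb/= /mint.
rewrite (@ae_eq_integral _ _ _ M B (fun x => (`|g x - t| `^ q)%:E))//; last 3 first.
- apply: (measurableT_comp (measurable_poweR q)).
  apply: (measurableT_comp (@abse_measurable _ _)).
  by apply: emeasurable_funD => //; exact: measurable_cst.
- apply/measurable_EFinP/measurable_funTS.
  apply: (measurableT_comp (measurable_powR _)).
  apply: (measurableT_comp (@normr_measurable _ _)).
  by apply: measurable_funB => //; exact: measurable_cst.
- move: ugO; apply: filterS => x hx Bx; by rewrite hx.
set I1 := integral _ _ _ in osc *.
have I10 : (0 <= I1)%E by apply: integral_ge0 => x _; rewrite lee_fin powR_ge0.
apply: (@le_trans _ _ (poweR ((4 * A) `^ q)%:E q^-1)).
  apply: gt0_ler_poweR.
  - by rewrite invr_ge0 ltW.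
  - by rewrite in_itv/= leey andbT mule_ge0// lee_fin invr_ge0 ltW.
  - by rewrite in_itv/= leey andbT lee_fin powR_ge0.
  apply: (@le_trans _ _ (b^-1%:E * (b * (4 * A) `^ q)%:E)%E).
    by apply: lee_wpmul2l => //; rewrite lee_fin invr_ge0 ltW.
  by rewrite -EFinM lee_fin mulKf ?gt_eqF.
rewrite poweR_EFin -powRrM mulfV ?gt_eqF// powRr1; last exact: mulr_ge0.
have ring4 (d z y : R) : 4 * (2 * d * (2 * (z * y))) = 16 * d * z * y by ring.
rewrite /A ring4 EFinM.
by apply: lee_wpmul2l; rewrite -?eE// lee_fin ltW.
Qed.

End two_sided.

(** * Constants uniform in [th] and [q] *)

Lemma sobolev_constant_le (R : realType) (D S th r N V : R) (p : nat) :
  1 <= D -> 0 <= S -> 0 < th -> th < 1 -> 0 < r -> 0 < N -> 0 < V ->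
  V <= D ^+ p * N ->
  16 * D * (D ^+ p * (S * (1 - th) * (2 * r) `^ th / N)) <=
  16 * D * (D ^+ p * S) * (2 * D ^+ p) * (1 - th) * r `^ th * V^-1.
Proof.
move=> D1 S0 th0 th1 r0 N0 V0 VN.
have D0 : 0 <= D by exact: le_trans D1.
(* Two changes of normalisation: the mass of [ball x0 (2 * r)] is traded for that of the large ball
   by doubling, and [(2 * r)^th] for [r^th] with the factor 2, as [th <= 1]. *)
have hN : N^-1 <= D ^+ p / V by rewrite ler_pdivlMr// mulrC ler_pdivrMr.
have h2 : (2 * r) `^ th <= 2 * r `^ th.
  rewrite powRM//; last exact: ltW.
  rewrite ler_pM2r ?powR_gt0// -[leRHS]powRr1//.
  by apply: ler_powR; [rewrite ler1n|exact: ltW].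
have := ler_pM (powR_ge0 _ _) (ltW (_ : 0 < N^-1)) h2 hN; rewrite invr_gt0 => /(_ N0).
set E := (2 * r) `^ th; set F := r `^ th => h.
have G0 : 0 <= 16 * D * (D ^+ p * S) * (1 - th).
  by rewrite !mulr_ge0 ?exprn_ge0// subr_ge0 ltW.
have := ler_wpM2l G0 h; move: (D ^+ p) (N^-1) (V^-1) => d n v.
rewrite [X in X <= _ -> _](_ : _ = 16 * D * (d * (S * (1 - th) * E * n))); last by ring.
by rewrite [X in _ <= X -> _](_ : _ = 16 * D * (d * S) * (2 * d) * (1 - th) * F * v)//; ring.
Qed.

Theorem theorem1p1 (R : realType) (C0 Qd : R -> R)
    (hC0 : forall c : R, 1 <= c -> 1 <= C0 c)
    (hQd : forall c : R, 1 <= c -> 1 < Qd c)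
    (Cmu CP tauP : R) :
  exists C tau : R, [/\ 1 <= C, 1 <= tau &
    forall (X : completeMetricType R) (mu : {outer_measure set X -> \bar R}),
      borel_regular mu ->
      doubling mu Cmu ->
      relative_lower_mass_bound mu (C0 Cmu) (Qd Cmu) ->
      poincare11 mu CP tauP ->
    forall theta q : R,
      0 < theta -> theta < 1 ->
      1 <= q -> q <= Qd Cmu / (Qd Cmu - theta) ->
    forall (x0 : X) (r : R), 0 < r ->
    forall u : X -> \bar R, L1loc mu u ->
      (poweR (mean mu (ball x0 r)
                (fun x => poweR `|u x - mean mu (ball x0 r) u| q)) (q^-1)%R
       <= (C * (1 - theta) * r `^ theta)%:E *
          mean mu (ball x0 (tau * r))
            (fun x => mint mu (ball x0 (tau * r))
                        (fun y => fractional_kernel mu theta u x y)))%E].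
Proof.
(* The witnesses precede the space: when the parameters exclude every space, any values serve. *)
have [[D1 CP1 tauP1]|bad] := pselect [/\ 1 <= Cmu, 1 <= CP & 1 <= tauP]; last first.
  by exists 1, 1; split => // X mu _ [? _] _ [? ? _]; exfalso; apply: bad; split.
have [p hp] : exists p : nat, 2 * (tauP + 2) <= 2 ^+ p.
  exists (Num.bound (2 * (tauP + 2))).
  have h0 : 0 <= 2 * (tauP + 2) by move: tauP1; lra.
  apply: (le_trans (ltW (archi_boundP h0))).
  by rewrite -natrX ler_nat; apply: ltnW; apply: ltn_expl.
have [Kc [Kc0 hKc]] : exists Kc, 0 < Kc /\ 320 * CP * Cmu ^+ 7 <= Kc.
  exists (320 * CP * Cmu ^+ 7); split; last exact: lexx.
  apply: mulr_gt0; last by rewrite exprn_gt0// (lt_le_trans _ D1).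
  by apply: mulr_gt0; [rewrite ltr0n|exact: lt_le_trans CP1].
have C01 := hC0 _ D1; have Q1 := hQd _ D1.
pose S := C0 Cmu * (Kc * (2 * Cmu ^+ 2)).
have S0 : 0 <= S.
  rewrite /S; apply: mulr_ge0; first exact: le_trans C01.
  by apply: mulr_ge0; [exact: ltW|rewrite mulr_ge0// exprn_ge0// (le_trans _ D1)].
pose K := 16 * Cmu * (Cmu ^+ p * S) * (2 * Cmu ^+ p).
(* [K] contains neither [theta] nor [q]. The dilation is that of [O] relative to [B], the top scale
   being [r0 = 2 * r]. *)
exists (Num.max 1 K), (2 * tauP + 5); split.
- by rewrite le_max lexx.
- by move: tauP1; lra.
move=> X mu breg dbl lmb poi th q th0 th1 q1 qQ x0 r r0 u lu.
have r20 : 0 < 2 * r by rewrite mulr_gt0.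
have rE : 2 * r / 2 = r by rewrite mulrAC mulfV// mul1r.
have := fractional_sobolev_poincare breg dbl lmb C01 poi th0 th1 r20 x0 Kc0 hKc hp Q1 q1 qQ lu.
rewrite rE; set O := ball x0 ((2 * tauP + 5) * r) => h; apply: (le_trans h).
have V0 : 0 < fine (mu O).
  apply: (m_ball_gt0 dbl); rewrite mulr_gt0//; move: tauP1; lra.
have N0 : 0 < fine (mu (ball x0 (2 * r))) by exact: (m_ball_gt0 dbl).
(* The same [p] serves again, since [2 * tauP + 5 <= 4 * (tauP + 2) <= 2 * 2 ^+ p]. *)
have VN : fine (mu O) <= Cmu ^+ p * fine (mu (ball x0 (2 * r))).
  apply: (m_ball_le dbl) => //; rewrite mdistxx add0r mulrA ler_pM2r//.
  by move: hp tauP1; set P := 2 ^+ p; lra.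
rewrite /mean muleA -EFinM; apply: lee_wpmul2r; first exact: mint_fractional_kernel_ge0.
rewrite lee_fin; apply: (le_trans (sobolev_constant_le D1 S0 th0 th1 r0 N0 V0 VN)).
rewrite -/K ler_pM2r ?invr_gt0// ler_pM2r ?powR_gt0// ler_pM2r ?subr_gt0//.
by rewrite le_max lexx orbT.
Qed.
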